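(* Let $n\ge 3$ and let $a,b$ be real numbers with $a<n$, $b<n$. Let $\mathbf X$ be an i.i.d. sample of size $n$ from the bivariate normal distribution with parameters $(\mu_1,\mu_2,\sigma_1,\sigma_2,\rho)$, use the prior $\pi_{ab}$, and let $\theta_4=\sigma_2\sqrt{1-\rho^2}/\sigma_1$. (a) The posterior distribution of $\theta_4$ given $\mathbf X$ is the distribution (with the data held fixed) of $$\theta_4^*=\sqrt{\frac{\chi^{2*}_{n-a}}{\chi^{2*}_{n-b}}}\,\sqrt{\frac{s_{22}(1-r^2)}{s_{11}}}.$$ (b) For every $\alpha\in(0,1)$, $\boldsymbol\xi=(\mu_1,\mu_2,\sigma_1,\sigma_2)$ and $\rho\in(-1,1)$, $$P(\theta_4<(\theta_4^* )_{1-\alpha}\mid\boldsymbol\xi,\rho)=P\left(\chi^2_{n-1}/\chi^2_{n-2}<(\chi^{2*}_{n-a}/\chi^{2*}_{n-b})_{1-\alpha}\right),$$ which does not depend on $\rho$. Furthermore, this quantity equals $1-\alpha$ for all $\alpha\in(0,1)$ if and only if $(a,b)=(1,2)$.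
   Context: Model: $\mathbf x_k=(x_{1k},x_{2k})'$, $k=1,\dots,n$, are i.i.d. bivariate normal with mean $(\mu_1,\mu_2)'\in\mathbb R^2$ and covariance matrix $\boldsymbol\Sigma=\begin{pmatrix}\sigma_1^2&\rho\sigma_1\sigma_2\\ \rho\sigma_1\sigma_2&\sigma_2^2\end{pmatrix}$, $\sigma_1,\sigma_2>0$, $|\rho|<1$. Statistics: $\overline x_i=n^{-1}\sum_k x_{ik}$, $s_{ij}=\sum_k(x_{ik}-\overline x_i)(x_{jk}-\overline x_j)$, $r=s_{12}/\sqrt{s_{11}s_{22}}$ (with $|r|<1$ almost surely). Prior: $\pi_{ab}$ is the (improper) density, with respect to $d\mu_1\,d\mu_2\,d\sigma_1\,d\sigma_2\,d\rho$, $$\pi_{ab}(\mu_1,\mu_2,\sigma_1,\sigma_2,\rho)=\frac{1}{\sigma_1^{3-a}\sigma_2^{2-b}(1-\rho^2)^{2-b/2}},$$ and the posterior given $\mathbf X$ is the normalized product of likelihood and prior (proper when $a<n$, $b<n$). Random variables: $\chi^2_m$ and $\chi^{2*}_m$ denote chi-squared random variables with $m$ (real, positive) degrees of freedom, i.e. Gamma with shape $m/2$ and rate $1/2$; $\chi^2_{n-1},\chi^2_{n-2},\chi^{2*}_{n-a},\chi^{2*}_{n-b}$ are mutually independent (four separate variables, even if $a=b$). Quantiles: $(W)_{\beta}$ denotes the $\beta$ quantile of $W$ with respect to the distribution of the starred variables only, all non-starred quantities (in particular the data) being held fixed; so $(\theta_4^* )_{1-\alpha}$ is a function of $\mathbf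 X$, the posterior $1-\alpha$ quantile of $\theta_4$. Frequentist coverage: $P(\cdot\mid\boldsymbol\xi,\rho)$ is probability under the sampling distribution of $\mathbf X$ with the parameters fixed. *)

(* Defs.v *)
From mathcomp Require Export all_boot all_order all_algebra.
From mathcomp Require Export all_classical all_reals all_analysis.
From mathcomp Require Export measurable_realfun.

Set Implicit Arguments.
Unset Strict Implicit.
Unset Printing Implicit Defensive.

Import Order.TTheory GRing.Theory Num.Theory.
Import numFieldNormedType.Exports.

Local Open Scope classical_set_scope.
Local Open Scope ring_scope.

Definition mutually_independent d d' (T : measurableType d)
    (T' : measurableType d') (R : realType) (P : probability T R)
    (I : finType) (X : I -> {RV P >-> T'}) : Prop :=
  forall (J : {set I}) (B : I -> set T'), (forall i, measurable (B i)) ->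
    P (\bigcap_(i in [set` J]) (X i @^-1` B i)) =
    (\prod_(i in J) P (X i @^-1` B i))%E.

(* Chi-squared with a real number m > 0 of degrees of freedom,
   as Gamma(m / 2, rate 1 / 2). *)

Definition Gamma_fun (R : realType) (a : R) : R :=
  \int[lebesgue_measure]_(t in `]0%R, +oo[) (t `^ (a - 1) * expR (- t)).

Definition gamma_pdf (R : realType) (shape rate t : R) : R :=
  rate `^ shape / Gamma_fun shape * t `^ (shape - 1) * expR (- rate * t).

Definition is_gamma d (T : measurableType d) (R : realType)
    (P : probability T R) (W : {RV P >-> R}) (shape rate : R) : Prop :=
  forall B : set R, measurable B ->
    distribution P W B =
    (\int[lebesgue_measure]_(t in B `&` `]0%R, +oo[)
       (gamma_pdf shape rate t)%:E)%E.

Definition is_chi2 d (T : measurableType d) (R : realType)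
    (P : probability T R) (W : {RV P >-> R}) (m : R) : Prop :=
  is_gamma W (m / 2) (1 / 2).

(* Meaningful for 0 < beta < 1, where the set below is nonempty and bounded
   from below. *)
Definition quantile d (T : measurableType d) (R : realType)
    (P : probability T R) (W : T -> R) (beta : R) : R :=
  inf [set q : R | (beta%:E <= P [set w | (W w <= q)%R])%E].

Definition covmx (R : realType) (sigma1 sigma2 rho : R) : 'M[R]_2 :=
  \matrix_(i < 2, j < 2)
    if i == j then (if i == ord0 then sigma1 ^+ 2 else sigma2 ^+ 2)
    else rho * sigma1 * sigma2.

(* Sample points are pairs rather than vectors of type 'cV[R]_2 because
   R * R carries the product sigma-algebra and the measure
   lebesgue_measure \x lebesgue_measure. *)
Definition binormal_pdf (R : realType) (mean : R * R) (Sigma : 'M[R]_2)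
    (z : R * R) : R :=
  let v : 'cV[R]_2 :=
    \col_(i < 2) if i == ord0 then z.1 - mean.1 else z.2 - mean.2 in
  (2 * pi * Num.sqrt (\det Sigma))^-1 *
  expR (- ((v^T *m invmx Sigma *m v) ord0 ord0 / 2)).

Definition is_binormal d (T : measurableType d) (R : realType)
    (P : probability T R) (Z : {RV P >-> (R * R)%type})
    (mean : R * R) (Sigma : 'M[R]_2) : Prop :=
  forall B : set (R * R), measurable B ->
    distribution P Z B =
    (\int[lebesgue_measure \x lebesgue_measure]_(z in B)
       (binormal_pdf mean Sigma z)%:E)%E.

(* (mu1, mu2, sigma1, sigma2, rho). The factors are measurableTypeR R (that is,
   R with its Borel sigma-algebra) because this is the type on which
   lebesgue_measure is a measure. *)
Notation param R :=
  (measurableTypeR R * measurableTypeR R * measurableTypeR R *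
   measurableTypeR R * measurableTypeR R)%type.

Definition p_mu1 (R : realType) (t : param R) : R := t.1.1.1.1.
Definition p_mu2 (R : realType) (t : param R) : R := t.1.1.1.2.
Definition p_sigma1 (R : realType) (t : param R) : R := t.1.1.2.
Definition p_sigma2 (R : realType) (t : param R) : R := t.1.2.
Definition p_rho (R : realType) (t : param R) : R := t.2.

Definition param_space (R : realType) : set (param R) :=
  [set t | [/\ 0 < p_sigma1 t, 0 < p_sigma2 t & -1 < p_rho t < 1]].

Definition theta4 (R : realType) (t : param R) : R :=
  p_sigma2 t * Num.sqrt (1 - p_rho t ^+ 2) / p_sigma1 t.

Definition model_pdf (R : realType) (t : param R) : R * R -> R :=
  binormal_pdf (p_mu1 t, p_mu2 t) (covmx (p_sigma1 t) (p_sigma2 t) (p_rho t)).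

Definition is_normal_sample d (T : measurableType d) (R : realType)
    (P : probability T R) (n : nat) (X : 'I_n -> {RV P >-> (R * R)%type})
    (t : param R) : Prop :=
  mutually_independent X /\
  forall k, is_binormal (X k) (p_mu1 t, p_mu2 t)
              (covmx (p_sigma1 t) (p_sigma2 t) (p_rho t)).

Section statistics.
Context (R : realType) (n : nat) (x : 'I_n -> R * R).

Definition xbar1 : R := n%:R^-1 * \sum_(k < n) (x k).1.
Definition xbar2 : R := n%:R^-1 * \sum_(k < n) (x k).2.
Definition s11 : R := \sum_(k < n) ((x k).1 - xbar1) ^+ 2.
Definition s22 : R := \sum_(k < n) ((x k).2 - xbar2) ^+ 2.
Definition s12 : R := \sum_(k < n) ((x k).1 - xbar1) * ((x k).2 - xbar2).
Definition corr : R := s12 / Num.sqrt (s11 * s22).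

Definition nondegenerate : Prop := [/\ 0 < s11, 0 < s22 & `|corr| < 1].

Definition likelihood (t : param R) : R := \prod_(k < n) model_pdf t (x k).

End statistics.

Definition prior (R : realType) (a b : R) (t : param R) : R :=
  (p_sigma1 t `^ (3 - a) * p_sigma2 t `^ (2 - b) *
   (1 - p_rho t ^+ 2) `^ (2 - b / 2))^-1.

Definition param_measure (R : realType) : set (param R) -> \bar R :=
  (lebesgue_measure \x lebesgue_measure \x lebesgue_measure
     \x lebesgue_measure \x lebesgue_measure)%E.

Definition unnormalized_posterior (R : realType) (n : nat) (a b : R)
    (x : 'I_n -> R * R) (A : set (param R)) : \bar R :=
  (\int[@param_measure R]_(t in A `&` @param_space R)
     (likelihood x t * prior a b t)%:E)%E.

(* If the posterior is improper (total mass 0 or +oo), the value at setT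
   is 0, so that this is not a probability. *)
Definition posterior (R : realType) (n : nat) (a b : R)
    (x : 'I_n -> R * R) (A : set (param R)) : \bar R :=
  (unnormalized_posterior a b x A / unnormalized_posterior a b x setT)%E.

(* u and v stand for the values of the chi-squared variables with n - a and
   n - b degrees of freedom. *)
Definition theta4_star (R : realType) (n : nat) (x : 'I_n -> R * R)
    (u v : R) : R :=
  Num.sqrt (u / v) * Num.sqrt (s22 x * (1 - corr x ^+ 2) / s11 x).

(* Main.v *)
From HB Require Import structures.
Require Import Defs.
From mathcomp Require Import ring lra.

(* Sampling: a new observation, standardized to (e, f) with independent standard
   normal coordinates, is first rotated against the running mean; its component
   orthogonal to the mean then updates the sums of squares and products by a
   second rotation, which turns (S_ee, S_ff - S_ef^2 / S_ee) into the same pair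
   with one more degree of freedom.  By induction s11 / sigma1^2 and
   s22 (1 - r^2) / (sigma2^2 (1 - rho^2)) are independent chi-squared variables
   with n - 1 and n - 2 degrees of freedom.  Since theta < quantile iff the
   distribution function at theta is below the level, the event in (b) becomes
   an event on their ratio.

   Exact coverage at all levels forces U / V and Ua / Vb to have the same law.
   As P(U / V <= y) has order y^(m/2) at 0, m being the degrees of freedom of the
   numerator, comparing the small balls of the ratios, and then those of their
   inverses, identifies both degrees of freedom.

   Posterior: the means integrate to Gaussian constants.  In the coordinates
   s = sigma1, t = sigma2 sqrt(1 - rho^2), y = rho / sqrt(1 - rho^2) the powers of
   1 - rho^2 in the prior cancel against the Jacobian, and the integral over y is
   Gaussian.  What remains is a product of two inverse chi densities in s and t,
   and theta4 = t / s. *)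

Set Implicit Arguments.
Unset Strict Implicit.
Unset Printing Implicit Defensive.

Import Order.TTheory GRing.Theory Num.Theory.
Import numFieldNormedType.Exports.

Local Open Scope classical_set_scope.
Local Open Scope ring_scope.

(** No Jacobian of several variables occurs: every such change of variables is split under Tonelli
    into monotone substitutions of one variable. Rotations therefore come with a positive cosine,
    and the standardizing map is taken triangular. No value of the Gamma function is computed
    either. A law enters as [K] times an explicit kernel; total mass one shows that [K] is positive
    and makes any two constants for the same kernel equal.

    The update of the sums of squares divides by a square root that vanishes when the first two
    observations share their first coordinate, so its algebra is valid only off a null set.

    In the converse of the last claim, exactness relates a strict event for one ratio to a
    non-strict event for the other; the small-ball bounds are stated so as to fit this mixture.

    The different exponents 3 - a and 2 - b in the prior balance the integral over y: the regression
    slope is y t / s, so the Gaussian in y has width proportional to s, which raises the power of s,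
    and not that of t, by one. *)

(** * Measures with densities and their uniqueness *)

Definition pushforward_measure d1 d2 (T1 : measurableType d1) (T2 : measurableType d2)
    (R : realType) (m : {measure set T1 -> \bar R}) (f : T1 -> T2)
    (mf : measurable_fun setT f) : {measure set T2 -> \bar R}.
Proof. by refine (@Measure.clone _ _ _ (pushforward m f) _); exact: mf. Defined.

(** The proofs [mg] and [g0] are arguments so that the measure structure declared below can be
    inferred from the term [density mu mg g0]. *)
Definition density d (T : measurableType d) (R : realType)
  (mu : {measure set T -> \bar R}) (g : T -> \bar R)
  (mg : measurable_fun setT g) (g0 : forall x, (0 <= g x)%E) (A : set T) : \bar R :=
  (\int[mu]_(x in A) g x)%E.

Section density_measure.
Local Open Scope ereal_scope.
Context d (T : measurableType d) (R : realType).
Variables (mu : {measure set T -> \bar R}) (g : T -> \bar R).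
Hypotheses (mg : measurable_fun setT g) (g0 : forall x, 0 <= g x).

Local Notation nu := (density mu mg g0).

Let density0 : nu set0 = 0. Proof. exact: integral_set0. Qed.

Let density_ge0 A : 0 <= nu A.
Proof. by apply: integral_ge0 => x _; exact: g0. Qed.

Let density_sigma_additive : semi_sigma_additive nu.
Proof.
move=> F mF tF mUF; rewrite /density ge0_integral_bigcup//.
- by apply: is_cvg_ereal_nneg_natsum => n _; exact: density_ge0.
- exact: measurable_funTS.
Qed.

HB.instance Definition _ := isMeasure.Build _ _ _ nu
  density0 density_ge0 density_sigma_additive.

End density_measure.

Section integral_density.
Local Open Scope ereal_scope.
Context d (T : measurableType d) (R : realType).
Import HBNNSimple.

Lemma ge0_integral_density (mu nu : {measure set T -> \bar R}) (g : T -> R) (f : T -> \bar R) :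
  measurable_fun setT g -> (forall x, 0 <= g x)%R ->
  (forall B, measurable B -> nu B = \int[mu]_(x in B) (g x)%:E) ->
  measurable_fun setT f -> (forall x, 0 <= f x) ->
  \int[nu]_x f x = \int[mu]_x (f x * (g x)%:E).
Proof.
move=> mg g0 nuE mf f0.
have mgE : measurable_fun setT (EFin \o g) by exact/measurable_EFinP.
have gE0 x : 0 <= (g x)%:E by rewrite lee_fin.
pose f_ := nnsfun_approx measurableT mf.
have cf x : (f_ n x)%:E @[n --> \oo] --> f x by exact: cvg_nnsfun_approx.
have ndf x : {homo (fun n => (f_ n x)%:E) : m n / (m <= n)%N >-> m <= n}.
  by move=> m n mn; rewrite lee_fin; exact/lefP/nd_nnsfun_approx.
have mfn n : measurable_fun setT (EFin \o f_ n) by exact/measurable_EFinP.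
transitivity (limn (fun n => \int[nu]_x (f_ n x)%:E)).
  rewrite -monotone_convergence//.
  - by apply: eq_integral => x _; apply/esym/cvg_lim.
  - by move=> n x _; rewrite lee_fin.
transitivity (limn (fun n => \int[mu]_x ((f_ n x)%:E * (g x)%:E))); last first.
  rewrite -monotone_convergence//.
  - by apply: eq_integral => x _; apply/cvg_lim => //; apply: cvgeZr => //; exact: cf.
  - by move=> n; apply: emeasurable_funM => //; exact: mfn.
  - by move=> n x _; rewrite mule_ge0// lee_fin.
  - by move=> x _ m n mn; rewrite lee_wpmul2r//; exact: ndf.
congr (limn _); apply/funext => n.
(* For a simple function both sides are finite sums over its fibres, and on each fibre the
   hypothesis on [nu] applies. *)
under eq_integral do rewrite fimfunE -fsumEFin//.
rewrite ge0_integral_fsum//; last 2 first.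
- by move=> y; exact/measurable_EFinP/measurable_funM.
- by move=> y x _; rewrite nnfun_muleindic_ge0.
under [RHS]eq_integral => x _.
  rewrite fimfunE -fsumEFin// ge0_mule_fsuml; last first.
    by move=> r; rewrite nnfun_muleindic_ge0.
  over.
rewrite [RHS]ge0_integral_fsum//; last 2 first.
- move=> y; apply: emeasurable_funM => //.
  exact/measurable_EFinP/measurable_funM.
- by move=> y x _; rewrite mule_ge0// nnfun_muleindic_ge0.
apply: eq_fsbigr => r _; rewrite integralZl_indic_nnsfun// integral_indic//= setIT.
have mA : measurable (f_ n @^-1` [set r]) by [].
rewrite nuE// integral_mkcond.
have [r0|r0] := leP 0%R r; last first.
  by rewrite preimage_nnfun0// patch_set0 integral_cst// mul0e mule0
    integral0_eq// => x _; rewrite indic0 mulr0 mul0e.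
rewrite -ge0_integralZl_EFin//; last 2 first.
- by move=> x _; rewrite patchE; case: ifP.
- by apply/(measurable_restrictT _ _).1 => //; exact: measurable_funTS.
apply: eq_integral => x _.
by rewrite patchE indicE; case: ifP => _; rewrite ?mulr1// mulr0 mul0e mule0.
Qed.

End integral_density.

(** Rectangles are closed under intersection, generate the product sigma-algebra and include the
    whole space. *)
Lemma measure_rectangles_unique d1 d2 (T1 : measurableType d1) (T2 : measurableType d2)
    (R : realType) (m1 m2 : {measure set (T1 * T2) -> \bar R}) :
  (m1 setT < +oo)%E ->
  (forall A B, measurable A -> measurable B -> m1 (A `*` B) = m2 (A `*` B)) ->
  forall X, measurable X -> m1 X = m2 X.
Proof.
move=> m1oo m12 X mX.
apply: (measure_unique [set A `*` B | A in measurable & B in measurable]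
  (fun=> setT)) => //.
- exact: measurable_prod_measurableType.
- move=> _ _ [A mA [B mB <-]] [A' mA' [B' mB' <-]].
  exists (A `&` A'); first exact: measurableI.
  by exists (B `&` B'); [exact: measurableI|rewrite setXI].
- by move=> _; exists setT => //; exists setT => //; rewrite setXTT.
- by rewrite bigcup_const//; exists 0%N.
- by move=> _ [A mA [B mB <-]]; exact: m12.
Qed.

(** * Substitution in Lebesgue integrals *)

Section substitution.
Context (R : realType).
Notation mu := (@lebesgue_measure R).
Local Open Scope ereal_scope.

(** The measure with density [dphi] on [I], pushed forward along [phi], gives each half-open
    interval its length by the fundamental theorem of calculus, hence is Lebesgue measure. The
    theorem is applied only on the compact intervals from [psi a] to [psi b], so [I] may be open or
    unbounded and [f] merely measurable. *)
Lemma ge0_integral_increasing_substitution (I : set R) (phi psi dphi : R -> R) :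
  measurable I -> (is_interval I) ->
  (forall y, I (psi y)) -> {in I, cancel phi psi} -> cancel psi phi ->
  {in I &, {homo phi : x y / (x < y)%R}} ->
  measurable_fun setT phi -> measurable_fun I dphi ->
  {in I, forall x, (0 <= dphi x)%R} ->
  {in I, forall x : R, is_derive x 1%R phi (dphi x)} ->
  {in I, continuous dphi} ->
  forall f : R -> \bar R, measurable_fun setT f -> (forall y, 0 <= f y) ->
  \int[mu]_y f y = \int[mu]_(x in I) (f (phi x) * (dphi x)%:E).
Proof.
move=> mI itvI Ipsi phiK psiK phi_lt mphi mdphi dphi0 Dphi cdphi f mf f0.
pose g := (dphi \_ I)%R.
have mg : measurable_fun setT g by apply/(measurable_restrictT _ _).1.
have g0 x : (0 <= g x)%R.
  by rewrite /g patchE; case: ifPn => // xI; exact: dphi0.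
have mgE : measurable_fun setT (EFin \o g) by exact/measurable_EFinP.
have gE0 x : 0 <= (EFin \o g) x by rewrite lee_fin.
pose nu : {measure set _ -> \bar R} := density mu mgE gE0.
have psi_lt : {homo psi : x y / (x < y)%R}.
  move=> x y xy; rewrite ltNge; apply/negP; rewrite le_eqVlt => /predU1P[e|yx].
    by move: xy; rewrite -(psiK x) -(psiK y) e ltxx.
  have := phi_lt _ _ (mem_set (Ipsi y)) (mem_set (Ipsi x)) yx.
  by rewrite !psiK => /(lt_trans xy); rewrite ltxx.
have mphi' : measurable_fun setT (phi : measurableTypeR R -> measurableTypeR R) by exact: mphi.
transitivity (\int[pushforward_measure nu mphi']_y f y).
  apply: eq_measure_integral => A mA _; apply: lebesgue_measure_unique => //.
  move=> _ [[a b] _ <-] /=; rewrite /pushforward /nu /= /density.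
  rewrite lebesgue_measure_itv/= lte_fin; case: ltP => ab; last first.
    by rewrite set_itv_ge ?preimage_set0 ?integral_set0// bnd_simp -leNgt.
  have pab : (psi a < psi b)%R by exact: psi_lt.
  have subI : `[psi a, psi b]%classic `<=` I.
    move=> x; rewrite /= in_itv/= => /andP[ax xb].
    by apply: (itvI _ _ (Ipsi a) (Ipsi b)); rewrite ax xb.
  transitivity (\int[mu]_(x in (phi @^-1` `]a, b]) `&` I) (dphi x)%:E); last first.
    rewrite integral_mkcondr; apply: eq_integral => x _.
    by rewrite /g !patchE; case: ifP.
  have -> : (phi @^-1` `]a, b]%classic `&` I = `]psi a, psi b]%classic)%classic.
    apply/seteqP; split => x /=; rewrite !in_itv/=.
      move=> [/andP[ax xb] Ix]; rewrite -(phiK x (mem_set Ix)) (psi_lt _ _ ax)/=.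
      by move: xb; rewrite le_eqVlt => /predU1P[->|/psi_lt/ltW].
    move=> /andP[ax xb]; have Ix : I x by apply: subI; rewrite /= in_itv/= (ltW ax).
    split => //; apply/andP; split.
      by rewrite -(psiK a); apply: phi_lt => //; exact/mem_set.
    move: xb; rewrite le_eqVlt => /predU1P[->|xb]; first by rewrite psiK.
    by apply/ltW; rewrite -(psiK b); apply: phi_lt => //; exact/mem_set.
  rewrite integral_itv_obnd_cbnd; last first.
    apply/measurable_EFinP; apply: measurable_funS mdphi => //.
    exact: subset_trans (@subset_itv_oc_cc _ _ _ _) subI.
  rewrite (@continuous_FTC2 _ _ phi)//; first by rewrite !psiK.
  - apply: continuous_in_subspaceT => x /set_mem/subI Ix.
    by apply: cdphi; exact/mem_set.
  - have cphi x : I x -> {for x, continuous phi}.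
      move=> Ix; apply: differentiable_continuous; apply/derivable1_diffP.
      by have [] := Dphi x (mem_set Ix).
    split.
    + move=> x; rewrite in_itv/= => /andP[ax xb].
      have Ix : I x by apply: subI; rewrite /= in_itv/= !ltW.
      by have [] := Dphi x (mem_set Ix).
    + by apply: cvg_at_right_filter; exact: cphi.
    + by apply: cvg_at_left_filter; exact: cphi.
  - move=> x; rewrite in_itv/= => /andP[ax xb].
    have Ix : I x by apply: subI; rewrite /= in_itv/= !ltW.
    by rewrite derive1E; have /@derive_val := Dphi x (mem_set Ix).
rewrite (ge0_integral_pushforward mphi')//=.
rewrite preimage_setT (@ge0_integral_density _ _ _ mu nu g)//; last first.
  exact: measurableT_comp.
rewrite [RHS]integral_mkcond; apply: eq_integral => x _.
by rewrite /g !patchE; case: ifPn => //=; rewrite mule0.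
Qed.

End substitution.

Lemma measurable_sqrt (R : realType) : measurable_fun setT (@Num.sqrt R : R -> R).
Proof. by apply: continuous_measurable_fun; exact: sqrt_continuous. Qed.

(** Writing the inverse of x as x times a real power of its square avoids a case split on the
    domain: at 0 both expressions are 0. *)
Lemma measurable_inv (R : realType) : measurable_fun setT (@GRing.inv R : R -> R).
Proof.
rewrite (_ : @GRing.inv R = fun x => x * (x ^+ 2) `^ (-1)); last first.
  apply/funext => x; rewrite powR_inv1 ?sqr_ge0//.
  have [->|x0] := eqVneq x 0; first by rewrite invr0 mul0r.
  by rewrite expr2 invfM mulrA divff// mul1r.
apply: measurable_funM => //.
apply: (measurableT_comp (@measurable_powR R (-1))).
exact: measurable_funX.
Qed.

Section substitution_corollaries.
Context (R : realType).
Notation mu := (@lebesgue_measure R).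
Local Open Scope ereal_scope.
Implicit Types f : R -> \bar R.

Lemma ge0_integral_affine f (c k : R) : (0 < c)%R ->
  measurable_fun setT f -> (forall y, 0 <= f y) ->
  \int[mu]_y f y = \int[mu]_x (f (c * x + k)%R * c%:E).
Proof.
move=> c0 mf f0; have cn0 : c != 0%R by rewrite gt_eqF.
apply: (@ge0_integral_increasing_substitution _ setT (fun x => c * x + k)%R
  (fun y => (y - k) / c)%R (fun=> c)) => //.
- by move=> x _; rewrite addrK mulrC mulKf.
- by move=> y; rewrite mulrC divfK// subrK.
- by move=> x y _ _ xy; rewrite ltrD2r ltr_pM2l.
- by apply: measurable_funD => //; apply: measurable_funM.
- by move=> x _; exact: ltW.
- move=> x _; have -> : (fun x => c * x + k)%R = (c \*: id + cst k)%R by [].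
  by apply: is_derive_eq; rewrite addr0 scaler1.
- by move=> x _; exact: cvg_cst.
Qed.

Lemma ge0_integral_translation f (k : R) :
  measurable_fun setT f -> (forall y, 0 <= f y) ->
  \int[mu]_y f y = \int[mu]_x f (x + k)%R.
Proof.
move=> mf f0; rewrite (@ge0_integral_affine f 1%R k)//.
by apply: eq_integral => x _; rewrite mul1r mule1.
Qed.

(** Reflection reverses orientation, so it rests on the invariance of Lebesgue measure instead of
    the increasing substitution; it serves negative exponents below. *)
Lemma ge0_integral_opp f :
  measurable_fun setT f -> (forall y, 0 <= f y) ->
  \int[mu]_y f y = \int[mu]_x f (- x)%R.
Proof.
move=> mf f0.
have mN : measurable_fun setT (-%R : measurableTypeR R -> measurableTypeR R).
  exact: oppr_measurable.
transitivity (\int[pushforward_measure mu mN]_y f y).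
  by apply: eq_measure_integral => A mA _; apply/esym/lebesgue_measureN.
by rewrite (ge0_integral_pushforward mN).
Qed.

Lemma ge0_integral_exp f :
  measurable_fun setT f -> (forall y, 0 <= f y) ->
  \int[mu]_(x in `]0%R, +oo[) f x = \int[mu]_x (f (expR x) * (expR x)%:E).
Proof.
move=> mf f0; apply/esym.
(* The substitution rule maps [I] onto the whole line, so it is applied to [ln] and read from right
   to left. *)
rewrite (@ge0_integral_increasing_substitution _ `]0%R, +oo[%classic (@ln R)
  (@expR R) (@GRing.inv R)) => //.
- apply: eq_integral => x /set_mem; rewrite /= in_itv/= andbT => x0.
  by rewrite lnK ?posrE// -muleA -EFinM mulfV ?gt_eqF// mule1.
- exact: interval_is_interval.
- by move=> y; rewrite /= in_itv/= expR_gt0.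
- by move=> x /set_mem; rewrite /= in_itv/= andbT => x0; rewrite lnK.
- exact: expRK.
- move=> x y /set_mem + /set_mem; rewrite /= !in_itv/= !andbT => x0 y0 xy.
  by rewrite ltr_ln.
- by apply: measurable_funTS; exact: measurable_inv.
- by move=> x /set_mem; rewrite /= in_itv/= andbT => x0; rewrite invr_ge0 ltW.
- by move=> x /set_mem; rewrite /= in_itv/= andbT => x0; exact: is_derive1_ln.
- move=> x /set_mem; rewrite /= in_itv/= andbT => x0.
  by apply: inv_continuous; rewrite gt_eqF.
- apply: emeasurable_funM; first exact: measurableT_comp.
  exact/measurable_EFinP.
- by move=> y; rewrite mule_ge0// lee_fin expR_ge0.
Qed.

Lemma ge0_integral_powR f (k q : R) : (0 < k)%R -> (q != 0)%R ->
  measurable_fun setT f -> (forall y, 0 <= f y) ->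
  \int[mu]_(x in `]0%R, +oo[) f x =
  \int[mu]_(u in `]0%R, +oo[) (f (k * u `^ q)%R * (k * `|q| * u `^ (q - 1))%:E).
Proof.
move=> k0 q0 mf f0.
rewrite ge0_integral_exp//.
have mfe : measurable_fun setT (fun x => f (expR x) * (expR x)%:E).
  apply: emeasurable_funM; first exact: measurableT_comp.
  exact/measurable_EFinP.
have fe0 x : 0 <= f (expR x) * (expR x)%:E by rewrite mule_ge0// lee_fin expR_ge0.
(* In logarithmic coordinates the power map is affine, and the sign of [q] only decides whether a
   reflection is needed. *)
transitivity (\int[mu]_x (f (expR (q * x + ln k)) * (expR (q * x + ln k))%:E * `|q|%:E)).
  have [qp|] := ltP 0%R q.
    rewrite (ge0_integral_affine (ln k) qp)//.
    by apply: eq_integral => x _; rewrite gtr0_norm.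
  rewrite le_eqVlt (negbTE q0)/= => qn.
  have Nq : (0 < - q)%R by rewrite oppr_gt0.
  rewrite (ge0_integral_affine (ln k) Nq)// ge0_integral_opp//.
  - by apply: eq_integral => x _; rewrite ltr0_norm// mulrNN.
  - apply: emeasurable_funM => //.
    apply: (measurableT_comp mfe).
    by apply: measurable_funD => //; apply: measurable_funM.
  - by move=> x; rewrite mule_ge0// lee_fin ltW.
have mpow r : measurable_fun setT (fun u : R => u `^ r)%R by exact: measurable_powR.
rewrite ge0_integral_exp; last 2 first.
- apply: emeasurable_funM.
    by apply: measurableT_comp => //; exact: measurable_funM.
  by apply/measurable_EFinP; exact: measurable_funM.
- by move=> y; rewrite mule_ge0// lee_fin !mulr_ge0 ?powR_ge0// ltW.
apply: eq_integral => x _.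
have pE r : (expR x `^ r = expR (r * x))%R.
  by rewrite /powR gt_eqF ?expR_gt0// expRK.
rewrite !pE expRD lnK// mulrC -!muleA -!EFinM; congr (_ * _%:E).
rewrite mulrBl mul1r expRB -!mulrA mulVf ?gt_eqF ?expR_gt0// mulr1.
by rewrite (mulrC (expR _)).
Qed.

Lemma ge0_integral_div_sqrt f :
  measurable_fun setT f -> (forall y, 0 <= f y) ->
  \int[mu]_y f y = \int[mu]_(x in `](- 1)%R, 1%R[)
    (f (x / Num.sqrt (1 - x ^+ 2))%R * ((1 - x ^+ 2) * Num.sqrt (1 - x ^+ 2))^-1%:E).
Proof.
move=> mf f0.
have pos (x : R) : x \in `](- 1)%R, 1%R[%classic -> (0 < 1 - x ^+ 2)%R.
  by move=> /set_mem; rewrite /= in_itv/= => /andP[x1 x2]; nra.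
have pos2 (y : R) : (0 < 1 + y ^+ 2)%R by nra.
have msq : measurable_fun setT (fun x : R => Num.sqrt (1 - x ^+ 2))%R.
  apply: measurableT_comp; first exact: measurable_sqrt.
  by apply: measurable_funB => //; exact: measurable_funX.
have minv := @measurable_inv R.
apply: (@ge0_integral_increasing_substitution _ _ _
  (fun y => y / Num.sqrt (1 + y ^+ 2))%R _) => //.
- exact: interval_is_interval.
- move=> y; rewrite /= in_itv/= ltr_pdivlMr ?sqrtr_gt0// ltr_pdivrMr ?sqrtr_gt0//.
  have := sqr_sqrtr (ltW (pos2 y)); have := sqrtr_ge0 (1 + y ^+ 2).
  by move: (Num.sqrt _) => s; nra.
- move=> x xI; have p := pos x xI.
  have -> : (1 + (x / Num.sqrt (1 - x ^+ 2)) ^+ 2 = (Num.sqrt (1 - x ^+ 2))^-1 ^+ 2)%R.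
    rewrite expr_div_n exprVn sqr_sqrtr ?ltW//; field; exact: lt0r_neq0.
  rewrite sqrtr_sqr ger0_norm ?invr_ge0 ?sqrtr_ge0// invrK divfK//.
  by rewrite gt_eqF// sqrtr_gt0.
- move=> y; have p := pos2 y.
  have -> : (1 - (y / Num.sqrt (1 + y ^+ 2)) ^+ 2 = (Num.sqrt (1 + y ^+ 2))^-1 ^+ 2)%R.
    rewrite expr_div_n exprVn sqr_sqrtr ?ltW//; field; exact: lt0r_neq0.
  rewrite sqrtr_sqr ger0_norm ?invr_ge0 ?sqrtr_ge0// invrK divfK//.
  by rewrite gt_eqF// sqrtr_gt0.
- move=> x y xI yI xy.
  have px : (0 < Num.sqrt (1 - x ^+ 2))%R by rewrite sqrtr_gt0; exact: pos.
  have py : (0 < Num.sqrt (1 - y ^+ 2))%R by rewrite sqrtr_gt0; exact: pos.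
  rewrite ltr_pdivrMr// mulrAC ltr_pdivlMr//.
  have := sqr_sqrtr (ltW (pos _ xI)); have := sqr_sqrtr (ltW (pos _ yI)).
  move: (Num.sqrt (1 - x ^+ 2)) (Num.sqrt (1 - y ^+ 2)) px py => s t s0 t0 t2 s2.
  (* Only the squares of the two roots are comparable, and which root is larger depends on the signs
     of [x] and [y]. *)
  have [x0|x0] := leP 0%R x.
    have : (t ^+ 2 < s ^+ 2)%R by rewrite t2 s2; nra.
    by rewrite ltr_pXn2r ?nnegrE ?ltW// => ts; nra.
  have [y0|y0] := leP 0%R y; first by nra.
  have : (s ^+ 2 < t ^+ 2)%R by rewrite t2 s2; nra.
  by rewrite ltr_pXn2r ?nnegrE ?ltW// => ts; nra.
- apply: measurable_funM => //; exact: measurableT_comp.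
- apply: measurable_funTS; apply: measurableT_comp => //; apply: measurable_funM => //.
  by apply: measurable_funB => //; exact: measurable_funX.
- move=> x xI; rewrite invr_ge0 mulr_ge0 ?sqrtr_ge0// ltW//; exact: pos.
- move=> x xI; have p := pos x xI; have sp : (0 < Num.sqrt (1 - x ^+ 2))%R by rewrite sqrtr_gt0.
  have d1 : is_derive x 1%R (fun x : R => 1 - x ^+ 2)%R (- (2 * x))%R.
    have -> : (fun x : R => 1 - x ^+ 2)%R = (cst 1 - id ^+ 2)%R by [].
    by apply: is_derive_eq; rewrite /= scaler1 sub0r expr1 mulr_natl.
  have d2 := @is_derive1_sqrt _ _ p.
  have d3 : is_derive x 1%R (fun x : R => Num.sqrt (1 - x ^+ 2))%R
      ((2 * Num.sqrt (1 - x ^+ 2))^-1 * (- (2 * x)))%R.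
    exact: (@is_derive1_comp R (@Num.sqrt R) (fun x : R => 1 - x ^+ 2)%R x _ _ d2 d1).
  have d4 := @is_deriveV R (fun x : R => Num.sqrt (1 - x ^+ 2))%R x _ 1%R (lt0r_neq0 sp) d3.
  have := @is_deriveM R R id (fun x : R => (Num.sqrt (1 - x ^+ 2))^-1)%R x 1%R _ _ (is_derive_id x 1%R) d4.
  move=> /is_derive_eq; apply; rewrite /= /GRing.scale/= mulr1.
  have s2 := sqr_sqrtr (ltW p); set s := Num.sqrt _ in sp s2 *.
  rewrite -s2; have sn0 := lt0r_neq0 sp.
  transitivity ((s ^+ 2 + x ^+ 2) / s ^+ 3)%R; first by field.
  have -> : (s ^+ 2 + x ^+ 2 = 1)%R by rewrite s2 subrK.
  by field.
- move=> x xI; have p := pos x xI.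
  apply: cvgV; first by rewrite gt_eqF// mulr_gt0// sqrtr_gt0.
  have c1 : (fun x : R => 1 - x ^+ 2)%R @ x --> (1 - x ^+ 2)%R.
    by apply: cvgB; [exact: cvg_cst|apply: exprn_continuous].
  apply: cvgM => //; apply: continuous_comp; [exact: c1|exact: sqrt_continuous].
Qed.

End substitution_corollaries.

(** * Measurability of explicit expressions *)

Section measurability.
Context d (T : measurableType d) (R : realType).
Implicit Types f g : T -> R.

Lemma measurable_fun_expR f : measurable_fun setT f ->
  measurable_fun setT (fun x => expR (f x)).
Proof. by move=> mf; apply: measurableT_comp. Qed.

Lemma measurable_fun_sqrt f : measurable_fun setT f ->
  measurable_fun setT (fun x => Num.sqrt (f x)).
Proof. by move=> mf; apply: (measurableT_comp (@measurable_sqrt R)). Qed.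

Lemma measurable_fun_inv f : measurable_fun setT f ->
  measurable_fun setT (fun x => (f x)^-1).
Proof. by move=> mf; apply: (measurableT_comp (@measurable_inv R)). Qed.

Lemma measurable_fun_powR f (p : R) : measurable_fun setT f ->
  measurable_fun setT (fun x => f x `^ p).
Proof. by move=> mf; apply: (measurableT_comp (@measurable_powR R p)). Qed.

Lemma measurable_fun_opp f : measurable_fun setT f ->
  measurable_fun setT (fun x => - f x).
Proof. by move=> mf; apply: (measurableT_comp (@oppr_measurable R setT)). Qed.

Lemma measurable_fun_EFin f : measurable_fun setT f ->
  measurable_fun setT (fun x => (f x)%:E).
Proof. by move=> mf; exact/measurable_EFinP. Qed.

End measurability.

Lemma measurable_fun_fst d d1 d2 (T : measurableType d) (T1 : measurableType d1)
    (T2 : measurableType d2) (f : T -> T1 * T2) :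
  measurable_fun setT f -> measurable_fun setT (fun x => (f x).1).
Proof. by move=> mf; apply: (measurableT_comp measurable_fst). Qed.

Lemma measurable_fun_snd d d1 d2 (T : measurableType d) (T1 : measurableType d1)
    (T2 : measurableType d2) (f : T -> T1 * T2) :
  measurable_fun setT f -> measurable_fun setT (fun x => (f x).2).
Proof. by move=> mf; apply: (measurableT_comp measurable_snd). Qed.

(** The rules follow the syntax of the function body. The last two use measurability hypotheses of
    the context, which is why proofs first introduce facts such as [mphi] or [mg] and then call
    [meas]. *)
Ltac meas_step := lazymatch goal with
  | |- measurable_fun _ (fun _ => ?c) => exact: measurable_cst
  | |- measurable_fun _ (fun x => x) => exact: measurable_id
  | |- measurable_fun _ (fun x => (@?f x, @?g x)) => apply: measurable_fun_pair
  | |- measurable_fun _ (fun x => (@?f x).1) => apply: measurable_fun_fst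
  | |- measurable_fun _ (fun x => (@?f x).2) => apply: measurable_fun_snd
  | |- measurable_fun _ (fun x => (@?f x)%:E) => apply: measurable_fun_EFin
  | |- measurable_fun _ (fun x => expR (@?f x)) => apply: measurable_fun_expR
  | |- measurable_fun _ (fun x => Num.sqrt (@?f x)) => apply: measurable_fun_sqrt
  | |- measurable_fun _ (fun x => (@?f x)^-1) => apply: measurable_fun_inv
  | |- measurable_fun _ (fun x => (@?f x) `^ _) => apply: measurable_fun_powR
  | |- measurable_fun _ (fun x => (@?f x) ^+ _) => apply: measurable_funX
  | |- measurable_fun _ (fun x => (@?f x * @?g x)%E) => apply: emeasurable_funM
  | |- measurable_fun _ (fun x => @?f x * @?g x) => apply: measurable_funM
  | |- measurable_fun _ (fun x => @?f x + @?g x) => apply: measurable_funD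
  | |- measurable_fun _ (fun x => - @?f x) => apply: measurable_fun_opp
  | |- measurable_fun _ fst => exact: measurable_fst
  | |- measurable_fun _ snd => exact: measurable_snd
  | H : measurable_fun setT ?h |- measurable_fun setT ?h => exact: H
  | H : measurable_fun setT ?h |- measurable_fun setT (fun x => ?h (@?f x)) =>
      apply: (measurableT_comp H)
  end.
Ltac meas := repeat meas_step.

(** * Tonelli on rectangles and measurability of partial integrals *)

Section tonelli.
Local Open Scope ereal_scope.
Context d1 d2 (T1 : measurableType d1) (T2 : measurableType d2) (R : realType).
Variables (m1 : {sigma_finite_measure set T1 -> \bar R})
          (m2 : {sigma_finite_measure set T2 -> \bar R}).
Variables (A : set T1) (B : set T2) (f : T1 * T2 -> \bar R).
Hypotheses (mA : measurable A) (mB : measurable B)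
  (mf : measurable_fun setT f) (f0 : forall z, 0 <= f z).

Let g := f \_ (A `*` B).

Let mg : measurable_fun setT g.
Proof.
apply/(measurable_restrictT _ _).1; first exact: measurableX.
exact: measurable_funTS.
Qed.

Let g0 z : 0 <= g z. Proof. by rewrite /g patchE; case: ifP. Qed.

Let gE1 x : \int[m2]_y g (x, y) = ((fun x => \int[m2]_(y in B) f (x, y)) \_ A) x.
Proof.
rewrite [RHS]patchE; case: ifPn => xA; last first.
  by apply: integral0_eq => y _; rewrite /g patchE in_setX (negbTE xA).
rewrite [RHS]integral_mkcond; apply: eq_integral => y _.
by rewrite /g !patchE in_setX xA.
Qed.

Let gE2 y : \int[m1]_x g (x, y) = ((fun y => \int[m1]_(x in A) f (x, y)) \_ B) y.
Proof.
rewrite [RHS]patchE; case: ifPn => yB; last first.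
  by apply: integral0_eq => x _; rewrite /g patchE in_setX (negbTE yB) andbF.
rewrite [RHS]integral_mkcond; apply: eq_integral => x _.
by rewrite /g !patchE in_setX yB andbT.
Qed.

Lemma ge0_integral_setX1 :
  \int[m1 \x m2]_(z in A `*` B) f z = \int[m1]_(x in A) \int[m2]_(y in B) f (x, y).
Proof.
rewrite integral_mkcond -/g (fubini_tonelli1 g mg g0) [RHS]integral_mkcond.
by apply: eq_integral => x _; rewrite /fubini_F gE1.
Qed.

Lemma ge0_integral_setX2 :
  \int[m1 \x m2]_(z in A `*` B) f z = \int[m2]_(y in B) \int[m1]_(x in A) f (x, y).
Proof.
rewrite integral_mkcond -/g (fubini_tonelli2 g mg g0) [RHS]integral_mkcond.
by apply: eq_integral => y _; rewrite /fubini_G gE2.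
Qed.

Lemma ge0_integral_swap :
  \int[m1]_(x in A) \int[m2]_(y in B) f (x, y) =
  \int[m2]_(y in B) \int[m1]_(x in A) f (x, y).
Proof. by rewrite -ge0_integral_setX1 ge0_integral_setX2. Qed.

End tonelli.

Section measurable_integral.
Local Open Scope ereal_scope.
Context d1 d2 (T1 : measurableType d1) (T2 : measurableType d2) (R : realType).
Variables (m2 : {sigma_finite_measure set T2 -> \bar R}).

Lemma measurable_fun_integral (B : set T2) (f : T1 -> T2 -> \bar R) :
  measurable B -> measurable_fun setT (fun z => f z.1 z.2) ->
  (forall x y, 0 <= f x y) ->
  measurable_fun setT (fun x => \int[m2]_(y in B) f x y).
Proof.
move=> mB mf f0.
have -> : (fun x => \int[m2]_(y in B) f x y) =
    fubini_F m2 ((fun z => f z.1 z.2) \_ (setT `*` B)).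
  apply/funext => x; rewrite /fubini_F [LHS]integral_mkcond.
  by apply: eq_integral => y _; rewrite !patchE in_setX in_setT.
apply: measurable_fun_fubini_tonelli_F => [|z].
  apply/(measurable_restrictT _ _).1; first exact: measurableX.
  exact: measurable_funTS.
by rewrite patchE; case: ifP.
Qed.

End measurable_integral.

(** * The standard normal law and its rotation invariance *)

Section normal.
Context (R : realType).
Local Open Scope ereal_scope.
Notation mu := (@lebesgue_measure R).

Definition std_normal : probability (measurableTypeR R) R := normal_prob 0 1.

Definition phi (x : R) : R := (Num.sqrt (pi *+ 2))^-1 * expR (- (x ^+ 2 / 2)).

Lemma measurable_phi : measurable_fun setT phi.
Proof. by rewrite /phi; meas. Qed.

Lemma phi_ge0 x : (0 <= phi x)%R.
Proof. by rewrite mulr_ge0 ?expR_ge0// invr_ge0 sqrtr_ge0. Qed.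

Lemma phi_gt0 x : (0 < phi x)%R.
Proof. by rewrite mulr_gt0 ?expR_gt0// invr_gt0 sqrtr_gt0 pmulrn_lgt0// pi_gt0. Qed.

Lemma integral_std_normal (f : R -> \bar R) :
  measurable_fun setT f -> (forall x, 0 <= f x) ->
  \int[std_normal]_x f x = \int[mu]_x (f x * (phi x)%:E).
Proof.
move=> mf f0.
have -> : (fun x => f x * (phi x)%:E) = (fun x => f x * (normal_pdf 0 1 x)%:E).
  apply/funext => x; rewrite normal_pdfE ?oner_neq0//; congr (_ * _%:E).
  rewrite /phi /normal_peak /normal_fun expr1n mul1r subr0 mulNr.
  by [].
apply: ge0_integral_density => //.
- exact: measurable_normal_pdf.
- by move=> x; exact: normal_pdf_ge0.
Qed.

Lemma phiM_rotation (c s x y : R) : (c ^+ 2 + s ^+ 2 = 1)%R ->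
  (phi (c * x + s * y) * phi (c * y - s * x) = phi x * phi y)%R.
Proof.
move=> cs; rewrite /phi [LHS]mulrACA [RHS]mulrACA -!expRD; congr (_ * expR _)%R.
transitivity (- ((c ^+ 2 + s ^+ 2) * (x ^+ 2 + y ^+ 2) / 2))%R; first by field.
by rewrite cs; field.
Qed.

Lemma std_normal_opp (f : R -> \bar R) :
  measurable_fun setT f -> (forall x, 0 <= f x) ->
  \int[std_normal]_x f (- x)%R = \int[std_normal]_x f x.
Proof.
move=> mf f0; have mphi := measurable_phi.
rewrite !integral_std_normal//; last by meas.
rewrite [RHS]ge0_integral_opp.
- by apply: eq_integral => x _; rewrite /phi sqrrN.
- by meas.
- by move=> y; rewrite mule_ge0// lee_fin phi_ge0.
Qed.

(** Two affine substitutions in one variable each replace the planar change of variables. The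
    condition [0 < c] keeps both increasing, and their factors 1/c and c cancel. *)
Lemma std_normal_rotation (f : R * R -> \bar R) (c s : R) :
  measurable_fun setT f -> (forall z, 0 <= f z) ->
  (0 < c)%R -> (c ^+ 2 + s ^+ 2 = 1)%R ->
  \int[std_normal]_x \int[std_normal]_y f (c * x + s * y, c * y - s * x)%R =
  \int[std_normal]_x \int[std_normal]_y f (x, y).
Proof.
move=> mf f0 c0 cs; have cn0 := lt0r_neq0 c0; have mphi := measurable_phi.
pose h (z : R * R) := f z * (phi z.1 * phi z.2)%:E.
have mh : measurable_fun setT h by rewrite /h; meas.
have phiM0 u v : (0 <= phi u * phi v)%R by rewrite mulr_ge0// phi_ge0.
have h0 z : 0 <= h z by rewrite /h mule_ge0// lee_fin.
have expand (g : R * R -> \bar R) : measurable_fun setT g -> (forall z, 0 <= g z) ->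
    \int[std_normal]_x \int[std_normal]_y g (x, y) =
    \int[mu]_x \int[mu]_y (g (x, y) * (phi x * phi y)%:E).
  move=> mg g0; rewrite integral_std_normal; last 2 first.
  - by apply: measurable_fun_integral => //; meas.
  - by move=> x; apply: integral_ge0 => y _.
  apply: eq_integral => x _.
  rewrite integral_std_normal//; last by meas.
  rewrite muleC -ge0_integralZl_EFin ?phi_ge0//; last 2 first.
  - by move=> y _; rewrite mule_ge0// lee_fin phi_ge0.
  - by meas.
  by apply: eq_integral => y _; rewrite muleCA EFinM.
rewrite (expand (fun z => f (c * z.1 + s * z.2, c * z.2 - s * z.1)%R))//; last by meas.
rewrite (expand f mf f0).
transitivity (\int[mu]_x \int[mu]_y h (c * x + s * y, c * y - s * x)%R).
  by do 2 (apply: eq_integral => ? _); rewrite /h/= phiM_rotation.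
have mrot : measurable_fun setT (fun z : R * R => h (c * z.1 + s * z.2, c * z.2 - s * z.1)%R).
  by meas.
(* For fixed y put u = c x + s y, then for fixed u put v = (y - s u) / c. *)
transitivity (\int[mu]_u \int[mu]_y (h (u, (y - s * u) / c)%R * (c^-1)%:E)).
  have c'0 : (0 <= c^-1)%R by rewrite invr_ge0 ltW.
  pose h' (z : R * R) := h (z.1, (z.2 - s * z.1) / c)%R * (c^-1)%:E.
  have mh' : measurable_fun setT h' by rewrite /h'; meas.
  have h'0 z : 0 <= h' z by rewrite /h' mule_ge0.
  rewrite (ge0_integral_swap mu mu measurableT measurableT mrot (fun=> h0 _)).
  rewrite (ge0_integral_swap mu mu measurableT measurableT mh' h'0) /h' /=.
  apply: eq_integral => y _.
  rewrite [RHS](ge0_integral_affine (s * y)%R c0); last 2 first.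
  - by meas.
  - by move=> u; rewrite mule_ge0.
  apply: eq_integral => x _; rewrite -muleA -EFinM mulVf// mule1; congr (h (_, _)).
  have -> : (c * y - s * x = (c ^+ 2 * y - s * c * x) / c)%R by field.
  by have -> : (c ^+ 2 = 1 - s ^+ 2)%R by [rewrite -cs addrK]; field.
apply: eq_integral => u _.
rewrite (ge0_integral_affine (s * u)%R c0); last 2 first.
- by meas.
- by move=> y; rewrite mule_ge0// lee_fin invr_ge0 ltW.
apply: eq_integral => v _; rewrite -muleA -EFinM mulVf// mule1 addrK mulrC.
by rewrite mulKf.
Qed.

End normal.

(** * Chi-squared laws *)

Section chi_square_law.
Context (R : realType).
Notation mu := (@lebesgue_measure R).

(** Carrying the half-line as a factor of the integrand turns all integrals into integrals over the
    whole line, where translations and Tonelli apply without a change of domain. *)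
Definition pos (t : R) : R := \1_(`]0, +oo[%classic) t.

Definition pospow (p t : R) : R := pos t * t `^ (p - 1).

(** The unnormalized Gamma density with shape [p] and rate 1/2. *)
Definition gamma_kernel (p t : R) : R := pospow p t * expR (- (t / 2)).

Lemma posE t : pos t = (0 < t)%R%:R.
Proof. by rewrite /pos indicE mem_setE in_itv/= andbT. Qed.

Lemma pos_ge0 t : 0 <= pos t. Proof. by rewrite posE. Qed.

Lemma pospow_ge0 p t : 0 <= pospow p t.
Proof. by rewrite mulr_ge0 ?pos_ge0 ?powR_ge0. Qed.

Lemma gamma_kernel_ge0 p t : 0 <= gamma_kernel p t.
Proof. by rewrite mulr_ge0 ?pospow_ge0 ?expR_ge0. Qed.

Lemma measurable_pos : measurable_fun setT pos.
Proof. exact: measurable_indic. Qed.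

Lemma measurable_pospow p : measurable_fun setT (pospow p).
Proof. by have mp := measurable_pos; rewrite /pospow; meas. Qed.

Lemma measurable_gamma_kernel p : measurable_fun setT (gamma_kernel p).
Proof. by have mp := measurable_pospow p; rewrite /gamma_kernel; meas. Qed.

Local Open Scope ereal_scope.

Lemma integral_pos (f : R -> \bar R) :
  \int[mu]_(x in `]0%R, +oo[) f x = \int[mu]_x (f x * (pos x)%:E).
Proof.
rewrite integral_mkcond; apply: eq_integral => x _.
by rewrite patchE /pos indicE; case: ifP; rewrite ?mule1 ?mule0.
Qed.

Lemma integral_even (f : R -> \bar R) :
  measurable_fun setT f -> (forall x, 0 <= f x) -> (forall x, f (- x)%R = f x) ->
  \int[mu]_x f x = 2%:E * \int[mu]_(x in `]0%R, +oo[) f x.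
Proof.
move=> mf f0 fN.
have -> : [set: measurableTypeR R] = `]-oo, 0%R[ `|` `[0%R, +oo[.
  by apply/seteqP; split => x //= _; rewrite !in_itv/= andbT; case: ltP => _; [left|right].
rewrite ge0_integral_setU//; last 2 first.
- exact: measurable_funTS.
- apply/disj_setPS => x [] /=; rewrite !in_itv/= andbT => x0.
  by move/(lt_le_trans x0); rewrite ltxx.
rewrite -integral_itv_obnd_cbnd; last exact: measurable_funTS.
rewrite (_ : \int[mu]_(x in `]-oo, 0%R[) f x = \int[mu]_(x in `]0%R, +oo[) f x).
  by rewrite -mule2n mule_natl.
rewrite [LHS]integral_mkcond ge0_integral_opp.
- rewrite integral_pos; apply: eq_integral => x _.
  rewrite patchE mem_setE in_itv/= oppr_lt0 posE fN.
  by case: ifP; rewrite ?mule1 ?mule0.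
- by apply/(measurable_restrictT _ _).1 => //; exact: measurable_funTS.
- by move=> x; rewrite patchE; case: ifP.
Qed.

Definition add_sqr (z : measurableTypeR R * measurableTypeR R) : measurableTypeR R :=
  (z.1 + z.2 ^+ 2 : R)%R.

Lemma measurable_add_sqr : measurable_fun setT add_sqr.
Proof.
by apply: measurable_funD => //; apply: measurable_funX.
Qed.

HB.instance Definition _ := isMeasurableFun.Build _ _ _ _ add_sqr measurable_add_sqr.

(** The law of a sum of [j] independent squared standard normals, built one square at a time to
    match the growth of the sample. The point mass at 0 occurs as the law of the residual sum of
    squares of two observations. *)
Fixpoint chi (j : nat) : probability (measurableTypeR R) R :=
  match j with
  | 0%N => \d_(0%R : measurableTypeR R)
  | j.+1 => distribution (chi j \x std_normal R) add_sqr
  end.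

Lemma integral_chi0 (f : R -> \bar R) : measurable_fun setT f ->
  \int[chi 0]_x f x = f 0%R.
Proof. by move=> mf; rewrite integral_dirac// diracT mul1e. Qed.

Lemma integral_chiS j (f : R -> \bar R) :
  measurable_fun setT f -> (forall x, 0 <= f x) ->
  \int[chi j.+1]_x f x = \int[chi j]_a \int[std_normal R]_e f (a + e ^+ 2)%R.
Proof.
move=> mf f0; rewrite ge0_integral_distribution// fubini_tonelli1//=.
exact: (measurableT_comp mf measurable_add_sqr).
Qed.

Lemma integral_chi1 (f : R -> \bar R) :
  measurable_fun setT f -> (forall x, 0 <= f x) ->
  \int[chi 1]_x f x =
    \int[mu]_t (f t * ((Num.sqrt (pi *+ 2))^-1 * gamma_kernel (1 / 2) t)%:E).
Proof.
move=> mf f0; have mphi := @measurable_phi R.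
rewrite integral_chiS// integral_chi0; last first.
  by apply: measurable_fun_integral => //; meas.
under eq_integral do rewrite add0r.
rewrite integral_std_normal//; last by meas.
have mg : measurable_fun setT (fun x : R => f (x ^+ 2)%R * (phi x)%:E) by meas.
have g0 x : 0 <= f (x ^+ 2)%R * (phi x)%:E by rewrite mule_ge0// lee_fin phi_ge0.
rewrite integral_even//; last by move=> x; rewrite /phi sqrrN.
have q0 : (1 / 2 != 0 :> R)%R by rewrite mul1r invr_eq0.
rewrite (ge0_integral_powR ltr01 q0)// -ge0_integralZl_EFin//; last 2 first.
- by move=> x _; rewrite mule_ge0// lee_fin !mulr_ge0 ?powR_ge0.
- by apply: measurable_funTS; meas.
rewrite integral_pos; apply: eq_integral => t _.
rewrite /gamma_kernel /pospow posE; case: ltP => t0; last by rewrite !mule0 !mul0r mulr0 mule0.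
rewrite mule1 !mul1r /phi powR12_sqrt ?ltW// sqr_sqrtr ?ltW//.
rewrite muleCA -!muleA -!EFinM; congr (_ * _%:E).
by rewrite ger0_norm ?invr_ge0//; field; rewrite gt_eqF// sqrtr_gt0 pmulrn_lgt0// pi_gt0.
Qed.

(** Scaling [e] by the square root of [w] separates the variables and leaves a beta integral, which
    is kept as an unevaluated constant. *)
Lemma pospow_convolution (p w : R) :
  \int[mu]_e (pospow p (w - e ^+ 2))%:E =
  (pospow (p + 1 / 2) w)%:E * \int[mu]_x (pospow p (1 - x ^+ 2))%:E.
Proof.
have mp := measurable_pospow p.
have [w0|w0] := ltP 0%R w; last first.
  rewrite {2}/pospow posE ltNge w0 mul0r mul0e; apply: integral0_eq => e _.
  rewrite /pospow posE ltNge (_ : w - e ^+ 2 <= 0)%R ?mul0r//.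
  by rewrite subr_le0 (le_trans w0)// sqr_ge0.
have s0 : (0 < Num.sqrt w)%R by rewrite sqrtr_gt0.
rewrite (ge0_integral_affine 0%R s0)//; last 2 first.
- by meas.
- by move=> y; rewrite lee_fin pospow_ge0.
rewrite -ge0_integralZl_EFin ?pospow_ge0//; last 2 first.
- by move=> y _; rewrite lee_fin pospow_ge0.
- by meas.
apply: eq_integral => x _; rewrite addr0 exprMn sqr_sqrtr ?ltW// -EFinM; congr EFin.
have -> : (w - w * x ^+ 2 = w * (1 - x ^+ 2))%R by rewrite mulrBr mulr1.
rewrite /pospow !posE pmulr_rgt0// w0.
case: ltP => x1; last by rewrite !mul0r mulr0.
rewrite !mul1r powRM ?ltW// mulrAC; congr (_ * _)%R.
rewrite -powR12_sqrt ?ltW// -powRD; last by rewrite (gt_eqF w0) implybT.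
by rewrite addrAC.
Qed.

Lemma chi_density j : exists2 K : R, (0 < K)%R &
  forall f : R -> \bar R, measurable_fun setT f -> (forall x, 0 <= f x) ->
  \int[chi j.+1]_x f x = \int[mu]_t (f t * (K * gamma_kernel (j.+1%:R / 2) t)%:E).
Proof.
elim: j => [|j [K K0 IH]].
  exists (Num.sqrt (pi *+ 2))^-1%R.
    by rewrite invr_gt0 sqrtr_gt0 pmulrn_lgt0// pi_gt0.
  by move=> f mf f0; rewrite integral_chi1.
set p : R := (j.+1%:R / 2)%R in IH.
have pS : (j.+2%:R / 2 = p + 1 / 2 :> R)%R by rewrite /p -natr1; field.
pose C := \int[mu]_x (pospow p (1 - x ^+ 2))%:E.
have C0 : 0 <= C by apply: integral_ge0 => x _; rewrite lee_fin pospow_ge0.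
pose c := (K * (Num.sqrt (pi *+ 2))^-1)%R.
have c0 : (0 < c)%R by rewrite mulr_gt0// invr_gt0 sqrtr_gt0 pmulrn_lgt0// pi_gt0.
have mphi := @measurable_phi R; have mp := measurable_pospow p.
have mg := measurable_gamma_kernel p; have mg2 := measurable_gamma_kernel (p + 1 / 2).
(* With w = a + e^2 the two exponentials combine to exp(-w/2), so only powers have to be convolved.
   The constant [C] may still be 0 or infinite here. *)
have main f : measurable_fun setT f -> (forall x, 0 <= f x) ->
    \int[chi j.+2]_x f x = (c%:E * C) * \int[mu]_t (f t * (gamma_kernel (p + 1 / 2) t)%:E).
  move=> mf f0; rewrite integral_chiS// IH; last 2 first.
  - by apply: measurable_fun_integral => //; meas.
  - by move=> a; exact: integral_ge0.
  pose h (z : R * R) := f (z.1 + z.2 ^+ 2)%R * (phi z.2 * (K * gamma_kernel p z.1))%:E.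
  have mh : measurable_fun setT h by rewrite /h; meas.
  have h0 z : 0 <= h z.
    rewrite /h mule_ge0// lee_fin; apply: mulr_ge0; first exact: phi_ge0.
    by apply: mulr_ge0; [exact: ltW|exact: gamma_kernel_ge0].
  transitivity (\int[mu]_a \int[mu]_e h (a, e)).
    apply: eq_integral => a _; rewrite integral_std_normal//; last by meas.
    rewrite muleC -ge0_integralZl_EFin//; last 3 first.
    - by move=> e _; rewrite mule_ge0// lee_fin phi_ge0.
    - by meas.
    - by apply: mulr_ge0; [exact: ltW|exact: gamma_kernel_ge0].
    by apply: eq_integral => e _; rewrite muleC -muleA -EFinM.
  rewrite (ge0_integral_swap mu mu measurableT measurableT mh h0).
  pose k (z : R * R) := f z.2 * (c * pospow p (z.2 - z.1 ^+ 2) * expR (- (z.2 / 2)))%:E.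
  have mk : measurable_fun setT k by rewrite /k; meas.
  have k0 z : 0 <= k z.
    rewrite /k mule_ge0// lee_fin; apply: mulr_ge0; last exact: expR_ge0.
    by apply: mulr_ge0; [exact: ltW|exact: pospow_ge0].
  transitivity (\int[mu]_e \int[mu]_w k (e, w)).
    apply: eq_integral => e _; rewrite [RHS](ge0_integral_translation (e ^+ 2)%R)//.
    - apply: eq_integral => a _; rewrite /h /k/= addrK; congr (_ * _%:E).
      rewrite /gamma_kernel /phi mulrDl opprD expRD /c; ring.
    - by meas.
  rewrite (ge0_integral_swap mu mu measurableT measurableT mk k0).
  transitivity (\int[mu]_w ((c%:E * C) * (f w * (gamma_kernel (p + 1 / 2) w)%:E))); last first.
    rewrite ge0_integralZl//; first by meas.
    - by move=> w _; rewrite mule_ge0// lee_fin gamma_kernel_ge0.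
    - by rewrite mule_ge0// lee_fin ltW.
  apply: eq_integral => w _; rewrite /k/=.
  transitivity (\int[mu]_e ((f w * (c * expR (- (w / 2)))%:E) * (pospow p (w - e ^+ 2))%:E)).
    by apply: eq_integral => e _; rewrite -muleA -EFinM; congr (_ * _%:E); ring.
  rewrite ge0_integralZl//; last 3 first.
  - by meas.
  - by move=> x _; rewrite lee_fin pospow_ge0.
  - by rewrite mule_ge0// lee_fin; apply: mulr_ge0; [exact: ltW|exact: expR_ge0].
  rewrite pospow_convolution -/C /gamma_kernel.
  rewrite [(c * _)%:E]EFinM [(pospow _ _ * _)%:E]EFinM.
  set q := (pospow _ _)%:E; set E := (expR _)%:E.
  rewrite (muleA (f w) c%:E) -[LHS]muleA [RHS]muleACA (muleC (f w)); congr (_ * _).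
  by rewrite muleC -muleA [RHS]muleCA.
(* Total mass one, tested with the constant function 1, reads 1 = c C J and excludes both C = 0 and
   C = +oo. *)
have := main (cst 1) (measurable_cst _) (fun=> lee01).
rewrite [LHS]integral_cst// [X in 1 * X]probability_setT mul1e.
under eq_integral do rewrite /= mul1e.
set J := \int[mu]_t _ => e1.
have J0 : 0 <= J by apply: integral_ge0 => x _; rewrite lee_fin gamma_kernel_ge0.
have Cfin : C \is a fin_num.
  rewrite ge0_fin_numE// ltNge leye_eq; apply/negP => /eqP Cy; move: e1.
  rewrite Cy gt0_muley ?lte_fin//.
  have [->|J1] := eqVneq J 0; first by rewrite mule0 => /eqP; rewrite onee_eq0.
  by rewrite gt0_mulye// lt_neqAle eq_sym J1.
have Cpos : (0 < fine C)%R.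
  rewrite lt_neqAle fine_ge0// andbT; apply/eqP => C00; move: e1.
  by rewrite -(fineK Cfin) -C00 mule0 mul0e => /eqP; rewrite onee_eq0.
exists (c * fine C)%R; first exact: mulr_gt0.
move=> f mf f0; rewrite main// pS -(fineK Cfin) -EFinM -ge0_integralZl_EFin//.
- by apply: eq_integral => t _; rewrite muleCA EFinM.
- by move=> x _; rewrite mule_ge0// lee_fin gamma_kernel_ge0.
- by meas.
- by rewrite mulr_ge0 ?ltW.
Qed.

End chi_square_law.

Ltac meas_int := repeat first [ meas_step
  | lazymatch goal with
    | |- measurable_fun _ (fun x => integral _ setT (fun y => @?F x y)) =>
        apply: (@measurable_fun_integral _ _ _ _ _ _ _ F) => //
    end ].

Ltac nn_int := move=> *; repeat (apply: integral_ge0; move=> * );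
  solve [auto].

Section tonelli_curried.
Local Open Scope ereal_scope.
Context d1 d2 (T1 : measurableType d1) (T2 : measurableType d2) (R : realType).
Variables (m1 : {sigma_finite_measure set T1 -> \bar R})
          (m2 : {sigma_finite_measure set T2 -> \bar R}).

Lemma tonelli_swap (f : T1 -> T2 -> \bar R) :
  measurable_fun setT (fun z => f z.1 z.2) -> (forall x y, 0 <= f x y) ->
  \int[m1]_x \int[m2]_y f x y = \int[m2]_y \int[m1]_x f x y.
Proof.
move=> mf f0.
exact: (@ge0_integral_swap _ _ _ _ _ m1 m2 setT setT (fun z => f z.1 z.2)).
Qed.

Lemma tonelli_prod (f : T1 * T2 -> \bar R) :
  measurable_fun setT f -> (forall z, 0 <= f z) ->
  \int[m1 \x m2]_z f z = \int[m1]_x \int[m2]_y f (x, y).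
Proof. by move=> mf f0; rewrite fubini_tonelli1. Qed.

End tonelli_curried.

(** * Effect of one new observation on the sums of squares *)

Section sampling_laws.
Context (R : realType).
Local Notation RR := (measurableTypeR R).
Local Notation N01 := (std_normal R).
Local Notation chi := (chi R).

Definition std_normal2 : probability (RR * RR)%type R := (N01 \x N01)%E.

(** Bartlett decomposition of a standard bivariate Wishart matrix with [k] degrees of freedom: its
    Cholesky-type coordinates are independent. *)
Definition ss_law (k : nat) : probability (RR * (RR * RR))%type R :=
  (chi k \x (N01 \x chi k.-1))%E.

(** A Helmert rotation applied to both coordinates at once. With [m] the scaled running mean and [z]
    the new observation, the first pair is the new scaled mean and the second the contribution
    orthogonal to it. *)
Definition rot (c s : R) (m z : RR * RR) : (RR * RR) * (RR * RR) :=
  ((c * m.1 + s * z.1, c * m.2 + s * z.2), (c * z.1 - s * m.1, c * z.2 - s * m.2)).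

(* [u = (a, (b, d))] codes the sums of squares and products of a sample
   [(e_i, f_i)]: [a = S_ee], [sqrt a * b = S_ef] and [b ^+ 2 + d = S_ff];
   [z] is the contribution, orthogonal to the mean, of a new observation. *)
Definition ss_update (u : RR * (RR * RR)) (z : RR * RR) : RR * (RR * RR) :=
  let a' : R := u.1 + z.1 ^+ 2 in
  (a', ((Num.sqrt u.1 * u.2.1 + z.1 * z.2) / Num.sqrt a',
        u.2.2 + ((Num.sqrt u.1 * z.2 - z.1 * u.2.1) / Num.sqrt a') ^+ 2)).

Local Open Scope ereal_scope.

Lemma measurable_ss_update d (T : measurableType d)
    (u : T -> RR * (RR * RR)) (z : T -> RR * RR) :
  measurable_fun setT u -> measurable_fun setT z ->
  measurable_fun setT (fun t => ss_update (u t) (z t)).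
Proof. by move=> mu mz; rewrite /ss_update; meas. Qed.

Ltac meas_ss := repeat first [ meas_step
  | lazymatch goal with
    | |- measurable_fun _ (fun x => integral _ setT (fun y => @?F x y)) =>
        apply: (@measurable_fun_integral _ _ _ _ _ _ _ F) => //
    | |- measurable_fun _ (fun x => ss_update (@?u x) (@?z x)) =>
        apply: measurable_ss_update
    | |- measurable_fun _ (ss_update ?u) => apply: (@measurable_ss_update _ _ (fun=> u) id)
    end ].

Lemma std_normal2_rotation (c s : R) (f : (RR * RR) * (RR * RR) -> \bar R) :
  measurable_fun setT f -> (forall z, 0 <= f z) ->
  (0 < c)%R -> (c ^+ 2 + s ^+ 2 = 1)%R ->
  \int[std_normal2]_m \int[std_normal2]_z f (rot c s m z) =
  \int[std_normal2]_m \int[std_normal2]_z f (m, z).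
Proof.
move=> mf f0 c0 cs.
(* The four variables are regrouped by coordinate, since the rotation acts in the plane of the first
   coordinates and in that of the second ones. *)
have ex (g : (RR * RR) * (RR * RR) -> \bar R) : measurable_fun setT g -> (forall z, 0 <= g z) ->
    \int[std_normal2]_m \int[std_normal2]_z g (m, z) =
    \int[N01]_m1 \int[N01]_e \int[N01]_m2 \int[N01]_f g ((m1, m2), (e, f)).
  move=> mg g0; rewrite tonelli_prod; last 2 first.
  - by meas_int.
  - by move=> *; exact: integral_ge0.
  apply: eq_integral => m1 _.
  transitivity (\int[N01]_m2 \int[N01]_e \int[N01]_f g ((m1, m2), (e, f))).
    by apply: eq_integral => m2 _; rewrite tonelli_prod//; meas.
  apply: tonelli_swap; first by meas_int.
  by move=> *; exact: integral_ge0.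
rewrite (ex (fun p => f (rot c s p.1 p.2)))//=; last by rewrite /rot; meas.
rewrite (ex f mf f0) /rot/=.
transitivity (\int[N01]_m1 \int[N01]_e \int[N01]_m2 \int[N01]_f0
    f ((c * m1 + s * e, m2), (c * e - s * m1, f0))%R).
  apply: eq_integral => m1 _; apply: eq_integral => e _.
  rewrite (@std_normal_rotation R (fun p =>
    f ((c * m1 + s * e, p.1), (c * e - s * m1, p.2))%R))//.
  by meas.
apply: (@std_normal_rotation R (fun p => \int[N01]_m2 \int[N01]_f0
    f ((p.1, m2), (p.2, f0))) c s) => //.
- by meas_int; move=> *; exact: integral_ge0.
- by move=> *; do 2 apply: integral_ge0 => *.
Qed.

(** This allows [a] to be taken positive below, where its square root is proportional to the cosine
    of a rotation. *)
Lemma chi_gt0_ext k (g h : R -> \bar R) : (0 < k)%N ->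
  measurable_fun setT g -> (forall x, 0 <= g x) ->
  measurable_fun setT h -> (forall x, 0 <= h x) ->
  (forall a, (0 < a)%R -> g a = h a) ->
  \int[chi k]_a g a = \int[chi k]_a h a.
Proof.
case: k => // k _ mg g0 mh h0 gh.
have [K K0 dens] := chi_density R k.
rewrite !dens//; apply: eq_integral => t _.
have [t0|t0] := ltP 0%R t; first by rewrite gh.
by rewrite /gamma_kernel /pospow posE ltNge t0 !mul0r mulr0 !mule0.
Qed.

Lemma integral_ss_law k (f : RR * (RR * RR) -> \bar R) :
  measurable_fun setT f -> (forall z, 0 <= f z) ->
  \int[ss_law k]_u f u = \int[chi k]_a \int[N01]_b \int[chi k.-1]_d f (a, (b, d)).
Proof.
move=> mf f0; rewrite tonelli_prod//.
by apply: eq_integral => a _; rewrite tonelli_prod//; meas.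
Qed.

(** For fixed a > 0 and e, the update rotates (b, f) by the angle whose cosine and sine are sqrt a
    and e divided by sqrt (a + e^2). The rotated pair is again a pair of independent standard
    normals, whatever a and e are. Then e^2 adds a degree of freedom to [a], and the square of the
    second rotated coordinate adds one to [d]. *)
Lemma ss_update_law k (f : RR * (RR * RR) -> \bar R) : (0 < k)%N ->
  measurable_fun setT f -> (forall z, 0 <= f z) ->
  \int[ss_law k]_u \int[std_normal2]_z f (ss_update u z) = \int[ss_law k.+1]_u f u.
Proof.
move=> k0 mf f0; 
rewrite integral_ss_law; last 2 first.
- by meas_ss.
- by nn_int.
transitivity (\int[chi k]_a \int[N01]_e \int[chi k.-1]_d \int[N01]_b \int[N01]_f0
    f (a + e ^+ 2, (b, d + f0 ^+ 2))%R).
  apply: (chi_gt0_ext k0).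
  - by meas_ss; nn_int.
  - by nn_int.
  - by meas_ss; nn_int.
  - by nn_int.
  move=> a a0.
  (* The swaps bring [b] and the new second coordinate innermost, with [a], [d] and [e] frozen while
     the pair is rotated. *)
  transitivity (\int[N01]_b \int[chi k.-1]_d \int[N01]_e \int[N01]_f0
      f (ss_update (a, (b, d)) (e, f0))).
    apply: eq_integral => b _; apply: eq_integral => d _.
    by rewrite tonelli_prod//; meas_ss.
  etransitivity; first (apply: tonelli_swap; [by meas_ss; nn_int|by nn_int]).
  transitivity (\int[chi k.-1]_d \int[N01]_e \int[N01]_b \int[N01]_f0
      f (ss_update (a, (b, d)) (e, f0))).
    apply: eq_integral => d _; apply: tonelli_swap; first by meas_ss.
    by nn_int.
  etransitivity; first (apply: tonelli_swap; [by meas_ss; nn_int|by nn_int]).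
  apply: eq_integral => e _; apply: eq_integral => d _.
  have a'0 : (0 < a + e ^+ 2)%R by rewrite ltr_wpDr ?sqr_ge0.
  have q0 : (0 < Num.sqrt (a + e ^+ 2))%R by rewrite sqrtr_gt0.
  have s0 : (0 < Num.sqrt a)%R by rewrite sqrtr_gt0.
  pose F (p : R * R) := f (a + e ^+ 2, (p.1, d + p.2 ^+ 2))%R.
  have mF : measurable_fun setT F by rewrite /F; meas.
  have cs : ((Num.sqrt a / Num.sqrt (a + e ^+ 2)) ^+ 2 +
      (e / Num.sqrt (a + e ^+ 2)) ^+ 2 = 1)%R.
    by rewrite !expr_div_n !sqr_sqrtr ?ltW// -mulrDl divff// gt_eqF.
  etransitivity; last exact: (std_normal_rotation mF (fun=> f0 _) (divr_gt0 s0 q0) cs).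
  apply: eq_integral => b _; apply: eq_integral => f1 _; rewrite /F /ss_update/=.
  congr (f (_, (_, _ + _ ^+ 2)))%R.
    by rewrite mulrDl mulrAC (mulrAC e).
  by rewrite mulrBl mulrAC (mulrAC e).
rewrite integral_ss_law// integral_chiS; last 2 first.
- by meas_ss; nn_int.
- by nn_int.
apply: eq_integral => a _; apply: eq_integral => e _.
transitivity (\int[N01]_b \int[chi k.-1]_d \int[N01]_f0
    f (a + e ^+ 2, (b, d + f0 ^+ 2))%R).
  apply: tonelli_swap; first by meas_ss.
  by nn_int.
apply: eq_integral => b _; rewrite -[in RHS](prednK k0) integral_chiS//.
by meas_ss.
Qed.

End sampling_laws.

(** * Independence of two random elements *)

Section independence.
Context d d1 d2 (T : measurableType d) (S1 : measurableType d1)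
  (S2 : measurableType d2) (R : realType) (P : probability T R).
Variables (Y : T -> S1) (Z : T -> S2).
Hypotheses (mY : measurable_fun setT Y) (mZ : measurable_fun setT Z).
Local Open Scope ereal_scope.

Let mYZ : measurable_fun setT (fun w => (Y w, Z w)).
Proof. exact: measurable_fun_pair. Qed.

Lemma indep_pair_integral :
  (forall A B, measurable A -> measurable B ->
     P (Y @^-1` A `&` Z @^-1` B) = P (Y @^-1` A) * P (Z @^-1` B)) ->
  forall f : S1 * S2 -> \bar R, measurable_fun setT f -> (forall z, 0 <= f z) ->
  \int[P]_w f (Y w, Z w) = \int[P]_w \int[P]_w' f (Y w, Z w').
Proof.
move=> indep f mf f0.
pose Y' : {RV P >-> S1} := HB.pack Y (isMeasurableFun.Build _ _ _ _ Y mY).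
pose Z' : {RV P >-> S2} := HB.pack Z (isMeasurableFun.Build _ _ _ _ Z mZ).
transitivity (\int[pushforward_measure P mYZ]_z f z).
  by rewrite (ge0_integral_pushforward mYZ).
transitivity (\int[distribution P Y' \x distribution P Z']_z f z).
  apply: eq_measure_integral => A mA _; apply/esym.
  apply: measure_rectangles_unique => //.
    by rewrite (le_lt_trans (probability_le1 _ _))// ltry.
  by move=> A1 A2 mA1 mA2; rewrite /= product_measure1E//= /pushforward/= -indep.
rewrite tonelli_prod// ge0_integral_distribution//=; last 2 first.
- apply: (@measurable_fun_integral _ _ _ _ _ _ _ (fun x y => f (x, y))) => //.
  by meas.
- by move=> y; exact: integral_ge0.
apply: eq_integral => w _; rewrite ge0_integral_distribution//=.
by meas.
Qed.

(** For fixed [E] both sides are finite measures in [W] that agree on rectangles. This lets a new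
    observation be absorbed into the state while independence from the later observations
    persists. *)
Lemma indep_pair_event (E : set T) : measurable E ->
  (forall A B, measurable A -> measurable B ->
     P (Y @^-1` A `&` Z @^-1` B `&` E) = P (Y @^-1` A `&` Z @^-1` B) * P E) ->
  forall W, measurable W ->
  P ((fun w => (Y w, Z w)) @^-1` W `&` E) = P ((fun w => (Y w, Z w)) @^-1` W) * P E.
Proof.
move=> mE indep W mW.
pose r : {nonneg R} := NngNum (fine_ge0 (measure_ge0 P E)).
have rE : r%:num%:E = P E by rewrite /= fineK// fin_num_measure.
pose m1 := pushforward_measure (mrestr P mE) mYZ.
pose m2 : {measure set (S1 * S2) -> \bar R} := mscale r (pushforward_measure P mYZ).
have := @measure_rectangles_unique _ _ _ _ _ m1 m2 _ _ W mW.
rewrite /m1 /m2 /= /mscale/= /pushforward /mrestr/= rE muleC; apply.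
  by rewrite preimage_setT (le_lt_trans (probability_le1 _ _)) ?ltry//; exact: measurableI.
move=> A B mA mB; rewrite muleC; exact: indep.
Qed.

End independence.

(** * Sampling distribution of the sums of squares *)

Section sample_state.
Context (R : realType).
Local Notation RR := (measurableTypeR R).
Local Notation N01 := (std_normal R).
Local Notation N2 := (std_normal2 R).
Local Notation chi := (chi R).
Local Notation sample_space := ((RR * RR) * (RR * (RR * RR)))%type.

(* [(sqrt (k+1) * mean, (a, (b, d)))] for the first [k.+1] observations. *)
Fixpoint state (z : nat -> RR * RR) (k : nat) : sample_space :=
  match k with
  | 0 => (z 0, (0 : R, (0 : R, 0 : R)))
  | k'.+1 =>
    let r := rot (Num.sqrt k'.+1%:R / Num.sqrt k'.+2%:R) (Num.sqrt k'.+2%:R)^-1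
      (state z k').1 (z k'.+1) in
    (r.1, ss_update (state z k').2 r.2)
  end.

(** The one-pass update of a centered sum of products, where [q] and [p] are the square roots of the
    old and the new sample size. The case x = y, A = B gives the sums of squares. *)
Lemma cross_product_step (p q x y A B S : R) : 0 < q -> 0 < p -> p ^+ 2 = q ^+ 2 + 1 ->
  S - A * B / q ^+ 2 + (q / p * x - p^-1 * (A / q)) * (q / p * y - p^-1 * (B / q)) =
  S + x * y - (A + x) * (B + y) / p ^+ 2.
Proof.
move=> q0 p0 pq; have qn := lt0r_neq0 q0; have pn := lt0r_neq0 p0.
have q1 : q ^+ 2 + 1 != 0 by rewrite -pq expf_neq0.
have -> : (q / p * x - p^-1 * (A / q)) * (q / p * y - p^-1 * (B / q)) =
    (q * x - A / q) * (q * y - B / q) / p ^+ 2 by field; rewrite ?qn ?pn.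
by rewrite pq; field; rewrite ?qn ?q1.
Qed.

(** Distinct first coordinates of the first two observations make [a] positive from the second
    observation on; otherwise a division by zero in [ss_update] could lose the cross product. *)
Lemma state_sums (z : nat -> RR * RR) (k : nat) : ((z 0).1 : R) != (z 1).1 ->
  let N : R := k.+1%:R in
  let Se : R := \sum_(i < k.+1) (z i).1 in let Sf : R := \sum_(i < k.+1) (z i).2 in
  let m := (state z k).1 in let a : R := (state z k).2.1 in
  let b : R := (state z k).2.2.1 in let d : R := (state z k).2.2.2 in
  [/\ Num.sqrt N * m.1 = Se /\ Num.sqrt N * m.2 = Sf,
      a = \sum_(i < k.+1) (z i).1 ^+ 2 - Se ^+ 2 / N,
      Num.sqrt a * b = \sum_(i < k.+1) (z i).1 * (z i).2 - Se * Sf / N,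
      b ^+ 2 + d = \sum_(i < k.+1) (z i).2 ^+ 2 - Sf ^+ 2 / N &
      if k is 0%N then a = 0 else 0 < a].
Proof.
move=> z01; elim: k => [|k].
  by rewrite /= !big_ord1 sqrtr1 !mul1r !invr1 !mulr1 !expr2 !mulr0 !subrr addr0.
move=> /=; rewrite ![\sum_(i < k.+2) _]big_ord_recr/=.
have e0 : (k = 0)%N -> (z k.+1).1 - (state z k).1.1 != 0 :> R.
  by move=> ->; rewrite /= subr_eq0 eq_sym.
move: (z k.+1) (state z k) e0 => [x y] [[m1 m2] [a [b d]]] /= e0.
move: (\sum_(i < k.+1) (z i).1) (\sum_(i < k.+1) (z i).2) => Se Sf.
move: (\sum_(i < k.+1) (z i).1 ^+ 2) (\sum_(i < k.+1) (z i).1 * (z i).2)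
  (\sum_(i < k.+1) (z i).2 ^+ 2) => See Sef Sff.
have q0 : 0 < Num.sqrt k.+1%:R :> R by rewrite sqrtr_gt0.
have p0 : 0 < Num.sqrt k.+2%:R :> R by rewrite sqrtr_gt0.
have q2 : Num.sqrt k.+1%:R ^+ 2 = k.+1%:R :> R by rewrite sqr_sqrtr.
have p2 : Num.sqrt k.+2%:R ^+ 2 = k.+2%:R :> R by rewrite sqr_sqrtr.
have pq : Num.sqrt k.+2%:R ^+ 2 = Num.sqrt k.+1%:R ^+ 2 + 1 :> R.
  by rewrite q2 p2 -[in LHS]natr1.
have q1 : (k = 0)%N -> Num.sqrt k.+1%:R = 1 :> R by move=> ->; rewrite sqrtr1.
move: (Num.sqrt k.+1%:R) (Num.sqrt k.+2%:R) q0 p0 q2 p2 pq q1 => q p q0 p0 q2 p2 pq q1.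
rewrite -q2 -p2 => -[[mE mF] aE bE dE apos]; clear q2 p2; have qn := lt0r_neq0 q0; have pn := lt0r_neq0 p0.
have m1E : m1 = Se / q by rewrite -mE mulrC mulKf.
have m2E : m2 = Sf / q by rewrite -mF mulrC mulKf.
have a0 : 0 <= a by move: apos; case: k {e0 q1} => [->//|k /ltW].
set e := q / p * x - p^-1 * m1; set f := q / p * y - p^-1 * m2.
(* In the first update a = 0, and positivity comes from [e], a nonzero multiple of the difference of
   the two first coordinates. *)
have a'0 : 0 < a + e ^+ 2.
  move: apos; case: k e0 q1 => [e0 q1 a00|k _ _ ap]; last by rewrite ltr_pwDl ?sqr_ge0.
  rewrite a00 add0r exprn_even_gt0//= /e q1//.
  by rewrite mul1r -mulrBr mulf_neq0 ?invr_eq0// e0.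
split.
- by split; [rewrite -mE|rewrite -mF]; field.
- rewrite aE /e m1E.
  by have := cross_product_step x x Se Se See q0 p0 pq; rewrite -!expr2.
- rewrite [LHS]mulrC divfK ?gt_eqF ?sqrtr_gt0// bE /e /f m1E m2E.
  exact: cross_product_step.
- have -> : Sff + y ^+ 2 - (Sf + y) ^+ 2 / p ^+ 2 = b ^+ 2 + d + f ^+ 2.
    rewrite dE /f m2E.
    by have := cross_product_step y y Sf Sf Sff q0 p0 pq; rewrite -!expr2.
  rewrite !expr_div_n sqr_sqrtr ?ltW// addrCA -mulrDl.
  (* The two-square identity: the rotation preserves b^2 + f^2, so S_ff grows by exactly f^2. *)
  have -> : (Num.sqrt a * b + e * f) ^+ 2 + (Num.sqrt a * f - e * b) ^+ 2 =
      (a + e ^+ 2) * (b ^+ 2 + f ^+ 2).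
    by rewrite -[in RHS](sqr_sqrtr a0); ring.
  by rewrite mulrAC divff ?gt_eqF// mul1r; ring.
- exact: a'0.
Qed.

End sample_state.

Section state_law.
Context (R : realType).
Local Notation RR := (measurableTypeR R).
Local Notation N01 := (std_normal R).
Local Notation N2 := (std_normal2 R).
Local Notation sample_space := ((RR * RR) * (RR * (RR * RR)))%type.
Local Open Scope ereal_scope.

Lemma std_normal_neq0_ext (g h : R -> \bar R) :
  measurable_fun setT g -> (forall x, 0 <= g x) ->
  measurable_fun setT h -> (forall x, 0 <= h x) ->
  (forall x, x != 0%R -> g x = h x) ->
  \int[N01]_x g x = \int[N01]_x h x.
Proof.
move=> mg g0 mh h0 gh; have mphi := @measurable_phi R.
have mphi' (f : R -> \bar R) : measurable_fun setT f ->
    measurable_fun ([set: R] `\ (0 : R)%R) (fun x => f x * (phi x)%:E).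
  by move=> mf; apply: measurable_funTS; meas.
have mD : measurable ([set: R] `\ (0 : R)%R) by exact: measurableD.
rewrite !integral_std_normal// -(integral_setD1 mD (mphi' _ mg)).
rewrite -(integral_setD1 mD (mphi' _ mh)).
by apply: eq_integral => x /set_mem[_ /eqP x0]; rewrite gh.
Qed.

(** From the zero state the new [b] is x e / |e|, that is x up to the sign of e, and the symmetry of
    the normal law absorbs this sign. At e = 0 the quotient takes its default value 0, which a null
    set hides. *)
Lemma ss_update0_law (f : RR * (RR * RR) -> \bar R) :
  measurable_fun setT f -> (forall z, 0 <= f z) ->
  \int[N2]_z f (ss_update (0%R : RR, (0%R : RR, 0%R : RR)) z) = \int[ss_law R 1]_u f u.
Proof.
move=> mf f0; rewrite tonelli_prod//; last by rewrite /ss_update; meas.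
rewrite integral_ss_law// integral_chiS; last 2 first.
- by meas_int; nn_int.
- by nn_int.
rewrite integral_chi0; last by meas_int; nn_int.
pose g e := \int[N01]_x f (ss_update (0%R : RR, (0%R : RR, 0%R : RR)) (e, x)).
pose h e := \int[N01]_x f (e ^+ 2, (x, 0))%R.
transitivity (\int[N01]_e h e); last first.
  apply: eq_integral => e _; apply: eq_integral => x _.
  by rewrite integral_chi0 ?add0r//; meas.
apply: std_normal_neq0_ext.
- by rewrite /ss_update; meas_int; nn_int.
- by nn_int.
- by rewrite /h; meas_int; nn_int.
- by rewrite /h; nn_int.
move=> e e0; rewrite /h /ss_update/= sqrtr0.
have [ep|en] := ltP 0%R e.
  apply: eq_integral => x _; rewrite !add0r !mul0r !mulr0 subrr mul0r expr0n/= !add0r.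
  by rewrite sqrtr_sqr gtr0_norm// mulrC mulKf.
rewrite -[RHS]std_normal_opp; last 2 first.
- by meas.
- by nn_int.
apply: eq_integral => x _; rewrite !add0r !mul0r !mulr0 subrr mul0r expr0n/= !add0r.
by rewrite sqrtr_sqr ler0_norm// invrN mulrN mulrC mulKf.
Qed.

Context d (T : measurableType d) (P : probability T R) (Z : nat -> T -> RR * RR).
Hypothesis mZ : forall i, measurable_fun setT (Z i).

Lemma measurable_state k : measurable_fun setT (fun w => state (Z ^~ w) k).
Proof.
elim: k => [|k IH] /=.
  by have mZ0 := mZ 0; meas.
have mZk := mZ k.+1; rewrite /ss_update /rot/=; meas.
Qed.

(** The induction ranges over all test functions: integrating out the newest observation replaces
    [f] by [G f], to which the induction hypothesis applies. *)
Lemma state_law (m k : nat) :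
  (forall f : RR * RR -> \bar R, measurable_fun setT f -> (forall z, 0 <= f z) ->
    forall i, (i <= m)%N -> \int[P]_w f (Z i w) = \int[N2]_z f z) ->
  (forall f : sample_space * (RR * RR) -> \bar R, measurable_fun setT f ->
    (forall z, 0 <= f z) -> forall i, (i < m)%N ->
    \int[P]_w f (state (Z ^~ w) i, Z i.+1 w) =
    \int[P]_w \int[P]_w' f (state (Z ^~ w) i, Z i.+1 w')) ->
  (k < m)%N ->
  forall f : sample_space -> \bar R, measurable_fun setT f -> (forall z, 0 <= f z) ->
  \int[P]_w f (state (Z ^~ w) k.+1) = \int[N2]_x \int[ss_law R k.+1]_u f (x, u).
Proof.
move=> lawZ indepZ km f mf f0.
pose upd j (p : sample_space * (RR * RR)) : sample_space :=
  let r := rot (Num.sqrt j.+1%:R / Num.sqrt j.+2%:R) (Num.sqrt j.+2%:R)^-1 p.1.1 p.2 in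
  (r.1, ss_update p.1.2 r.2).
have mupd j : measurable_fun setT (upd j).
  by rewrite /upd /rot /ss_update /=; meas.
pose G (g : sample_space -> \bar R) j (s : sample_space) := \int[N2]_z g (upd j (s, z)).
have mG : forall g j, measurable_fun setT g -> (forall z, 0 <= g z) -> measurable_fun setT (G g j).
  by move=> g j mg g0; rewrite /G; have mu := mupd j; meas_int.
have G0 : forall g j s, (forall z, 0 <= g z) -> 0 <= G g j s by move=> g j s g0; exact: integral_ge0.
have step : forall g j, measurable_fun setT g -> (forall z, 0 <= g z) -> (j < m)%N ->
    \int[P]_w g (state (Z ^~ w) j.+1) = \int[P]_w G g j (state (Z ^~ w) j).
  move=> g j mg g0 jm.
  have := indepZ (fun p => g (upd j p)).
  rewrite /upd /= => -> //; last exact: (measurableT_comp mg (mupd j)).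
  apply: eq_integral => w _.
  rewrite (lawZ (fun z => g (upd j (state (Z ^~ w) j, z))))//.
  by apply: (measurableT_comp mg); apply: (measurableT_comp (mupd j)); meas.
have rotation : forall g j u, measurable_fun setT g -> (forall z, 0 <= g z) ->
    \int[N2]_x G g j (x, u) = \int[N2]_x \int[N2]_z g (x, ss_update u z).
  move=> g j u mg g0.
  apply: (@std_normal2_rotation R (Num.sqrt j.+1%:R / Num.sqrt j.+2%:R)
    (Num.sqrt j.+2%:R)^-1 (fun p => g (p.1, ss_update u p.2))) => //.
  - by rewrite /ss_update; meas.
  - rewrite expr_div_n exprVn !sqr_sqrtr// -[X in (_ + X)%R]mul1r -mulrDl natr1.
    by rewrite divff.
elim: k km f mf f0 => [|k IH] km f mf f0.
  rewrite step//= (lawZ (fun z => G f 0%N (z, (0%R : RR, (0%R : RR, 0%R : RR)))))//; last 2 first.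
  - by have mG0 := mG _ 0%N mf f0; meas.
  - by move=> z; exact: G0.
  rewrite rotation//; apply: eq_integral => x _.
  by rewrite (ss_update0_law (f := fun u => f (x, u)))//; meas.
have mG' := mG _ k.+1 mf f0.
rewrite (step f k.+1 mf f0 km) (IH (ltnW km) (G f k.+1) mG' (fun z => G0 _ _ _ f0)).
(* The rotation mixes the mean with the new observation for a fixed state [u], so the mean has to be
   integrated inside [u]. *)
etransitivity; first (apply: tonelli_swap; [by meas|by move=> *; exact: G0]).
transitivity (\int[ss_law R k.+1]_u \int[N2]_x \int[N2]_z f (x, ss_update u z)).
  by apply: eq_integral => u _; rewrite rotation.
etransitivity; first apply: tonelli_swap.
- by rewrite /ss_update; meas_int; nn_int.
- by nn_int.
by apply: eq_integral => x _; rewrite (ss_update_law (f := fun u => f (x, u)))//; meas.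
Qed.

End state_law.

(** * Standardization of the bivariate normal law *)

Section binormal.
Context (R : realType).

(* Standardization [x1 -> e] and [x2 | x1 -> f], where [f] has the conditional
   standard deviation [sigma2 * sqrt (1 - rho^2)] as its unit. *)
Definition standardize (mu1 mu2 sigma1 sigma2 rho : R) (x : R * R) : R * R :=
  ((x.1 - mu1) / sigma1,
   (x.2 - mu2 - rho * sigma2 / sigma1 * (x.1 - mu1)) /
     (sigma2 * Num.sqrt (1 - rho ^+ 2))).

Lemma det_covmx (sigma1 sigma2 rho : R) :
  \det (covmx sigma1 sigma2 rho) = sigma1 ^+ 2 * sigma2 ^+ 2 * (1 - rho ^+ 2).
Proof.
rewrite (expand_det_row _ ord0) !big_ord_recl big_ord0 /cofactor !det_mx11 !mxE/=.
by rewrite !addn0 !addn1 !expr0 !expr1; ring.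
Qed.

Lemma covmx_quadratic (sigma1 sigma2 rho : R) (v : 'cV[R]_2) :
  sigma1 != 0 -> sigma2 != 0 -> 1 - rho ^+ 2 != 0 ->
  (v^T *m invmx (covmx sigma1 sigma2 rho) *m v) ord0 ord0 =
  (v 0 0 ^+ 2 / sigma1 ^+ 2 - 2 * rho * (v 0 0 * v 1 0) / (sigma1 * sigma2) +
    v 1 0 ^+ 2 / sigma2 ^+ 2) / (1 - rho ^+ 2).
Proof.
move=> s1 s2 r0.
pose M : 'M[R]_2 := \matrix_(i < 2, j < 2)
  if i == j then (if i == ord0 then (sigma1 ^+ 2 * (1 - rho ^+ 2))^-1
                  else (sigma2 ^+ 2 * (1 - rho ^+ 2))^-1)
  else - rho / (sigma1 * sigma2 * (1 - rho ^+ 2)).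
have MC : covmx sigma1 sigma2 rho *m M = 1%:M.
  apply/matrixP => i j; rewrite !mxE !big_ord_recl big_ord0 !mxE /=.
  by case: i => -[|[|//]] ?; case: j => -[|[|//]] ?; rewrite /=; field; rewrite ?s1 ?s2 ?r0.
have -> : invmx (covmx sigma1 sigma2 rho) = M.
  have [uC _] := mulmx1_unit MC.
  by rewrite -[invmx _]mulmx1 -MC mulmxA mulVmx// mul1mx.
rewrite !mxE !big_ord_recl big_ord0 !mxE /= !big_ord_recl !big_ord0 !mxE /=.
have -> : lift ord0 ord0 = 1 :> 'I_2 by exact/val_inj.
have -> : ord0 = 0 :> 'I_2 by exact/val_inj.
by field; rewrite ?s1 ?s2 ?r0.
Qed.

(** Completing the square in the second coordinate factors the joint density into the marginal
    density of x1 and the conditional density of x2 given x1. *)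
Lemma binormal_pdfE (mu1 mu2 sigma1 sigma2 rho : R) (x : R * R) :
  0 < sigma1 -> 0 < sigma2 -> -1 < rho < 1 ->
  binormal_pdf (mu1, mu2) (covmx sigma1 sigma2 rho) x =
  phi (standardize mu1 mu2 sigma1 sigma2 rho x).1 *
  phi (standardize mu1 mu2 sigma1 sigma2 rho x).2 /
    (sigma1 * (sigma2 * Num.sqrt (1 - rho ^+ 2))).
Proof.
move=> s1 s2 /andP[r1 r2]; have r0 : 0 < 1 - rho ^+ 2 by nra.
have s0 : 0 < Num.sqrt (1 - rho ^+ 2) by rewrite sqrtr_gt0.
have sE := sqr_sqrtr (ltW r0).
rewrite /binormal_pdf det_covmx covmx_quadratic ?gt_eqF// !mxE/=.
have -> : Num.sqrt (sigma1 ^+ 2 * sigma2 ^+ 2 * (1 - rho ^+ 2)) =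
    sigma1 * (sigma2 * Num.sqrt (1 - rho ^+ 2)).
  rewrite -exprMn -[X in _ * X]sE -exprMn sqrtr_sqr gtr0_norm ?mulrA//.
  by rewrite !mulr_gt0.
rewrite /phi [in RHS]mulrACA -expRD -invfM -expr2 sqr_sqrtr; last first.
  by rewrite mulrn_wge0// pi_ge0.
set E1 := expR _; set E2 := expR _.
have -> : E1 = E2.
  rewrite /E1 /E2; congr expR.
  rewrite [X in _ = _ + - (X / 2)]expr_div_n (exprMn 2 sigma2) sE.
  by field; rewrite !gt_eqF.
rewrite -(mulr_natl pi); move: (pi_gt0 R); move: pi => p p0.
by field; rewrite !gt_eqF.
Qed.

End binormal.

Section standardize_law.
Context (R : realType).
Notation mu := (@lebesgue_measure R).
Local Notation RR := (measurableTypeR R).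
Local Notation N2 := (std_normal2 R).
Variables (mu1 mu2 sigma1 sigma2 rho : R).
Hypotheses (s1 : 0 < sigma1) (s2 : 0 < sigma2) (rho1 : -1 < rho < 1).
Local Open Scope ereal_scope.

Let tau : R := (sigma2 * Num.sqrt (1 - rho ^+ 2))%R.

Let tau0 : (0 < tau)%R.
Proof.
by move/andP: rho1 => [r1 r2]; rewrite /tau mulr_gt0// sqrtr_gt0; nra.
Qed.

Lemma measurable_standardize :
  measurable_fun setT (standardize mu1 mu2 sigma1 sigma2 rho : RR * RR -> RR * RR).
Proof. by rewrite /standardize; meas. Qed.

Lemma integral_std_normal2 (f : RR * RR -> \bar R) :
  measurable_fun setT f -> (forall z, 0 <= f z) ->
  \int[N2]_z f z = \int[mu]_x \int[mu]_y (f (x, y) * (phi x * phi y)%:E).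
Proof.
move=> mf f0; have mphi := @measurable_phi R.
rewrite tonelli_prod// integral_std_normal; last 2 first.
- by meas_int; nn_int.
- by nn_int.
apply: eq_integral => x _; rewrite integral_std_normal//; last by meas.
rewrite muleC -ge0_integralZl_EFin ?phi_ge0//; last 2 first.
- by move=> y _; rewrite mule_ge0// lee_fin phi_ge0.
- by meas.
by apply: eq_integral => y _; rewrite muleCA EFinM.
Qed.

(** The standardizing map is triangular: once the first coordinate is substituted, the second
    substitution is affine with a shift depending on the first. *)
Lemma integral_standardize (f : RR * RR -> \bar R) :
  measurable_fun setT f -> (forall z, 0 <= f z) ->
  \int[mu]_x \int[mu]_y
    (f (standardize mu1 mu2 sigma1 sigma2 rho (x, y)) * ((sigma1 * tau)^-1)%:E) =
  \int[mu]_x \int[mu]_y f (x, y).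
Proof.
move=> mf f0; have ms := measurable_standardize.
have sn := lt0r_neq0 s1; have tn := lt0r_neq0 tau0.
have c0 : (0 <= (sigma1 * tau)^-1)%R by rewrite invr_ge0 mulr_ge0 ?ltW.
rewrite (ge0_integral_affine mu1 s1); last 2 first.
- by meas_int; move=> *; rewrite mule_ge0.
- by move=> *; apply: integral_ge0 => *; rewrite mule_ge0.
apply: eq_integral => x _.
rewrite (ge0_integral_affine (mu2 + rho * sigma2 * x)%R tau0); last 2 first.
- by meas.
- by move=> *; rewrite mule_ge0.
rewrite muleC -ge0_integralZl_EFin ?ltW//; last 2 first.
- by move=> y _; rewrite !mule_ge0// lee_fin ltW.
- by meas.
apply: eq_integral => y _; rewrite -!muleA -EFinM muleCA -EFinM.
have -> : (sigma1 * ((sigma1 * tau)^-1 * tau) = 1)%R by field; rewrite sn tn.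
rewrite mule1 /standardize/= -/tau; congr (f (_, _)).
  by rewrite addrK mulrC mulKf.
by field; rewrite sn tn.
Qed.

Lemma standardize_law d (T : measurableType d) (P : probability T R)
    (Z : {RV P >-> (R * R)%type}) (f : RR * RR -> \bar R) :
  is_binormal Z (mu1, mu2) (covmx sigma1 sigma2 rho) ->
  measurable_fun setT f -> (forall z, 0 <= f z) ->
  \int[P]_w f (standardize mu1 mu2 sigma1 sigma2 rho (Z w)) = \int[N2]_z f z.
Proof.
move=> lawZ mf f0; have ms := measurable_standardize; have mphi := @measurable_phi R.
pose g x := (phi (standardize mu1 mu2 sigma1 sigma2 rho x).1 *
   phi (standardize mu1 mu2 sigma1 sigma2 rho x).2 * (sigma1 * tau)^-1)%R.
have mg : measurable_fun setT (g : RR * RR -> R) by rewrite /g; meas.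
have g0 x : (0 <= g x)%R.
  by rewrite /g mulr_ge0 ?invr_ge0 ?mulr_ge0 ?phi_ge0// ltW.
have mZ : measurable_fun setT (Z : T -> RR * RR) by exact: (@measurable_funPT _ _ _ _ Z).
pose Z' : {RV P >-> (RR * RR)%type} := HB.pack (Z : T -> RR * RR)
  (isMeasurableFun.Build _ _ _ _ (Z : T -> RR * RR) mZ).
rewrite -(@ge0_integral_distribution _ _ _ _ _ P Z'
  (fun x => f (standardize mu1 mu2 sigma1 sigma2 rho x)))//; last by meas.
etransitivity.
  apply: (@ge0_integral_density _ _ _ (mu \x mu) (distribution P Z') g) => //.
    move=> B mB; transitivity (distribution P Z B); first by [].
    by rewrite lawZ//; apply: eq_integral => x _; rewrite binormal_pdfE.
  by meas.
rewrite tonelli_prod; last 2 first.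
- by meas.
- by move=> x; rewrite mule_ge0// lee_fin.
rewrite (integral_std_normal2 mf f0).
have mh : measurable_fun setT (fun z : RR * RR => f z * (phi z.1 * phi z.2)%:E) by meas.
have h0 (z : RR * RR) : 0 <= f z * (phi z.1 * phi z.2)%:E.
  by rewrite mule_ge0// lee_fin mulr_ge0 ?phi_ge0.
rewrite -(integral_standardize mh h0).
by apply: eq_integral => x _; apply: eq_integral => y _; rewrite /g EFinM muleA.
Qed.

End standardize_law.

(** * Mutual independence along the sample *)

Lemma bigcap_preimage_update (T S : Type) (I : finType) (X : I -> T -> S) (i0 : I)
    (J : {set I}) (B0 : set S) (B : I -> set S) : i0 \notin J ->
  X i0 @^-1` B0 `&` \bigcap_(i in [set` J]) (X i @^-1` B i) =
  \bigcap_(i in [set` (i0 |: J)%SET]) (X i @^-1` (if i == i0 then B0 else B i)).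
Proof.
move=> i0J.
have ne i : i \in J -> (i == i0) = false by move=> iJ; apply: contraNF i0J => /eqP <-.
apply/seteqP; split => w /=.
  move=> [w0 wJ] i /=; rewrite !inE => /predU1P[->|iJ]; first by rewrite eqxx.
  by rewrite ne//; exact: wJ.
move=> wJ; split.
  by have := wJ i0; rewrite eqxx; apply; rewrite /= setU11.
by move=> i /= iJ; have := wJ i; rewrite /= ne//; apply; rewrite setU1r.
Qed.

Section mutual_independence.
Context d d' (T : measurableType d) (S : measurableType d') (R : realType)
  (P : probability T R) (I : finType) (X : I -> T -> S).
Hypothesis indepX : forall (J : {set I}) (B : I -> set S),
  (forall i, measurable (B i)) ->
  P (\bigcap_(i in [set` J]) (X i @^-1` B i)) = (\prod_(i in J) P (X i @^-1` B i))%E.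

Lemma mutually_independent_cons (i0 : I) (J : {set I}) (B0 : set S) (B : I -> set S) :
  i0 \notin J -> measurable B0 -> (forall i, measurable (B i)) ->
  (P (X i0 @^-1` B0 `&` \bigcap_(i in [set` J]) (X i @^-1` B i)) =
   P (X i0 @^-1` B0) * P (\bigcap_(i in [set` J]) (X i @^-1` B i)))%E.
Proof.
move=> i0J mB0 mB; pose B' i := if i == i0 then B0 else B i.
have mB' i : measurable (B' i) by rewrite /B'; case: ifP.
rewrite bigcap_preimage_update//.
rewrite -[X in P X]/(\bigcap_(i in [set` (i0 |: J)%SET]) (X i @^-1` B' i)).
rewrite !indepX// big_setU1//= {1}/B' eqxx; congr (_ * _)%E.
by apply: eq_bigr => i iJ; rewrite /B'; case: eqP i0J => // <-; rewrite iJ.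
Qed.

End mutual_independence.

Section sample.
Context (R : realType).
Local Notation RR := (measurableTypeR R).
Local Notation N2 := (std_normal2 R).
Local Notation sample_space := ((RR * RR) * (RR * (RR * RR)))%type.
Context d (T : measurableType d) (P : probability T R) (m : nat).
Variable Z : nat -> T -> RR * RR.
Hypothesis mZ : forall i, measurable_fun setT (Z i).
Hypothesis indepZ : forall (J : {set 'I_m.+1}) (B : 'I_m.+1 -> set (RR * RR)),
  (forall i, measurable (B i)) ->
  P (\bigcap_(i in [set` J]) (Z i @^-1` B i)) = (\prod_(i in J) P (Z i @^-1` B i))%E.

Local Notation st k := (fun w => state (Z ^~ w) k).

Let measurable_preimage k A : measurable A -> measurable (Z k @^-1` A).
Proof. by move=> mA; rewrite -[X in measurable X]setTI; exact: mZ. Qed.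

(** The next state is a function of the present state and the next observation, so rectangles in
    this pair suffice. On a rectangle the induction hypothesis is used twice: with the next index
    alone, and with the next index added to [J]. *)
Lemma state_independent k (kl : (k < m.+1)%N) (C : set sample_space) (J : {set 'I_m.+1})
    (B : 'I_m.+1 -> set (RR * RR)) :
  measurable C -> (forall j : 'I_m.+1, j \in J -> (k < j)%N) ->
  (forall i, measurable (B i)) ->
  (P (st k @^-1` C `&` \bigcap_(i in [set` J]) (Z i @^-1` B i)) =
   P (st k @^-1` C) * P (\bigcap_(i in [set` J]) (Z i @^-1` B i)))%E.
Proof.
elim: k kl C J B => [|k IH] kl C J B mC Jk mB.
  pose C0 := (fun z : RR * RR => (z, (0 : RR, (0 : RR, 0 : RR)))) @^-1` C.
  have mC0 : measurable C0.
    have mpair : measurable_fun setT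
        (fun z : RR * RR => (z, (0 : RR, (0 : RR, 0 : RR)))) by meas.
    by rewrite -[X in measurable X]setTI; exact: mpair.
  apply: (mutually_independent_cons indepZ (i0 := Ordinal kl) (B0 := C0)) => //.
  by apply/negP => /Jk; rewrite ltnn.
pose U (p : sample_space * (RR * RR)) : sample_space :=
  let r := rot (Num.sqrt k.+1%:R / Num.sqrt k.+2%:R) (Num.sqrt k.+2%:R)^-1 p.1.1 p.2 in
  (r.1, ss_update p.1.2 r.2).
have mU : measurable_fun setT U by rewrite /U /rot /ss_update /=; meas.
have mJ : measurable (\bigcap_(i in [set` J]) (Z i @^-1` B i)).
  by apply: fin_bigcap_measurable => // i _; exact: measurable_preimage.
pose i0 := Ordinal kl.
have i0J : i0 \notin J by apply/negP => /Jk; rewrite ltnn.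
apply: (@indep_pair_event _ _ _ _ _ _ _ P _ _ (measurable_state mZ k) (mZ k.+1)
  _ mJ _ (U @^-1` C)); last first.
  by rewrite -[X in measurable X]setTI; exact: mU.
move=> A B0 mA mB0; have kl' := ltnW kl.
have E0 : \bigcap_(i in [set` [set i0]%SET]) (Z i @^-1` B0) = Z k.+1 @^-1` B0.
  apply/seteqP; split => w /=; first by move=> /(_ i0); apply; rewrite /= set11.
  by move=> wB i /=; rewrite inE => /eqP ->.
have E1 := IH kl' A [set i0]%SET (fun=> B0) mA.
rewrite E0 in E1; rewrite E1//; last by move=> j; rewrite inE => /eqP ->.
have E2 := mutually_independent_cons indepZ i0J mB0 mB.
rewrite -muleA -E2 -setIA.
pose B' i := if i == i0 then B0 else B i.
have mB' i : measurable (B' i) by rewrite /B'; case: ifP.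
have -> : Z k.+1 @^-1` B0 `&` \bigcap_(i in [set` J]) (Z i @^-1` B i) =
    \bigcap_(i in [set` (i0 |: J)%SET]) (Z i @^-1` B' i).
  exact: (@bigcap_preimage_update _ _ _ (fun i : 'I_m.+1 => Z i)).
apply: IH => // j; rewrite !inE => /predU1P[->//|/Jk]; exact: ltnW.
Qed.

Lemma sample_law k (f : sample_space -> \bar R) : (k < m)%N ->
  (forall f : RR * RR -> \bar R, measurable_fun setT f -> (forall z, 0 <= f z)%E ->
    forall i, (i <= m)%N -> \int[P]_w f (Z i w) = \int[N2]_z f z)%E ->
  measurable_fun setT f -> (forall z, 0 <= f z)%E ->
  (\int[P]_w f (st k.+1 w) = \int[N2]_x \int[ss_law R k.+1]_u f (x, u))%E.
Proof.
move=> km lawZ mf f0.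
refine (@state_law _ _ _ P Z m k lawZ _ km f mf f0).
move=> g mg g0 i im.
apply: (indep_pair_integral (measurable_state mZ i) (mZ i.+1)) => //.
move=> A B mA mB; have il : (i.+1 < m.+1)%N by [].
have := state_independent (ltnW il) (J := [set Ordinal il]%SET) (B := fun=> B) mA.
have -> : \bigcap_(j in [set` [set Ordinal il]%SET]) (Z j @^-1` B) = Z i.+1 @^-1` B.
  apply/seteqP; split => w /=.
    by move=> /(_ (Ordinal il)); apply; rewrite /= set11.
  by move=> wB j /=; rewrite inE => /eqP ->.
by apply => // j; rewrite inE => /eqP ->.
Qed.

End sample.

(** * Chi-squared random variables and their densities *)

Section chi2_variables.
Context d (T : measurableType d) (R : realType) (Q : probability T R).
Local Notation RR := (measurableTypeR R).
Notation mu := (@lebesgue_measure R).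
Local Open Scope ereal_scope.

Lemma is_chi2_density (W : {RV Q >-> R}) (m : R) : is_chi2 W m ->
  exists2 K : R, (0 < K)%R &
  forall f : R -> \bar R, measurable_fun setT f -> (forall x, 0 <= f x) ->
  \int[Q]_w f (W w) = \int[mu]_t (f t * (K * gamma_kernel (m / 2) t)%:E).
Proof.
move=> lawW; pose K : R := ((1 / 2) `^ (m / 2) / Gamma_fun (m / 2))%R.
have mg := @measurable_gamma_kernel R (m / 2).
have K0 : (0 <= K)%R.
  rewrite /K divr_ge0 ?powR_ge0// /Gamma_fun; apply: Rintegral_ge0 => x _.
  by rewrite mulr_ge0 ?powR_ge0 ?expR_ge0.
have mW : measurable_fun setT (W : T -> RR) by exact: (@measurable_funPT _ _ _ _ W).
pose W' : {RV Q >-> RR} := HB.pack (W : T -> RR)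
  (isMeasurableFun.Build _ _ _ _ (W : T -> RR) mW).
have dens (f : R -> \bar R) : measurable_fun setT f -> (forall x, 0 <= f x) ->
    \int[Q]_w f (W w) = \int[mu]_t (f t * (K * gamma_kernel (m / 2) t)%:E).
  move=> mf f0; rewrite -(@ge0_integral_distribution _ _ _ _ _ Q W' f)//.
  apply: (@ge0_integral_density _ _ _ mu (distribution Q W')) => //.
  - by meas.
  - by move=> x; rewrite mulr_ge0 ?gamma_kernel_ge0.
  move=> B mB; transitivity (distribution Q W B); first by [].
  rewrite lawW// integral_mkcondr; apply: eq_integral => t _.
  rewrite patchE mem_setE in_itv/= andbT /gamma_kernel /pospow posE.
  case: ifP => t0; last by rewrite !mul0r mulr0.
  rewrite /gamma_pdf -/K mul1r -mulrA; congr (_ * (_ * expR _))%:E.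
    by rewrite mul1r.
  by rewrite mulNr mulrC.
(* Positivity of the constant is read off from total mass one, not from a property of
   [Gamma_fun]. *)
exists K => //; rewrite lt_neqAle K0 andbT; apply/eqP => K00.
have := dens (cst 1) (measurable_cst _) (fun=> lee01).
rewrite [LHS]integral_cst// [X in 1 * X]probability_setT mule1 -K00.
under eq_integral do rewrite mul0r mule0.
by rewrite integral0 => /eqP; rewrite onee_eq0.
Qed.

(** Both laws are multiples of the same kernel and have total mass one, so the constants agree; this
    replaces the values of Gamma at half-integers. *)
Lemma is_chi2_law (W : {RV Q >-> R}) (j : nat) (f : R -> \bar R) :
  is_chi2 W j.+1%:R -> measurable_fun setT f -> (forall x, 0 <= f x) ->
  \int[Q]_w f (W w) = \int[chi R j.+1]_x f x.
Proof.
move=> /is_chi2_density[K K0 Kdens] mf f0.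
have [C C0 Cdens] := chi_density R j.
have mg := @measurable_gamma_kernel R (j.+1%:R / 2).
pose J := \int[mu]_t (gamma_kernel (j.+1%:R / 2) t)%:E.
have JE c : (0 < c)%R -> \int[mu]_t (cst 1 t * (c * gamma_kernel (j.+1%:R / 2) t)%:E) = c%:E * J.
  move=> c0; rewrite /J -ge0_integralZl_EFin//; last 3 first.
  - by move=> t _; rewrite lee_fin gamma_kernel_ge0.
  - by meas.
  - exact: ltW.
  by apply: eq_integral => t _; rewrite mul1e EFinM.
have KJ : K%:E * J = 1.
  rewrite -(JE _ K0) -Kdens// [LHS]integral_cst// [X in 1 * X]probability_setT.
  by rewrite mule1.
have CJ : C%:E * J = 1.
  rewrite -(JE _ C0) -Cdens// [LHS]integral_cst// [X in 1 * X]probability_setT.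
  by rewrite mule1.
suff KC : K = C by rewrite Kdens// Cdens// KC.
have Jfin : J \is a fin_num.
  move: KJ; case: J {JE CJ} => [//||].
  - by rewrite gt0_muley ?lte_fin.
  - by rewrite gt0_muleNy ?lte_fin.
apply: (@mulIf _ (fine J)).
  by apply/eqP => J0; move: KJ; rewrite -(fineK Jfin) J0 mule0 => /eqP; rewrite eq_sym onee_eq0.
by apply: EFin_inj; rewrite !EFinM fineK// KJ CJ.
Qed.

End chi2_variables.

(** * Coverage *)

Section quantiles.
Context d (T : measurableType d) (R : realType) (Q : probability T R).

(** The limits of the distribution function at both infinities make the infimum meaningful, and
    right continuity gives the exact equivalence, also for laws with atoms or gaps. *)
Lemma lt_quantile (W : T -> R) (beta theta : R) :
  measurable_fun setT W -> 0 < beta < 1 ->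
  (theta < quantile Q W beta) = (Q [set w | (W w <= theta)%R] < beta%:E)%E.
Proof.
move=> mW /andP[beta0 beta1].
pose W' : {RV Q >-> R} := HB.pack W (isMeasurableFun.Build _ _ _ _ W mW).
have cdfE q : Q [set w | (W w <= q)%R] = cdf W' q.
  have -> : [set w | (W w <= q)%R] = W' @^-1` `]-oo, q]; last by [].
  by apply/seteqP; split => w /=; rewrite in_itv.
rewrite /quantile; under eq_set do rewrite cdfE; rewrite cdfE.
set S := [set q | _].
have S0 : S !=set0.
  have : \forall q \near +oo, (beta%:E < cdf W' q)%E.
    have b1 : (beta%:E < 1)%E by rewrite lte_fin.
    exact: (@cvg_cdfy1 _ _ _ Q W' _ (open_ereal_gt' b1)).
  case => M [_ HM]; exists (M + 1); apply/ltW/HM; by rewrite ltrDl.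
have Slb : has_lbound S.
  have : \forall q \near -oo, (cdf W' q < beta%:E)%E.
    have b0 : (0 < beta%:E)%E by rewrite lte_fin.
    exact: (@cvg_cdfNy0 _ _ _ Q W' _ (open_ereal_lt' b0)).
  case => M [_ HM]; exists M => q Sq; rewrite leNgt; apply/negP => qM.
  by have := lt_le_trans (HM _ qM) Sq; rewrite ltxx.
apply/idP/idP => [thq|thb].
  rewrite ltNge; apply/negP => bth.
  by have := lt_le_trans thq (ge_inf Slb bth); rewrite ltxx.
(* The distribution function stays below [beta] up to theta + e/2, which is therefore a lower bound
   of the set and separates [theta] from its infimum. *)
have [e /= e0 He] := @cdf_right_continuous _ _ _ Q W' theta _ (open_ereal_lt' thb).
apply: (@lt_le_trans _ _ (theta + e / 2)); first by rewrite ltrDl divr_gt0.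
apply: lb_le_inf => // q Sq; rewrite leNgt; apply/negP => qe.
have : (cdf W' (theta + e / 2) < beta%:E)%E.
  apply: He; last by rewrite ltrDl divr_gt0.
  by rewrite /= opprD addrA subrr add0r normrN gtr0_norm ?divr_gt0// gtr_pMr// invf_lt1// ltr1n.
move=> /(le_lt_trans (cdf_nondecreasing W' (ltW qe))) /(le_lt_trans Sq).
by rewrite ltxx.
Qed.

End quantiles.

Section centered_sums.
Context (R : realType).

Lemma centered_sum (n : nat) (f g : 'I_n -> R) : (0 < n)%N ->
  \sum_(k < n) (f k - n%:R^-1 * \sum_(i < n) f i) * (g k - n%:R^-1 * \sum_(i < n) g i) =
  \sum_(k < n) f k * g k - (\sum_(k < n) f k) * (\sum_(k < n) g k) / n%:R.
Proof.
move=> n0; have nn : n%:R != 0 :> R by rewrite pnatr_eq0 -lt0n.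
set F := \sum_(k < n) f k; set G := \sum_(k < n) g k.
under eq_bigr => k _.
  rewrite (_ : _ * _ = f k * g k - (n%:R^-1 * G * f k + n%:R^-1 * F * g k)
    + n%:R^-1 ^+ 2 * F * G); last by field.
  over.
rewrite big_split /= sumrB big_split /= -!mulr_sumr -/F -/G sumr_const card_ord.
by rewrite -mulr_natl; field.
Qed.

Variables (mu1 mu2 sigma1 sigma2 rho : R).
Hypotheses (s1 : 0 < sigma1) (s2 : 0 < sigma2) (rho1 : -1 < rho < 1).

Let tau := sigma2 * Num.sqrt (1 - rho ^+ 2).

Let tau0 : 0 < tau.
Proof.
by move/andP: rho1 => [r1 r2]; rewrite /tau mulr_gt0// sqrtr_gt0; nra.
Qed.

Lemma sums_standardize (n : nat) (x : 'I_n -> R * R) : (0 < n)%N ->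
  let e k := (standardize mu1 mu2 sigma1 sigma2 rho (x k)).1 in
  let f k := (standardize mu1 mu2 sigma1 sigma2 rho (x k)).2 in
  let c (u v : 'I_n -> R) :=
    \sum_(k < n) u k * v k - (\sum_(k < n) u k) * (\sum_(k < n) v k) / n%:R in
  [/\ s11 x = sigma1 ^+ 2 * c e e,
      s12 x = sigma1 * (rho * sigma2 * c e e + tau * c e f) &
      s22 x = (rho * sigma2) ^+ 2 * c e e + 2 * (rho * sigma2 * tau) * c e f
              + tau ^+ 2 * c f f].
Proof.
move=> n0 e f c; have nn : n%:R != 0 :> R by rewrite pnatr_eq0 -lt0n.
have sn := lt0r_neq0 s1; have tn := lt0r_neq0 tau0.
have x1E k : (x k).1 = mu1 + sigma1 * e k by rewrite /e /=; field.
have x2E k : (x k).2 = mu2 + rho * sigma2 * e k + tau * f k.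
  by rewrite /e /f /= -/tau; field; rewrite sn tn.
have d1 : forall k, (x k).1 - xbar1 x = sigma1 * (e k - n%:R^-1 * \sum_(i < n) e i).
  move=> k.
  rewrite /xbar1 x1E; under eq_bigr do rewrite x1E.
  rewrite big_split/= sumr_const card_ord -mulr_sumr -[mu1 *+ n]mulr_natl.
  by field.
have d2 : forall k, (x k).2 - xbar2 x =
    rho * sigma2 * (e k - n%:R^-1 * \sum_(i < n) e i) +
    tau * (f k - n%:R^-1 * \sum_(i < n) f i).
  move=> k.
  rewrite /xbar2 x2E; under eq_bigr do rewrite x2E.
  rewrite !big_split/= sumr_const card_ord -!mulr_sumr -[mu2 *+ n]mulr_natl.
  by field.
rewrite /c -!centered_sum//.
set eb := n%:R^-1 * \sum_(i < n) e i in d1 d2 *.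
set fb := n%:R^-1 * \sum_(i < n) f i in d2 *; split.
- rewrite /s11 mulr_sumr; apply: eq_bigr => k _; rewrite d1; ring.
- rewrite /s12 !mulr_sumr -big_split mulr_sumr; apply: eq_bigr => k _.
  by rewrite d1 d2 /=; ring.
- rewrite /s22 !mulr_sumr -!big_split; apply: eq_bigr => k _.
  by rewrite d2 /=; ring.
Qed.

(** The identity survives degenerate data: if [s22] is 0, all deviations of the second coordinate
    vanish and so does [s12]; if [s11] is 0, the default inverse kills both quotients. *)
Lemma s22_corr (n : nat) (x : 'I_n -> R * R) :
  s22 x * (1 - corr x ^+ 2) = s22 x - s12 x ^+ 2 / s11 x.
Proof.
have s11ge0 : 0 <= s11 x by apply: sumr_ge0 => k _; exact: sqr_ge0.
have s22ge0 : 0 <= s22 x by apply: sumr_ge0 => k _; exact: sqr_ge0.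
rewrite /corr expr_div_n sqr_sqrtr ?mulr_ge0// mulrBr mulr1; congr (_ - _).
have [s22E|s22n] := eqVneq (s22 x) 0; last first.
  have [->|s11n] := eqVneq (s11 x) 0; first by rewrite mul0r !invr0 !mulr0.
  by field; rewrite s22n s11n.
rewrite s22E mul0r.
suff -> : s12 x = 0 by rewrite expr0n/= mul0r.
have /psumr_eq0P s22E' : \sum_(k < n) ((x k).2 - xbar2 x) ^+ 2 = 0 by [].
apply: big1 => k _; have := s22E' (fun k _ => sqr_ge0 _) k isT.
by move/eqP; rewrite sqrf_eq0 => /eqP ->; rewrite mulr0.
Qed.

(** Regression on x1 removes the part of x2 proportional to e, so the residual sum of squares feels
    only the scale [tau], and [rho] has no other influence on it. *)
Lemma state_statistics (m : nat) (x : 'I_m.+1 -> R * R) :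
  let z := fun i => standardize mu1 mu2 sigma1 sigma2 rho (x (inord i)) in
  let s := state (z : nat -> measurableTypeR R * measurableTypeR R) m in
  (0 < m)%N -> (z 0%N).1 != (z 1%N).1 ->
  [/\ 0 < (s.2.1 : R), s11 x = sigma1 ^+ 2 * s.2.1 &
      s22 x * (1 - corr x ^+ 2) = tau ^+ 2 * s.2.2.2].
Proof.
move=> z s m0 z01; move: (state_sums m z01); rewrite {}/s.
case: (state _ m) => _ [A [b dd]] /= [_ aE bE dE a0].
have ap : 0 < A by move: m0 a0; case: (m).
have an := lt0r_neq0 ap; have sn := lt0r_neq0 s1.
have := @sums_standardize _ x (ltn0Sn m); cbv beta zeta.
have zE (F : R * R -> R) : \sum_(i < m.+1) F (z i) =
    \sum_(i < m.+1) F (standardize mu1 mu2 sigma1 sigma2 rho (x i)).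
  by apply: eq_bigr => i _; rewrite /z inord_val.
rewrite -(zE fst) -(zE snd) -(zE (fun p => p.1 * p.1)) -(zE (fun p => p.1 * p.2)).
rewrite -(zE (fun p => p.2 * p.2)) -expr2.
have E2 (F : R * R -> R) : \sum_(i < m.+1) F (z i) * F (z i) = \sum_(i < m.+1) F (z i) ^+ 2.
  by apply: eq_bigr => i _; rewrite expr2.
rewrite (E2 fst) (E2 snd) -[X in tau ^+ 2 * (_ - X / _)]expr2 -aE -bE -dE.
move=> [S11 S12 S22]; split => //; rewrite s22_corr S11 S12 S22.
have := sqr_sqrtr (ltW ap); set q := Num.sqrt A => qE.
have qn : q != 0 by rewrite gt_eqF// /q sqrtr_gt0.
by rewrite -{}qE in an *; move: q qn {an} => q qn; field; rewrite sn qn.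
Qed.

End centered_sums.

Section coverage.
Context (R : realType).
Local Notation RR := (measurableTypeR R).

(** Given the data, [theta4_star] is an increasing function of the ratio up to a scale, which moves
    out of the quantile. If [c] is not positive, its root is 0 and [theta4_star] vanishes, so its
    quantile cannot exceed a positive [theta]; the first conjunct records this. *)
Lemma lt_quantile_theta4_star d (T : measurableType d) (Q : probability T R)
    (U V : {RV Q >-> R}) (n : nat) (x : 'I_n -> R * R) (beta theta : R) :
  0 < beta < 1 -> 0 < theta ->
  let c := s22 x * (1 - corr x ^+ 2) / s11 x in
  (theta < quantile Q (fun w => theta4_star x (U w) (V w)) beta) =
  (0 < c) && (theta ^+ 2 / c < quantile Q (fun w => U w / V w) beta).
Proof.
move=> beta01 th0 c.
have mU : measurable_fun setT U by exact: measurable_funPT.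
have mV : measurable_fun setT V by exact: measurable_funPT.
have mUV : measurable_fun setT (fun w => U w / V w) by meas.
rewrite lt_quantile//; last by rewrite /theta4_star; meas.
rewrite lt_quantile// /theta4_star -/c; move: c => c.
have [c0|c0] := ltP 0 c.
  have q0 : 0 < Num.sqrt c by rewrite sqrtr_gt0.
  have thE : theta / Num.sqrt c = Num.sqrt (theta ^+ 2 / c).
    by rewrite sqrtrM ?sqr_ge0// sqrtr_sqr gtr0_norm// sqrtrV// ltW.
  have -> : [set w | Num.sqrt (U w / V w) * Num.sqrt c <= theta] =
      [set w | U w / V w <= theta ^+ 2 / c].
    apply/seteqP; split => w /=;
      by rewrite -(ler_pdivlMr _ _ q0) thE ler_sqrt// divr_ge0 ?sqr_ge0 ?ltW.
  by [].
have -> : [set w | Num.sqrt (U w / V w) * Num.sqrt c <= theta] = setT.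
  by apply/seteqP; split => w //= _; rewrite (ler0_sqrtr c0) mulr0 ltW.
by rewrite probability_setT lte_fin ltNge ltW//; case/andP: beta01.
Qed.

Lemma measure_eq_off_null d (T : measurableType d) (P : probability T R)
    (N E E' : set T) :
  measurable N -> measurable E -> measurable E' -> P N = 0%E ->
  (forall w, ~ N w -> (E w <-> E' w)) -> P E = P E'.
Proof.
move=> mN.
suff H A B : measurable A -> measurable B -> P N = 0%E ->
    (forall w, ~ N w -> A w -> B w) -> (P A <= P B)%E.
  by move=> mE mE' N0 EE'; apply/eqP; rewrite eq_le !H// => w /EE' [].
move=> mA mB N0 AB; apply: (@le_trans _ _ (P (B `|` N))).
  apply: le_measure; rewrite ?inE//; first exact: measurableU.
  by move=> w Aw; have [Nw|nNw] := pselect (N w); [right|left; exact: AB].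
by apply: (le_trans (measureU2 _ mB mN)); rewrite [X in (_ + X)%E]N0 adde0.
Qed.

Lemma mutually_independent_pair d d' (T : measurableType d) (S : measurableType d')
    (P : probability T R) (I : finType) (X : I -> {RV P >-> S}) (i j : I) :
  mutually_independent X -> i != j -> forall A B, measurable A -> measurable B ->
  (P (X i @^-1` A `&` X j @^-1` B) = P (X i @^-1` A) * P (X j @^-1` B))%E.
Proof.
move=> indep ij A B mA mB.
have -> : X j @^-1` B = \bigcap_(k in [set` [set j]%SET]) (X k @^-1` B).
  apply/seteqP; split => w /=; first by move=> wB k /=; rewrite inE => /eqP ->.
  by move=> /(_ j); apply; rewrite /= set11.
apply: (mutually_independent_cons indep (B := fun=> B)) => //.
by rewrite inE.
Qed.

Local Open Scope ereal_scope.

Definition ratio_lt (q : R) : set (RR * RR) := [set p | (p.1 / p.2 < q :> R)%R].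

Lemma measurable_ratio_lt q : measurable (ratio_lt q).
Proof.
have mr : measurable_fun setT (fun p : RR * RR => (p.1 / p.2 : R)%R) by meas.
have -> : ratio_lt q = (fun p : RR * RR => (p.1 / p.2 : R)%R) @^-1` `]-oo, q[.
  by apply/seteqP; split => p /=; rewrite in_itv.
by rewrite -[X in measurable X]setTI; exact: mr.
Qed.

(** The common value of both sides of the coverage identity, free of the probability spaces and of
    the parameters. *)
Definition chi_ratio (k j : nat) (q : R) : \bar R :=
  \int[chi R k]_a \int[chi R j]_d (\1_(ratio_lt q) (a, d))%:E.

Lemma chi_ratioE d (T : measurableType d) (Q : probability T R)
    (U V : {RV Q >-> R}) (k j : nat) (q : R) :
  is_chi2 U k.+1%:R -> is_chi2 V j.+1%:R ->
  (forall A B, measurable A -> measurable B ->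
    Q (U @^-1` A `&` V @^-1` B) = Q (U @^-1` A) * Q (V @^-1` B)) ->
  Q [set w | (U w / V w < q)%R] = chi_ratio k.+1 j.+1 q.
Proof.
move=> lawU lawV indep.
have mU : measurable_fun setT (U : T -> RR) by exact: (@measurable_funPT _ _ _ _ U).
have mV : measurable_fun setT (V : T -> RR) by exact: (@measurable_funPT _ _ _ _ V).
pose f : RR * RR -> \bar R := EFin \o \1_(ratio_lt q).
have mf : measurable_fun setT f.
  by apply/measurable_EFinP; apply: measurable_indic; exact: measurable_ratio_lt.
have f0 z : 0 <= f z by rewrite lee_fin.
have mE : measurable [set w | (U w / V w < q)%R].
  have mUV : measurable_fun setT (fun w => (U w, V w) : RR * RR) by meas.
  have -> : [set w | (U w / V w < q)%R] = (fun w => (U w, V w) : RR * RR) @^-1` ratio_lt q.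
    by [].
  by rewrite -[X in measurable X]setTI; apply: mUV => //; exact: measurable_ratio_lt.
transitivity (\int[Q]_w f (U w, V w)).
  transitivity (\int[Q]_w (\1_[set w | (U w / V w < q)%R] w)%:E); last by [].
  by rewrite integral_indic// setIT.
rewrite (indep_pair_integral mU mV indep mf f0) /chi_ratio.
transitivity (\int[Q]_w \int[chi R j.+1]_d f (U w, d)).
  apply: eq_integral => w _; rewrite (is_chi2_law (f := fun v => f (U w, v)) lawV)//.
  by meas.
rewrite (is_chi2_law (f := fun u => \int[chi R j.+1]_d f (u, d)) lawU)//.
- by apply: measurable_fun_integral => //; meas.
- by move=> x; exact: integral_ge0.
Qed.

Lemma chi_le0 (j : nat) : \int[chi R j.+1]_x (\1_(`]-oo, 0%R]%classic) x)%:E = 0.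
Proof.
have [K K0 ->] := chi_density R j; last 2 first.
- by apply/measurable_EFinP; exact: measurable_indic.
- by move=> x; rewrite lee_fin.
apply: integral0_eq => t _; rewrite indicE mem_setE in_itv/= /gamma_kernel /pospow posE.
by case: leP => _; rewrite ?mul0e// !mul0r mulr0 mule0.
Qed.

End coverage.

Section sample_coverage.
Context (R : realType).
Local Notation RR := (measurableTypeR R).
Local Notation sample_space := ((RR * RR) * (RR * (RR * RR)))%type.
Local Open Scope ereal_scope.

(** In the state coordinates [theta4 ^+ 2 / c] is a / d, so all parameters cancel. From [1 < m] the
    residual [d] has at least one degree of freedom and is almost surely positive. *)
Lemma coverage_chi_ratio d (T : measurableType d) (P : probability T R) (m : nat)
    (X : 'I_m.+1 -> {RV P >-> (R * R)%type}) (mu1 mu2 sigma1 sigma2 rho q : R) :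
  (1 < m)%N -> (0 < sigma1)%R -> (0 < sigma2)%R -> (-1 < rho < 1)%R ->
  is_normal_sample X (mu1, mu2, sigma1, sigma2, rho) ->
  P [set w | let x := fun k => X k w in
             let c := (s22 x * (1 - corr x ^+ 2) / s11 x)%R in
             ((0 < c) && (theta4 (mu1, mu2, sigma1, sigma2, rho) ^+ 2 / c < q))%R] =
  chi_ratio m m.-1 q.
Proof.
move=> m1 s1 s2 rho1 [indepX lawX]; set t := (mu1, mu2, sigma1, sigma2, rho).
set E := [set w | _].
have m0 : (0 < m)%N by exact: ltnW.
have mX k : measurable_fun setT (X k : T -> RR * RR) by exact: (@measurable_funPT _ _ _ _ (X k)).
have mstd := @measurable_standardize R mu1 mu2 sigma1 sigma2 rho.
pose Z (i : nat) (w : T) : RR * RR := standardize mu1 mu2 sigma1 sigma2 rho (X (inord i) w).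
have mZ i : measurable_fun setT (Z i) by apply: (measurableT_comp mstd).
have lawZ (f : RR * RR -> \bar R) : measurable_fun setT f -> (forall z, 0 <= f z) ->
    forall i, (i <= m)%N -> \int[P]_w f (Z i w) = \int[std_normal2 R]_z f z.
  by move=> mf f0 i im; apply: standardize_law => //; exact: lawX.
have indepZ (J : {set 'I_m.+1}) (B : 'I_m.+1 -> set (RR * RR)) :
    (forall i, measurable (B i)) ->
    P (\bigcap_(i in [set` J]) (Z i @^-1` B i)) = \prod_(i in J) P (Z i @^-1` B i).
  move=> mB.
  have mB' i : measurable ((standardize mu1 mu2 sigma1 sigma2 rho : RR * RR -> RR * RR) @^-1` B i).
    by rewrite -[X in measurable X]setTI; exact: mstd.
  have := indepX J (fun i => standardize mu1 mu2 sigma1 sigma2 rho @^-1` B i) mB'.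
  have ZE (i : 'I_m.+1) : Z i @^-1` B i =
      X i @^-1` (standardize mu1 mu2 sigma1 sigma2 rho @^-1` B i).
    by apply/seteqP; split => w; rewrite /= /Z inord_val.
  by under [in X in _ -> X]eq_bigcapr do rewrite ZE; under [in X in _ -> X]eq_bigr do rewrite ZE.
pose st k w := state (Z ^~ w) k.
have mst k : measurable_fun setT (st k) by exact: measurable_state.
have law_event k (A : set sample_space) : (k < m)%N -> measurable A ->
    P (st k.+1 @^-1` A) = \int[chi R k.+1]_a \int[std_normal R]_b \int[chi R k]_e
      \int[std_normal2 R]_x (\1_A (x, (a, (b, e))))%:E.
  move=> km mA.
  have mA1 : measurable_fun setT (fun p => (\1_A p : R)%:E).
    by apply/measurable_EFinP; exact: measurable_indic.
  have mI : measurable_fun setT (\1_A : sample_space -> R) by exact: measurable_indic.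
  have A0 p : 0 <= (\1_A p : R)%:E by rewrite lee_fin.
  have mSA : measurable (st k.+1 @^-1` A).
    by rewrite -[X in measurable X]setTI; exact: mst.
  transitivity (\int[P]_w (\1_(st k.+1 @^-1` A) w)%:E); first by rewrite integral_indic// setIT.
  transitivity (\int[P]_w (\1_A (st k.+1 w))%:E); first by [].
  rewrite (sample_law mZ indepZ km lawZ mA1 A0) tonelli_swap; last 2 first.
  - by meas.
  - by move=> *; exact: A0.
  rewrite integral_ss_law//; first by apply: measurable_fun_integral => //; meas.
  by move=> u; exact: integral_ge0.
have mst1 k : measurable_fun setT (fun w => (st k w).2.1) by have := mst k => ?; meas.
have mst2 k : measurable_fun setT (fun w => (st k w).2.2.2) by have := mst k => ?; meas.
pose F1 (s : sample_space) : RR := s.2.1; pose F2 (s : sample_space) : RR := s.2.2.2.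
have mF1 : measurable_fun setT F1 by rewrite /F1; meas.
have mF2 : measurable_fun setT F2 by rewrite /F2; meas.
pose neg : set RR := `]-oo, 0%R]%classic.
have mneg : measurable neg by exact: measurable_itv.
have mA1 : measurable (F1 @^-1` neg) by rewrite -[X in measurable X]setTI; exact: mF1.
have mA2 : measurable (F2 @^-1` neg) by rewrite -[X in measurable X]setTI; exact: mF2.
have mstS k (A : set sample_space) : measurable A -> measurable (st k @^-1` A).
  by move=> mA; rewrite -[X in measurable X]setTI; exact: mst.
have cstE d' (S : measurableType d') (pr : probability S R) (c : \bar R) : \int[pr]_x c = c.
  by rewrite integral_cst// [X in _ * X]probability_setT mule1.
pose N1 := st 1%N @^-1` (F1 @^-1` neg); pose N2 := st m @^-1` (F2 @^-1` neg).
have N10 : P N1 = 0.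
  rewrite law_event// -(chi_le0 R 0); apply: eq_integral => a _.
  rewrite -[RHS](cstE _ _ (std_normal R)); apply: eq_integral => b _.
  rewrite -[RHS](cstE _ _ (chi R 0)); apply: eq_integral => e _.
  by rewrite -[RHS](cstE _ _ (std_normal2 R)); apply: eq_integral => x _.
have N20 : P N2 = 0.
  rewrite /N2 -[m](prednK m0) law_event ?prednK//.
  rewrite -[RHS](cstE _ _ (chi R m)); apply: eq_integral => a _.
  rewrite -[RHS](cstE _ _ (std_normal R)); apply: eq_integral => b _.
  have m2 : (0 < m.-1)%N by rewrite -ltnS prednK.
  rewrite -[m.-1](prednK m2) -(chi_le0 R m.-2); apply: eq_integral => e _.
  by rewrite -[RHS](cstE _ _ (std_normal2 R)); apply: eq_integral => x _.
pose E' := st m @^-1` ((fun s => (F1 s, F2 s)) @^-1` ratio_lt q).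
have mE' : measurable E'.
  have mF : measurable_fun setT (fun s => (F1 s, F2 s)) by meas.
  by apply: mstS; rewrite -[X in measurable X]setTI; apply: mF => //; exact: measurable_ratio_lt.
have PE' : P E' = chi_ratio m m.-1 q.
  rewrite /E' -[m](prednK m0) law_event ?prednK//; last first.
    have mF : measurable_fun setT (fun s => (F1 s, F2 s)) by meas.
    by rewrite -[X in measurable X]setTI; apply: mF => //; exact: measurable_ratio_lt.
  apply: eq_integral => a _.
  rewrite -[RHS](cstE _ _ (std_normal R)); apply: eq_integral => b _.
  apply: eq_integral => e _.
  by rewrite -[RHS](cstE _ _ (std_normal2 R)); apply: eq_integral => x _.
have mX1 k : measurable_fun setT (fun w => (X k w).1 : R) by have := mX k => ?; meas.
have mX2 k : measurable_fun setT (fun w => (X k w).2 : R) by have := mX k => ?; meas.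
have msum (f : 'I_m.+1 -> T -> R) : (forall k, measurable_fun setT (f k)) ->
    measurable_fun setT (fun w => \sum_(k < m.+1) f k w)%R.
  by move=> mf; apply: measurable_sum.
have mb1 : measurable_fun setT (fun w => xbar1 (fun k => X k w)).
  by have := msum _ mX1 => ?; rewrite /xbar1; meas.
have mb2 : measurable_fun setT (fun w => xbar2 (fun k => X k w)).
  by have := msum _ mX2 => ?; rewrite /xbar2; meas.
have ms11 : measurable_fun setT (fun w => s11 (fun k => X k w)).
  by apply: msum => k; have := mX1 k => ?; meas.
have ms22 : measurable_fun setT (fun w => s22 (fun k => X k w)).
  by apply: msum => k; have := mX2 k => ?; meas.
have ms12 : measurable_fun setT (fun w => s12 (fun k => X k w)).
  by apply: msum => k; have := mX1 k => ?; have := mX2 k => ?; meas.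
pose c w : R := let x := fun k => X k w in (s22 x * (1 - corr x ^+ 2) / s11 x)%R.
have mc : measurable_fun setT c by rewrite /c /corr /=; meas.
have mE : measurable E.
  have -> : E = c @^-1` `]0%R, +oo[ `&` (fun w => theta4 t ^+ 2 / c w)%R @^-1` `]-oo, q[.
    by apply/seteqP; split => w /=; rewrite !in_itv/= andbT => /andP.
  have mth : measurable_fun setT (fun w => theta4 t ^+ 2 / c w)%R by meas.
  by apply: measurableI; rewrite -[X in measurable X]setTI; [exact: mc|exact: mth].
rewrite -PE'; apply: (@measure_eq_off_null _ _ _ _ (N1 `|` N2)) => //.
- by apply: measurableU; exact: mstS.
- by rewrite measureU0//; [exact: mstS|exact: mstS].
move=> w; rewrite /N1 /N2 /neg /= !in_itv/= => /not_orP[/negP + /negP]; rewrite -!ltNge => a1 dm.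
have z01 : (Z 0%N w).1 != (Z 1%N w).1 :> R.
  apply/eqP => z01; move: a1.
  have -> : F1 (st 1%N w) = (0 + (Num.sqrt 1 / Num.sqrt 2 * (Z 1%N w).1 -
      (Num.sqrt 2)^-1 * (Z 0%N w).1) ^+ 2)%R by [].
  by rewrite z01 sqrtr1 add0r mul1r subrr expr0n/= ltxx.
have [] := @state_statistics R mu1 mu2 sigma1 sigma2 rho s1 s2 rho1 m (fun k => X k w) m0 z01.
move: dm; rewrite /E /E' /= /F1 /F2 /theta4 /p_sigma1 /p_sigma2 /p_rho /= -/(st m w).
move=> dm ap -> ->.
move: (st m w).2.1 (st m w).2.2.2 ap dm => a dd ap dm.
have r0 : (0 < 1 - rho ^+ 2)%R by case/andP: rho1 => r1 r2; nra.
have q0 : (0 < Num.sqrt (1 - rho ^+ 2))%R by rewrite sqrtr_gt0.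
have -> /= : (0 < (sigma2 * Num.sqrt (1 - rho ^+ 2)) ^+ 2 * dd / (sigma1 ^+ 2 * a))%R.
  by apply: divr_gt0; apply: mulr_gt0 => //; apply: exprn_gt0 => //; exact: mulr_gt0.
by have -> // : (((sigma2 * Num.sqrt (1 - rho ^+ 2)) / sigma1) ^+ 2 /
    ((sigma2 * Num.sqrt (1 - rho ^+ 2)) ^+ 2 * dd / (sigma1 ^+ 2 * a)) = a / dd)%R;
  field; rewrite !gt_eqF.
Qed.

End sample_coverage.

(** * Exact coverage *)

Section ratio_exponents.
Context d (T : measurableType d) (R : realType) (Q : probability T R).
Local Notation RR := (measurableTypeR R).
Notation mu := (@lebesgue_measure R).
Local Open Scope ereal_scope.

Definition le_ind (y t : R) : R := \1_(`]-oo, y]%classic) t.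

Lemma le_indE y t : le_ind y t = (t <= y)%R%:R.
Proof. by rewrite /le_ind indicE mem_setE in_itv. Qed.

Lemma measurable_le_ind y : measurable_fun setT (le_ind y).
Proof. by apply: measurable_indic; exact: measurable_itv. Qed.

Lemma le_ind_ge0 y t : (0 <= le_ind y t)%R. Proof. by rewrite le_indE. Qed.

(** The integral of t^(p-1) over the unit interval; only its being positive and finite matters. *)
Definition beta_mass (p : R) : \bar R := \int[mu]_t (le_ind 1 t * pospow p t)%:E.

Lemma beta_mass_scale (p y : R) : (0 < y)%R ->
  \int[mu]_t (le_ind y t * pospow p t)%:E = (y `^ p)%:E * beta_mass p.
Proof.
move=> y0; have ml := @measurable_le_ind; have mp := measurable_pospow p.
have ml1 := ml 1%R; have mly := ml y.
have f0 z t : 0 <= (le_ind z t * pospow p t)%:E.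
  by rewrite lee_fin mulr_ge0 ?le_ind_ge0 ?pospow_ge0.
rewrite (ge0_integral_affine 0%R y0)//; last by meas.
rewrite -ge0_integralZl_EFin ?powR_ge0//; last by meas.
apply: eq_integral => t _; rewrite addr0 -!EFinM; congr EFin.
have -> : le_ind y (y * t) = le_ind 1 t.
  by rewrite !le_indE -[X in (_ <= X)%R](mulr1 y) ler_pM2l.
rewrite /pospow !posE pmulr_rgt0//; case: (ltP 0%R t) => t0; last by rewrite !mul0r !mulr0 mul0r.
rewrite powRM ?ltW// !mul1r.
have -> : (y `^ p = y `^ (p - 1) * y)%R.
  by rewrite -[X in (_ * X)%R](powRr1 (ltW y0)) -powRD ?subrK// (gt_eqF y0) implybT.
ring.
Qed.

Lemma integral_gt0_itv (f : R -> R) (l h : R) : (l < h)%R ->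
  measurable_fun setT f -> (forall t, (0 <= f t)%R) ->
  (forall t, (l <= t <= h)%R -> (0 < f t)%R) ->
  0 < \int[mu]_t (f t)%:E.
Proof.
move=> lh mf f0 fpos.
have mfE : measurable_fun setT (EFin \o f) by exact/measurable_EFinP.
rewrite lt_neqAle integral_ge0 ?andbT; last by move=> t _; rewrite lee_fin.
apply/eqP => /esym I0.
have : \int[mu]_(t in setT) `| (EFin \o f) t | = 0.
  by rewrite -[RHS]I0; apply: eq_integral => t _; rewrite /= ger0_norm.
move/(ae_eq_integral_abs mu measurableT mfE) => [N [mN N0 subN]].
have : mu `[l, h] <= mu N.
  apply: le_measure; rewrite ?inE//.
  move=> t /=; rewrite in_itv/= => /fpos ft; apply: (subN t) => /= /(_ I) [ft0].
  by move: ft; rewrite ft0 ltxx.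
rewrite [X in _ <= X]N0 lebesgue_measure_itv/= lte_fin lh -EFinB lee_fin.
by rewrite leNgt subr_gt0 lh.
Qed.

Lemma pospow_gt0 (p t : R) : (0 < t)%R -> (0 < pospow p t)%R.
Proof. by move=> t0; rewrite /pospow posE t0 mul1r powR_gt0. Qed.

Lemma gamma_kernel_gt0 (p t : R) : (0 < t)%R -> (0 < gamma_kernel p t)%R.
Proof. by move=> t0; rewrite /gamma_kernel mulr_gt0 ?pospow_gt0 ?expR_gt0. Qed.

Lemma measurable_le_set (W : {RV Q >-> R}) (y : R) : measurable [set w | (W w <= y)%R].
Proof.
have -> : [set w | (W w <= y)%R] = W @^-1` `]-oo, y].
  by apply/seteqP; split => w /=; rewrite in_itv.
by apply: measurable_funPTI; exact: measurable_itv.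
Qed.

Lemma chi2_le_event (W : {RV Q >-> R}) (K m y : R) :
  (forall f : R -> \bar R, measurable_fun setT f -> (forall x, 0 <= f x) ->
    \int[Q]_w f (W w) = \int[mu]_t (f t * (K * gamma_kernel (m / 2) t)%:E)) ->
  Q [set w | (W w <= y)%R] = \int[mu]_t (le_ind y t * (K * gamma_kernel (m / 2) t))%:E.
Proof.
move=> dens; have ml := measurable_le_ind y.
have mE := measurable_le_set W y.
transitivity (\int[Q]_w (le_ind y (W w))%:E); last first.
  rewrite (dens (fun t => (le_ind y t)%:E))//; first by meas.
  by move=> t; rewrite lee_fin le_ind_ge0.
transitivity (\int[Q]_w (\1_[set w | (W w <= y)%R] w)%:E).
  by rewrite integral_indic// setIT.
apply: eq_integral => w _; rewrite le_indE indicE.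
have -> // : (w \in [set w | (W w <= y)%R]) = (W w <= y)%R.
by apply/idP/idP => [/set_mem//|?]; exact/mem_set.
Qed.

(** Finiteness is borrowed from the chi-squared law: on the unit interval the exponential is at
    least exp(-1/2), so a multiple of the mass is bounded by a probability. *)
Lemma beta_mass_fin_num (W : {RV Q >-> R}) (m : R) : is_chi2 W m ->
  exists2 B : R, (0 < B)%R & beta_mass (m / 2) = B%:E.
Proof.
move=> /is_chi2_density[K K0 dens].
have ml := @measurable_le_ind 1%R; have mp := measurable_pospow (m / 2).
have mg := measurable_gamma_kernel (m / 2).
have Bpos : 0 < beta_mass (m / 2).
  apply: (@integral_gt0_itv _ (1 / 2) 1); first by rewrite ltr_pdivrMr// mul1r ltr1n.
  - by meas.
  - by move=> t; rewrite mulr_ge0 ?le_ind_ge0 ?pospow_ge0.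
  - move=> t /andP[t0 t1]; rewrite le_indE t1 mul1r pospow_gt0//.
    by apply: lt_le_trans t0; rewrite divr_gt0.
pose c := (K * expR (- (1 / 2)))%R.
have c0 : (0 < c)%R by rewrite mulr_gt0 ?expR_gt0.
have le1 : c%:E * beta_mass (m / 2) <= 1.
  apply: (@le_trans _ _ (Q [set w | (W w <= 1)%R])); last first.
    by apply: probability_le1; exact: measurable_le_set.
  rewrite (chi2_le_event 1 dens) /beta_mass -ge0_integralZl_EFin//; last 3 first.
  - by move=> t _; rewrite lee_fin mulr_ge0 ?le_ind_ge0 ?pospow_ge0.
  - by meas.
  - exact: ltW.
  apply: ge0_le_integral => //.
  - move=> t _; rewrite lee_fin; apply: mulr_ge0; last exact: mulr_ge0 (le_ind_ge0 _ _) (pospow_ge0 _ _).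
    exact: ltW.
  - by meas.
  - by meas.
  move=> t _; rewrite lee_fin le_indE /c /gamma_kernel.
  case: (leP t 1%R) => [t1|_]; last by rewrite !mul0r mulr0.
  rewrite !mul1r -mulrA ler_pM2l// mulrC ler_wpM2l ?pospow_ge0//.
  by rewrite ler_expR; lra.
have Bfin : beta_mass (m / 2) \is a fin_num.
  rewrite ge0_fin_numE ?ltW// ltNge leye_eq; apply/negP => /eqP By.
  by move: le1; rewrite By gt0_muley ?lte_fin// leye_eq.
exists (fine (beta_mass (m / 2))); last by rewrite fineK.
by rewrite -lte_fin fineK.
Qed.

Variables (U V : {RV Q >-> R}) (m k : R).
Hypotheses (lawU : is_chi2 U m) (lawV : is_chi2 V k).
Hypothesis indepUV : forall A B, measurable A -> measurable B ->
  Q (U @^-1` A `&` V @^-1` B) = Q (U @^-1` A) * Q (V @^-1` B).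

Lemma ratio_small_ball_lower : exists2 c : R, (0 < c)%R &
  forall x : R, (0 < x <= 1)%R ->
  (c * x `^ (m / 2))%:E <= Q [set w | (U w / V w < x)%R].
Proof.
have [B B0 BE] := beta_mass_fin_num lawU.
have [K K0 dens] := is_chi2_density lawU.
have [K' K'0 dens'] := is_chi2_density lawV.
have mp := measurable_pospow (m / 2); have mg := measurable_gamma_kernel (m / 2).
have mg' := measurable_gamma_kernel (k / 2).
(* The bound 2 leaves room for a strict inequality: U <= x and V >= 2 force U < x V. Independence
   then yields a product whose first factor has order x^(m/2). *)
pose P2 := Q (V @^-1` `[2%R, +oo[).
have m2 : measurable (V @^-1` `[2%R, +oo[) by apply: measurable_funPTI; exact: measurable_itv.
have P2pos : 0 < P2.
  pose i2 (t : R) : R := \1_(`[2%R, +oo[%classic) t.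
  have i2E t : i2 t = (2 <= t)%R%:R by rewrite /i2 indicE mem_setE in_itv/= andbT.
  have mi2 : measurable_fun setT i2 by apply: measurable_indic; exact: measurable_itv.
  have -> : P2 = \int[mu]_t (i2 t * (K' * gamma_kernel (k / 2) t))%:E.
    transitivity (\int[Q]_w (i2 (V w))%:E); last first.
      rewrite (dens' (fun t => (i2 t)%:E))//; first by meas.
      by move=> t; rewrite lee_fin i2E.
    transitivity (\int[Q]_w (\1_(V @^-1` `[2%R, +oo[) w)%:E); last by [].
    by rewrite integral_indic// setIT.
  apply: (@integral_gt0_itv _ 2 3); first by rewrite ltr_nat.
  - by meas.
  - by move=> t; rewrite i2E mulr_ge0// mulr_ge0 ?gamma_kernel_ge0// ltW.
  - move=> t /andP[t2 _]; rewrite i2E t2 mul1r mulr_gt0// gamma_kernel_gt0//.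
    by apply: lt_le_trans t2.
have P2fin : P2 \is a fin_num by exact: fin_num_measure.
exists (K * expR (- (1 / 2)) * B * fine P2)%R.
  by rewrite !mulr_gt0 ?expR_gt0// -lte_fin fineK.
move=> x /andP[x0 x1].
have mUx : measurable (U @^-1` `]-oo, x]) by apply: measurable_funPTI; exact: measurable_itv.
have mR : measurable [set w | (U w / V w < x)%R].
  have mU : measurable_fun setT U by exact: measurable_funPT.
  have mV : measurable_fun setT V by exact: measurable_funPT.
  have mUV : measurable_fun setT (fun w => U w / V w)%R by meas.
  have -> : [set w | (U w / V w < x)%R] = (fun w => U w / V w)%R @^-1` `]-oo, x[.
    by apply/seteqP; split => w /=; rewrite in_itv.
  by rewrite -[X in measurable X]setTI; exact: mUV.
apply: (@le_trans _ _ (Q (U @^-1` `]-oo, x] `&` V @^-1` `[2%R, +oo[))); last first.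
  apply: le_measure; rewrite ?inE//; first exact: measurableI.
  move=> w [] /=; rewrite !in_itv/= andbT => Ux V2.
  have V0 : (0 < V w)%R by apply: lt_le_trans V2.
  by rewrite ltr_pdivrMr//; nra.
rewrite indepUV//.
have -> : Q (U @^-1` `]-oo, x]) = Q [set w | (U w <= x)%R].
  by congr (Q _); apply/seteqP; split => w /=; rewrite in_itv.
rewrite -/P2 -(fineK P2fin) (chi2_le_event x dens).
rewrite mulrAC EFinM; apply: lee_wpmul2r; first by rewrite fineK// ltW.
apply: (@le_trans _ _ ((K * expR (- (1 / 2)))%:E * \int[mu]_t (le_ind x t * pospow (m / 2) t)%:E)).
  by rewrite beta_mass_scale// BE -!EFinM lee_fin mulrA mulrAC.
have ml := measurable_le_ind x.
rewrite -ge0_integralZl_EFin//; last 3 first.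
- by move=> t _; rewrite lee_fin mulr_ge0 ?le_ind_ge0 ?pospow_ge0.
- by meas.
- by rewrite mulr_ge0 ?expR_ge0// ltW.
apply: ge0_le_integral => //.
- move=> t _; rewrite lee_fin; apply: mulr_ge0; last exact: mulr_ge0 (le_ind_ge0 _ _) (pospow_ge0 _ _).
  by rewrite mulr_ge0 ?expR_ge0// ltW.
- by meas.
- by meas.
move=> t _; rewrite lee_fin le_indE /gamma_kernel.
case: (leP t x) => [tx|_]; last by rewrite !mul0r mulr0.
rewrite !mul1r -mulrA ler_pM2l// mulrC ler_wpM2l ?pospow_ge0//.
by rewrite ler_expR; lra.
Qed.

End ratio_exponents.

Section ratio_law.
Context d (T : measurableType d) (R : realType) (Q : probability T R).
Local Notation RR := (measurableTypeR R).
Notation mu := (@lebesgue_measure R).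
Local Open Scope ereal_scope.
Variables (U V : {RV Q >-> R}) (m k : R).
Hypotheses (m0 : (0 < m)%R) (lawU : is_chi2 U m) (lawV : is_chi2 V k).
Hypothesis indepUV : forall A B, measurable A -> measurable B ->
  Q (U @^-1` A `&` V @^-1` B) = Q (U @^-1` A) * Q (V @^-1` B).

Lemma ratio_event_integral (K K' : R) (A : set R) : (0 < K)%R -> measurable A ->
  (forall f : R -> \bar R, measurable_fun setT f -> (forall x, 0 <= f x) ->
    \int[Q]_w f (U w) = \int[mu]_t (f t * (K * gamma_kernel (m / 2) t)%:E)) ->
  (forall f : R -> \bar R, measurable_fun setT f -> (forall x, 0 <= f x) ->
    \int[Q]_w f (V w) = \int[mu]_t (f t * (K' * gamma_kernel (k / 2) t)%:E)) ->
  Q [set w | A (U w / V w)%R] =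
  \int[mu]_v ((\int[mu]_t ((\1_A (t / v)%R)%:E * (K * gamma_kernel (m / 2) t)%:E)) *
     (K' * gamma_kernel (k / 2) v)%:E).
Proof.
move=> K0 mA dens dens'.
have mU : measurable_fun setT (U : T -> RR) by exact: (@measurable_funPT _ _ _ _ U).
have mV : measurable_fun setT (V : T -> RR) by exact: (@measurable_funPT _ _ _ _ V).
have mg := measurable_gamma_kernel (m / 2); have mg' := measurable_gamma_kernel (k / 2).
have mI : measurable_fun setT (\1_A : R -> R) by exact: measurable_indic.
pose f (z : RR * RR) : \bar R := (\1_A (z.2 / z.1)%R)%:E.
have mf : measurable_fun setT f by rewrite /f; meas.
have f0 z : 0 <= f z by rewrite lee_fin.
have mUV : measurable_fun setT (fun w => U w / V w)%R by meas.
have mE : measurable [set w | A (U w / V w)%R].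
  by rewrite -[X in measurable X]setTI; exact: mUV.
transitivity (\int[Q]_w f (V w, U w)).
  transitivity (\int[Q]_w (\1_[set w | A (U w / V w)%R] w)%:E); last by [].
  by rewrite integral_indic// setIT.
rewrite (indep_pair_integral mV mU _ mf f0); last first.
  by move=> B C mB mC; rewrite setIC muleC; exact: indepUV.
rewrite -(dens' (fun v => \int[mu]_t (f (v, t) * (K * gamma_kernel (m / 2) t)%:E))).
- apply: eq_integral => w _; rewrite (dens (fun t => f (V w, t)))//.
  by meas.
- meas_int => x y; rewrite mule_ge0// lee_fin.
  by apply: mulr_ge0; [exact: ltW|exact: gamma_kernel_ge0].
- move=> x; apply: integral_ge0 => t _; rewrite mule_ge0// lee_fin.
  by apply: mulr_ge0; [exact: ltW|exact: gamma_kernel_ge0].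
Qed.

(** Given V = v > 0, the event confines U to the single point x v. *)
Lemma ratio_atomless (x : R) : Q [set w | (U w / V w)%R = x] = 0.
Proof.
have [K K0 dens] := is_chi2_density lawU.
have [K' K'0 dens'] := is_chi2_density lawV.
rewrite (ratio_event_integral K0 (measurable_set1 x) dens dens').
apply: integral0_eq => v _.
have [v0|v0] := ltP 0%R v; last first.
  by rewrite [gamma_kernel (k / 2) v]/gamma_kernel /pospow posE ltNge v0 !mul0r mulr0 mule0.
rewrite -[RHS](mul0e (K' * gamma_kernel (k / 2) v)%:E); congr (_ * _).
rewrite -[RHS](integral_set1 (fun t => (K * gamma_kernel (m / 2) t)%:E) (x * v)%R).
rewrite [RHS]integral_mkcond; apply: eq_integral => t _.
have tE : (t / v)%R = x <-> t = (x * v)%R.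
  by split => [<-|->]; [rewrite divfK ?gt_eqF|rewrite mulfK ?gt_eqF].
rewrite patchE indicE; case: (boolP (t \in [set (x * v)%R])) => [/set_mem/tE tx|/negP tx].
  by rewrite mem_set// mul1e.
by rewrite memNset ?mul0e// => /tE txv; apply: tx; exact/mem_set.
Qed.

(** The bound ln u < u at u = t / (4 p). The rate 1/4 spends half of the decay of the gamma kernel
    and leaves the other half for integrability. *)
Lemma powR_le_exp (p : R) : (0 < p)%R -> exists2 C : R, (0 < C)%R &
  forall t : R, (0 < t)%R -> (t `^ p <= C * expR (t / 4))%R.
Proof.
move=> p0; exists (expR (p * ln (4 * p)))%R; first exact: expR_gt0.
move=> t t0; rewrite -expRD /powR gt_eqF// ler_expR.
have q0 : (0 < t / (4 * p))%R by rewrite divr_gt0// mulr_gt0.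
have -> : ln t = (ln (t / (4 * p)) + ln (4 * p))%R.
  have p4 : (0 < 4 * p)%R by rewrite mulr_gt0.
  by rewrite -lnM// divfK// gt_eqF.
have := ln_sublinear q0; move: (ln (t / _)) (ln (4 * p)) => y z yt.
have -> : (t / 4 = p * (t / (4 * p)))%R by field; rewrite gt_eqF.
by rewrite -mulrDr ler_pM2l// addrC lerD2l ltW.
Qed.

(** Given V = v, the probability of U <= x v is at most a multiple of (x v)^(m/2), so a moment of V
    has to be finite: half of the exponential of its density absorbs v^(m/2). *)
Lemma ratio_small_ball_upper : exists2 C : R, (0 < C)%R &
  forall x : R, (0 < x)%R -> Q [set w | (U w / V w <= x)%R] <= (C * x `^ (m / 2))%:E.
Proof.
have [B B0 BE] := beta_mass_fin_num lawU.
have [K K0 dens] := is_chi2_density lawU.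
have [K' K'0 dens'] := is_chi2_density lawV.
have p0 : (0 < m / 2)%R by rewrite divr_gt0.
have [C1 C10 C1P] := powR_le_exp p0.
have mp := measurable_pospow (m / 2); have mg := measurable_gamma_kernel (m / 2).
have mpk := measurable_pospow (k / 2); have mgk := measurable_gamma_kernel (k / 2).
have JE : K'%:E * \int[mu]_t (gamma_kernel (k / 2) t)%:E = 1.
  rewrite -ge0_integralZl_EFin//; last 3 first.
  - by move=> t _; rewrite lee_fin gamma_kernel_ge0.
  - by meas.
  - exact: ltW.
  have := dens' (cst 1) (measurable_cst _) (fun=> lee01).
  rewrite [LHS]integral_cst// [X in 1 * X]probability_setT mule1 => ->.
  by apply: eq_integral => t _; rewrite mul1e EFinM.
(* Substituting v = 2 x restores the rate 1/2, so the integral is that of the chi-squared density up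
   to an explicit factor. *)
have ME : K'%:E * \int[mu]_v (pospow (k / 2) v * expR (- (v / 4)))%:E =
    (2 `^ (k / 2 - 1) * 2)%:E.
  rewrite (ge0_integral_affine 0%R (ltr0n R 2)) //; last 2 first.
  - by meas.
  - by move=> y; rewrite lee_fin mulr_ge0 ?pospow_ge0 ?expR_ge0.
  transitivity (K'%:E * \int[mu]_x ((2 `^ (k / 2 - 1) * 2)%:E * (gamma_kernel (k / 2) x)%:E)).
    congr (_ * _); apply: eq_integral => x _; rewrite addr0 -!EFinM; congr EFin.
    rewrite /gamma_kernel (_ : 2 * x / 4 = x / 2)%R; last by field.
    rewrite [in LHS]/pospow posE pmulr_rgt0//.
    have [x0|x0] := ltP 0%R x; last by rewrite /pospow posE ltNge x0 !mul0r mulr0.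
    by rewrite powRM ?ltW// /pospow posE x0 !mul1r; ring.
  rewrite ge0_integralZl_EFin//; first by rewrite muleCA JE mule1.
  - by move=> t _; rewrite lee_fin gamma_kernel_ge0.
  - by meas.
pose C := (K * B * C1 * (2 `^ (k / 2 - 1) * 2))%R.
have C0 : (0 < C)%R by rewrite !mulr_gt0 ?powR_gt0.
exists C => // x x0.
have mA : measurable (`]-oo, x]%classic : set R) by exact: measurable_itv.
have -> : [set w | (U w / V w <= x)%R] = [set w | `]-oo, x]%classic (U w / V w)%R].
  by apply/seteqP; split => w /=; rewrite in_itv.
rewrite (ratio_event_integral K0 mA dens dens').
pose c := (K * x `^ (m / 2) * B * C1)%R.
have c0 : (0 <= c)%R by rewrite !mulr_ge0 ?powR_ge0 ?ltW.
have -> : (C * x `^ (m / 2))%:E =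
    c%:E * (K'%:E * \int[mu]_v (pospow (k / 2) v * expR (- (v / 4)))%:E).
  by rewrite ME -EFinM; congr EFin; rewrite /C /c; ring.
rewrite -ge0_integralZl_EFin//; last 3 first.
- by move=> v _; rewrite lee_fin mulr_ge0 ?pospow_ge0 ?expR_ge0.
- by meas.
- exact: ltW.
rewrite -ge0_integralZl_EFin//; last 2 first.
- move=> v _; apply: mule_ge0; rewrite lee_fin; first exact: ltW.
  by apply: mulr_ge0; [exact: pospow_ge0|exact: expR_ge0].
- by meas.
have mI : measurable_fun setT (\1_(`]-oo, x]%classic) : R -> R) by exact: measurable_indic.
have Kg0 t : (0 <= K * gamma_kernel (m / 2) t)%R by apply: mulr_ge0; [exact: ltW|exact: gamma_kernel_ge0].
have Kg'0 t : (0 <= K' * gamma_kernel (k / 2) t)%R by apply: mulr_ge0; [exact: ltW|exact: gamma_kernel_ge0].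
apply: ge0_le_integral => //.
- by move=> v _; rewrite mule_ge0 ?lee_fin//; apply: integral_ge0 => t _; rewrite mule_ge0 ?lee_fin.
- by meas_int => *; rewrite mule_ge0 ?lee_fin.
- by meas.
move=> v _; have [v0|v0] := ltP 0%R v; last first.
  by rewrite [gamma_kernel (k / 2) v]/gamma_kernel /pospow posE ltNge v0 !mul0r !mulr0 !mule0.
have xv0 : (0 < x * v)%R by rewrite mulr_gt0.
have inner : \int[mu]_t ((\1_(`]-oo, x]%classic) (t / v)%R)%:E * (K * gamma_kernel (m / 2) t)%:E) <=
    (K * ((x * v) `^ (m / 2) * B))%:E.
  rewrite [leRHS]EFinM [(_ * B)%:E]EFinM -BE -beta_mass_scale//.
  have ml := measurable_le_ind (x * v).
  rewrite -ge0_integralZl_EFin//; last 3 first.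
  - by move=> t _; rewrite lee_fin mulr_ge0 ?le_ind_ge0 ?pospow_ge0.
  - by meas.
  - exact: ltW.
  apply: ge0_le_integral => //.
  - by move=> t _; rewrite mule_ge0 ?lee_fin.
  - by meas.
  - by meas.
  move=> t _; rewrite -!EFinM lee_fin indicE mem_setE in_itv/= ler_pdivrMr// le_indE.
  case: (leP t (x * v)%R) => tx; last by rewrite !mul0r mulr0.
  rewrite !mul1r ler_pM2l//; have [t0|t0] := ltP 0%R t; last first.
    by rewrite /gamma_kernel /pospow posE ltNge t0 !mul0r.
  by rewrite /gamma_kernel -[leRHS]mulr1 ler_wpM2l ?pospow_ge0// expR_le1 oppr_le0 divr_ge0// ltW.
apply: (@le_trans _ _ ((K * ((x * v) `^ (m / 2) * B))%:E * (K' * gamma_kernel (k / 2) v)%:E)).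
  by rewrite lee_wpmul2r ?lee_fin.
rewrite -!EFinM lee_fin (powRM _ (ltW x0) (ltW v0)) /gamma_kernel /c.
have e4 : expR (- (v / 2)) = (expR (- (v / 4)) * expR (- (v / 4)))%R.
  by rewrite -expRD; congr expR; field.
have C1v := C1P _ v0.
have : (v `^ (m / 2) * expR (- (v / 4)) <= C1)%R.
  by rewrite expRN ler_pdivrMr ?expR_gt0.
have pk := pospow_ge0 (k / 2) v; have xp := powR_ge0 x (m / 2).
have e0 := expR_ge0 (- (v / 4))%R.
rewrite e4; move: (x `^ _)%R (v `^ _)%R (pospow _ _) (expR _) xp pk e0 => X Y Z E X0 Z0 E0 YE.
have a0 : (0 <= K * X * B * (K' * (Z * E)))%R by rewrite !mulr_ge0 ?(ltW K0) ?(ltW B0) ?(ltW K'0).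
have := ler_wpM2l a0 YE.
have -> : (K * X * B * (K' * (Z * E)) * (Y * E) = K * (X * Y * B) * (K' * (Z * (E * E))))%R.
  by ring.
by have -> : (K * X * B * (K' * (Z * E)) * C1 = K * X * B * C1 * (K' * (Z * E)))%R by ring.
Qed.

End ratio_law.

(** * From exact coverage to degrees of freedom and back *)

Section law_comparison.
Context d (T : measurableType d) (R : realType) (Q : probability T R).
Local Open Scope ereal_scope.

Let measurable_lt (W : T -> R) x : measurable_fun setT W -> measurable [set w | (W w < x)%R].
Proof.
move=> mW; have -> : [set w | (W w < x)%R] = W @^-1` `]-oo, x[.
  by apply/seteqP; split => w /=; rewrite in_itv.
by rewrite -[X in measurable X]setTI; apply: mW => //; exact: measurable_itv.
Qed.

Let measurable_le (W : T -> R) x : measurable_fun setT W -> measurable [set w | (W w <= x)%R].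
Proof.
move=> mW; have -> : [set w | (W w <= x)%R] = W @^-1` `]-oo, x].
  by apply/seteqP; split => w /=; rewrite in_itv.
by rewrite -[X in measurable X]setTI; apply: mW => //; exact: measurable_itv.
Qed.

Let indep (U V : {RV Q >-> R}) := forall A B, measurable A -> measurable B ->
  Q (U @^-1` A `&` V @^-1` B) = Q (U @^-1` A) * Q (V @^-1` B).

Let measurable_ratio (U V : {RV Q >-> R}) : measurable_fun setT (fun w => U w / V w)%R.
Proof.
have mU : measurable_fun setT U by exact: measurable_funPT.
have mV : measurable_fun setT V by exact: measurable_funPT.
by meas.
Qed.

Lemma small_ball_exponent_le (U1 V1 U2 V2 : {RV Q >-> R}) (m1 k1 m2 k2 : R) :
  (0 < m2)%R -> is_chi2 U1 m1 -> is_chi2 V1 k1 -> indep U1 V1 ->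
  is_chi2 U2 m2 -> is_chi2 V2 k2 -> indep U2 V2 ->
  (forall x : R, (0 < x)%R ->
    Q [set w | (U1 w / V1 w < x)%R] <= Q [set w | (U2 w / V2 w <= x)%R]) ->
  (m2 <= m1)%R.
Proof.
move=> m20 lU1 lV1 i1 lU2 lV2 i2 le12.
have [c c0 lower] := ratio_small_ball_lower lU1 lV1 i1.
have [C C0 upper] := ratio_small_ball_upper m20 lU2 lV2 i2.
rewrite leNgt; apply/negP => m12.
pose e : R := ((m2 - m1) / 2)%R.
have e0 : (0 < e)%R by rewrite divr_gt0// subr_gt0.
(* The two bounds would give c <= C x^e. Here [r] is the value prescribed for x^e: small enough that
   C r <= c / 2, and at most 1 so that [x] lies in the range of the lower bound. *)
pose r : R := Num.min (1 / 2)%R (c / (2 * C))%R.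
have r0 : (0 < r)%R by rewrite lt_min !divr_gt0// mulr_gt0.
pose x : R := (r `^ e^-1)%R.
have x0 : (0 < x)%R by rewrite powR_gt0.
have xe : (x `^ e = r)%R by rewrite /x -powRrM mulVf ?gt_eqF// powRr1// ltW.
have r1 : (r <= 1)%R by rewrite ge_min ler_pdivrMr// mul1r ler1n.
have x1 : (x <= 1)%R.
  have p1 : (1 `^ e^-1 = 1)%R by rewrite powR1.
  rewrite /x -[leRHS]p1; apply: ge0_ler_powR => //.
  - by rewrite invr_ge0 ltW.
  - by rewrite nnegrE ltW.
  - by rewrite nnegrE.
have x01 : (0 < x <= 1)%R by rewrite x0.
have := le_trans (lower x x01) (le_trans (le12 x x0) (upper x x0)).
rewrite lee_fin => le.
have m2E : (m2 / 2 = m1 / 2 + e)%R by rewrite /e; field.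
move: le; rewrite m2E powRD; last by rewrite (gt_eqF x0) implybT.
have y0 : (0 < x `^ (m1 / 2))%R by rewrite powR_gt0.
rewrite xe mulrA mulrAC ler_pM2r// => cC.
have rc : (r <= c / (2 * C))%R by rewrite ge_min lexx orbT.
have : (C * r <= c / 2)%R.
  apply: (@le_trans _ _ (C * (c / (2 * C)))%R); first by rewrite ler_pM2l.
  by rewrite le_eqVlt; apply/orP; left; apply/eqP; field; rewrite gt_eqF.
lra.
Qed.

(** If b <= P(W2 <= x), the b quantile is at most x, hence b <= P(W1 < x); if b > P(W2 <= x), it
    exceeds x, hence P(W1 < x) <= b. A level strictly between the two probabilities would contradict
    one of these. *)
Lemma exact_coverage_law (W1 W2 : T -> R) :
  measurable_fun setT W1 -> measurable_fun setT W2 ->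
  (forall alpha : R, (0 < alpha < 1)%R ->
    Q [set w | (W1 w < quantile Q W2 (1 - alpha))%R] = (1 - alpha)%:E) ->
  forall x : R, Q [set w | (W1 w < x)%R] = Q [set w | (W2 w <= x)%R].
Proof.
move=> mW1 mW2 cov x.
have cov' b : (0 < b < 1)%R -> Q [set w | (W1 w < quantile Q W2 b)%R] = b%:E.
  move=> b01; have := cov (1 - b)%R; rewrite opprB addrCA subrr addr0; apply.
  by case/andP: b01 => b0 b1; apply/andP; split; lra.
have mL1 y := measurable_lt y mW1; have mL2 := measurable_le x mW2.
have low b : (0 < b < 1)%R -> b%:E <= Q [set w | (W2 w <= x)%R] ->
    b%:E <= Q [set w | (W1 w < x)%R].
  move=> b01 bF; rewrite -(cov' b b01); apply: le_measure; rewrite ?inE//.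
  move=> w /= /lt_le_trans; apply; rewrite leNgt lt_quantile//.
  by rewrite -leNgt.
have high b : (0 < b < 1)%R -> Q [set w | (W2 w <= x)%R] < b%:E ->
    Q [set w | (W1 w < x)%R] <= b%:E.
  move=> b01 Fb; rewrite -(cov' b b01); apply: le_measure; rewrite ?inE//.
  by move=> w /= /lt_trans; apply; rewrite lt_quantile.
have F1le := probability_le1 Q (mL1 x); have F2le := probability_le1 Q mL2.
have F1ge : 0 <= Q [set w | (W1 w < x)%R] by exact: measure_ge0.
have F2ge : 0 <= Q [set w | (W2 w <= x)%R] by exact: measure_ge0.
have F1fin : Q [set w | (W1 w < x)%R] \is a fin_num by exact: fin_num_measure.
have F2fin : Q [set w | (W2 w <= x)%R] \is a fin_num by exact: fin_num_measure.
move: low high F1le F2le F1ge F2ge; rewrite -(fineK F1fin) -(fineK F2fin).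
move: (fine _) (fine _) => f1 f2 low high; rewrite !lee_fin => f11 f21 f10 f20.
congr EFin; apply/eqP; rewrite eq_le; apply/andP; split; rewrite leNgt; apply/negP => f12.
- have := high ((f1 + f2) / 2)%R; rewrite lte_fin lee_fin => H.
  have : (f1 <= (f1 + f2) / 2)%R by apply: H; [apply/andP; split|]; lra.
  lra.
- have := low ((f1 + f2) / 2)%R; rewrite !lee_fin => H.
  have : ((f1 + f2) / 2 <= f1)%R by apply: H; [apply/andP; split|]; lra.
  lra.
Qed.

Lemma exact_coverage_of_law (W1 W2 : T -> R) (b : R) : (0 < b < 1)%R ->
  measurable_fun setT W2 ->
  (forall x : R, Q [set w | (W1 w < x)%R] = Q [set w | (W2 w < x)%R]) ->
  (forall x : R, Q [set w | W2 w = x] = 0) ->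
  Q [set w | (W1 w < quantile Q W2 b)%R] = b%:E.
Proof.
move=> b01 mW2 law atomless; rewrite law; set q := quantile Q W2 b.
have mS y := measurable_le y mW2; have mL y := measurable_lt y mW2.
apply/eqP; rewrite eq_le; apply/andP; split.
  (* Below the quantile the distribution function is less than [b]; approaching [q] from the left
     bounds the strict event by [b]. *)
  pose F (n : nat) := [set w | (W2 w <= q - n.+1%:R^-1)%R].
  have UF : \bigcup_n F n = [set w | (W2 w < q)%R].
    apply/seteqP; split => w /=.
      by move=> [n _ /le_lt_trans]; apply; rewrite ltrBlDr ltrDl invr_gt0.
    rewrite -subr_gt0 => W2q; have [n _ ltn] := near_infty_natSinv_lt (PosNum W2q).
    exists n => //; rewrite /F /=.
    by have /= := ltn n (leqnn n); rewrite ltrBrDl -ltrBrDr => /ltW.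
  have cvF : Q (F n) @[n --> \oo] --> Q [set w | (W2 w < q)%R].
    rewrite -UF; apply: nondecreasing_cvg_mu.
    - by move=> n; exact: mS.
    - by rewrite UF.
    - move=> n p np; apply/subsetPset => w /= /le_trans; apply.
      by rewrite lerD2l lerN2 lef_pV2 ?posrE// ler_nat.
  rewrite -(cvg_lim _ cvF)//; apply: lime_le; first by apply/cvg_ex; exists (Q [set w | (W2 w < q)%R]).
  apply: nearW => n; apply: ltW; rewrite /F -lt_quantile//.
  by rewrite -/q ltrBlDr ltrDl invr_gt0.
have : b%:E <= Q [set w | (W2 w <= q)%R].
  by rewrite leNgt -lt_quantile// ltxx.
have -> // : Q [set w | (W2 w <= q)%R] = Q [set w | (W2 w < q)%R].
apply: (@measure_eq_off_null _ _ _ _ [set w | W2 w = q]) => //.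
  rewrite (_ : [set w | W2 w = q] = W2 @^-1` [set q]) // -[X in measurable X]setTI.
  by apply: mW2.
by move=> w /= /eqP W2q; rewrite lt_neqAle W2q.
Qed.

Lemma chi2_le0 (U : {RV Q >-> R}) (m : R) : is_chi2 U m -> Q [set w | (U w <= 0)%R] = 0.
Proof.
move=> /is_chi2_density[K K0 dens]; rewrite (chi2_le_event 0 dens).
apply: integral0_eq => t _; rewrite le_indE /gamma_kernel /pospow posE.
by case: ltP => _; rewrite ?mul0r// mulr0 mulr0.
Qed.

(** Both variables are almost surely positive, so ratios can be inverted. Complements exchange
    strict and non-strict events; this carries the comparison of numerators over to denominators. *)
Lemma inverse_ratio (U V : {RV Q >-> R}) (m k y : R) : (0 < y)%R ->
  is_chi2 U m -> is_chi2 V k ->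
  Q [set w | (V w / U w < y)%R] = Q (~` [set w | (U w / V w <= y^-1)%R]) /\
  Q [set w | (V w / U w <= y)%R] = Q (~` [set w | (U w / V w < y^-1)%R]).
Proof.
move=> y0 lU lV.
have mN : measurable ([set w | (U w <= 0)%R] `|` [set w | (V w <= 0)%R]).
  by apply: measurableU; apply: measurable_le; exact: measurable_funPT.
have N0 : Q ([set w | (U w <= 0)%R] `|` [set w | (V w <= 0)%R]) = 0.
  rewrite measureU0; [exact: chi2_le0 lU| | |exact: chi2_le0 lV].
    by apply: measurable_le; exact: measurable_funPT.
  by apply: measurable_le; exact: measurable_funPT.
have key w : ~ ([set w | (U w <= 0)%R] `|` [set w | (V w <= 0)%R]) w ->
    (0 < U w)%R /\ (0 < V w)%R.
  by move=> /= /not_orP[/negP + /negP]; rewrite -!ltNge.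
split; apply: (measure_eq_off_null mN) => //.
- by apply: measurable_lt.
- by apply: measurableC; exact: measurable_le.
- move=> w /key[U0 V0] /=; rewrite ltr_pdivrMr// ler_pdivrMr// ler_pdivlMl//.
  by rewrite mulrC; split => [Vy|/negP]; [apply/negP; rewrite -ltNge|rewrite -ltNge].
- by apply: measurable_le.
- by apply: measurableC; exact: measurable_lt.
- move=> w /key[U0 V0] /=; rewrite ler_pdivrMr// ltr_pdivrMr// ltr_pdivlMl//.
  by rewrite mulrC; split => [Vy|/negP]; [apply/negP; rewrite -leNgt|rewrite -leNgt].
Qed.

End law_comparison.

Lemma coverage_theta4_star (R : realType) (n : nat) d' (T' : measurableType d')
    (Q : probability T' R) (U V Ua Vb : {RV Q >-> R}) : (3 <= n)%N ->
  is_chi2 U (n%:R - 1) -> is_chi2 V (n%:R - 2) ->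
  (forall A B, measurable A -> measurable B ->
    Q (U @^-1` A `&` V @^-1` B) = (Q (U @^-1` A) * Q (V @^-1` B))%E) ->
  forall (beta mu1 mu2 sigma1 sigma2 rho : R),
  0 < beta < 1 -> 0 < sigma1 -> 0 < sigma2 -> -1 < rho < 1 ->
  forall d (T : measurableType d) (P : probability T R)
    (X : 'I_n -> {RV P >-> (R * R)%type}),
  is_normal_sample X (mu1, mu2, sigma1, sigma2, rho) ->
  P [set w | theta4 (mu1, mu2, sigma1, sigma2, rho) <
       quantile Q (fun w' => theta4_star (fun k => X k w) (Ua w') (Vb w')) beta] =
  Q [set w' | U w' / V w' < quantile Q (fun w' => Ua w' / Vb w') beta].
Proof.
case: n => // -[//|m] n3 lU lV indep beta mu1 mu2 sigma1 sigma2 rho b01 s1 s2 r1.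
move=> d T P X lX; set q := quantile Q (fun w' => Ua w' / Vb w') beta.
have th0 : 0 < theta4 (mu1, mu2, sigma1, sigma2, rho).
  rewrite /theta4 /p_sigma2 /p_rho /p_sigma1 /= divr_gt0// mulr_gt0// sqrtr_gt0.
  by case/andP: r1 => *; nra.
have -> : [set w | theta4 (mu1, mu2, sigma1, sigma2, rho) <
       quantile Q (fun w' => theta4_star (fun k => X k w) (Ua w') (Vb w')) beta] =
    [set w | let x := fun k => X k w in
             let c := s22 x * (1 - corr x ^+ 2) / s11 x in
             (0 < c) && (theta4 (mu1, mu2, sigma1, sigma2, rho) ^+ 2 / c < q)].
  by apply/seteqP; split => w /=; rewrite lt_quantile_theta4_star.
rewrite (coverage_chi_ratio q _ s1 s2 r1 lX)//.
case: m n3 lU lV {X lX} => // m _ lU lV.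
apply/esym/(@chi_ratioE _ _ _ _ U V m.+1 m) => //.
- by move: lU; rewrite -(@natrB R m.+3 1).
- by move: lV; rewrite -(@natrB R m.+3 2).
Qed.

Lemma exact_coverage_iff (R : realType) (n : nat) d (T : measurableType d)
    (Q : probability T R) (U V Ua Vb : {RV Q >-> R}) (a b : R) : (3 <= n)%N ->
  a < n%:R -> b < n%:R ->
  is_chi2 U (n%:R - 1) -> is_chi2 V (n%:R - 2) ->
  is_chi2 Ua (n%:R - a) -> is_chi2 Vb (n%:R - b) ->
  (forall A B, measurable A -> measurable B ->
    Q (U @^-1` A `&` V @^-1` B) = (Q (U @^-1` A) * Q (V @^-1` B))%E) ->
  (forall A B, measurable A -> measurable B ->
    Q (Ua @^-1` A `&` Vb @^-1` B) = (Q (Ua @^-1` A) * Q (Vb @^-1` B))%E) ->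
  (forall alpha : R, 0 < alpha < 1 ->
    Q [set w | U w / V w < quantile Q (fun w' => Ua w' / Vb w') (1 - alpha)] =
    (1 - alpha)%:E) <-> (a, b) = (1, 2).
Proof.
move=> n3 an bn lU lV lUa lVb iUV iab.
have n1 : 0 < n%:R - 1 :> R by rewrite subr_gt0 ltr1n (ltn_trans _ n3).
have n2 : 0 < n%:R - 2 :> R by rewrite subr_gt0 ltr_nat.
have na : 0 < n%:R - a by rewrite subr_gt0.
have nb : 0 < n%:R - b by rewrite subr_gt0.
have iVU A B : measurable A -> measurable B ->
    Q (V @^-1` A `&` U @^-1` B) = (Q (V @^-1` A) * Q (U @^-1` B))%E.
  by move=> mA mB; rewrite setIC muleC; exact: iUV.
have iba A B : measurable A -> measurable B ->
    Q (Vb @^-1` A `&` Ua @^-1` B) = (Q (Vb @^-1` A) * Q (Ua @^-1` B))%E.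
  by move=> mA mB; rewrite setIC muleC; exact: iab.
have mr (Y Z : {RV Q >-> R}) : measurable_fun setT (fun w => Y w / Z w).
  have mY : measurable_fun setT Y by exact: measurable_funPT.
  have mZ : measurable_fun setT Z by exact: measurable_funPT.
  by meas.
have mlt (Y Z : {RV Q >-> R}) x : measurable [set w | Y w / Z w < x].
  have -> : [set w | Y w / Z w < x] = (fun w => Y w / Z w) @^-1` `]-oo, x[.
    by apply/seteqP; split => w /=; rewrite in_itv.
  by rewrite -[X in measurable X]setTI; apply: mr => //; exact: measurable_itv.
have mle (Y Z : {RV Q >-> R}) x : measurable [set w | Y w / Z w <= x].
  have -> : [set w | Y w / Z w <= x] = (fun w => Y w / Z w) @^-1` `]-oo, x].
    by apply/seteqP; split => w /=; rewrite in_itv.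
  by rewrite -[X in measurable X]setTI; apply: mr => //; exact: measurable_itv.
have ltle (Y Z : {RV Q >-> R}) x :
    (Q [set w | (Y w / Z w < x)%R] <= Q [set w | (Y w / Z w <= x)%R])%E.
  by apply: le_measure; rewrite ?inE// => w /= /ltW.
split=> [cov|[aE bE] alpha al01].
  have E := exact_coverage_law (mr U V) (mr Ua Vb) cov.
  (* Inversion turns strict into non-strict, so the original ratio and the posterior one exchange
     places with respect to [E]; hence the last two bounds mirror the first two. *)
  have EI x : 0 < x -> Q [set w | Vb w / Ua w < x] = Q [set w | V w / U w <= x].
    move=> x0; have [-> _] := inverse_ratio x0 lUa lVb.
    have [_ ->] := inverse_ratio x0 lU lV.
    by rewrite !probability_setC// E.
  have le1 : n%:R - a <= n%:R - 1.
    by apply: (small_ball_exponent_le na lU lV iUV lUa lVb iab) => x _; rewrite E.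
  have le2 : n%:R - 1 <= n%:R - a.
    apply: (small_ball_exponent_le n1 lUa lVb iab lU lV iUV) => x _.
    by rewrite (le_trans (ltle _ _ _))// -E ltle.
  have le3 : n%:R - b <= n%:R - 2.
    apply: (small_ball_exponent_le nb lV lU iVU lVb lUa iba) => x x0.
    by rewrite (le_trans (ltle _ _ _))// -EI// ltle.
  have le4 : n%:R - 2 <= n%:R - b.
    by apply: (small_ball_exponent_le n2 lVb lUa iba lV lU iVU) => x x0; rewrite EI.
  by congr (_, _); lra.
subst a b; apply: (exact_coverage_of_law _ (mr Ua Vb)).
- by case/andP: al01 => *; apply/andP; split; lra.
(* With a = 1 and b = 2 both ratios have the same positive integer degrees of freedom, so both
   probabilities equal the same [chi_ratio]. *)
- move=> x; case: n n3 n1 n2 an bn na nb lU lV lUa lVb => // -[//|[//|m]] _ _ _ _ _ _ _.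
  have -> : m.+3%:R - 1 = m.+2%:R :> R by rewrite -(@natrB R m.+3 1).
  have -> : m.+3%:R - 2 = m.+1%:R :> R by rewrite -(@natrB R m.+3 2).
  by move=> lU lV lUa lVb; rewrite (chi_ratioE _ lU lV)// (chi_ratioE _ lUa lVb).
- by move=> x; rewrite (ratio_atomless lUa lVb).
Qed.
(** * Posterior distribution *)

Section posterior_substitutions.
Context (R : realType).
Local Notation RR := (measurableTypeR R).
Notation mu := (@lebesgue_measure R).
Local Open Scope ereal_scope.

Lemma ge0_integral_scale f (k : R) : (0 < k)%R ->
  measurable_fun setT f -> (forall y, 0 <= f y) ->
  \int[mu]_(y in `]0%R, +oo[) f y =
  \int[mu]_(x in `]0%R, +oo[) (f (x * k)%R * k%:E).
Proof.
move=> k0 mf f0; rewrite (ge0_integral_powR k0 (oner_neq0 R) mf f0).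
apply: eq_integral => x /set_mem; rewrite /= in_itv/= andbT => x0.
by rewrite powRr1 ?ltW// subrr powRr0 normr1 !mulr1 mulrC.
Qed.

(** The substitution u = s / x^2 turns the exponent into u / 2, and u^((p+1)/2) times the factor
    u^(-3/2) of the Jacobian is u^(p/2 - 1). *)
Lemma ge0_integral_inv_chi (p s : R) (f : R -> \bar R) : (0 < s)%R ->
  measurable_fun setT f -> (forall y, 0 <= f y) ->
  \int[mu]_(x in `]0%R, +oo[) (f x * (x `^ (- (p + 1)) * expR (- (s / (2 * x ^+ 2))))%:E) =
  (Num.sqrt s `^ (- p) / 2)%:E *
  \int[mu]_u (f (Num.sqrt s * u `^ (- 2^-1))%R * (gamma_kernel (p / 2) u)%:E).
Proof.
move=> s0 mf f0; have k0 : (0 < Num.sqrt s)%R by rewrite sqrtr_gt0.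
have mg := measurable_gamma_kernel (p / 2).
have q0 : (- 2^-1 != 0 :> R)%R by rewrite oppr_eq0 invr_eq0 pnatr_eq0.
have mid : measurable_fun setT (fun x : R => x) by exact: measurable_id.
rewrite (ge0_integral_powR k0 q0); last 2 first.
- by meas.
- by move=> y; rewrite mule_ge0// lee_fin mulr_ge0 ?powR_ge0 ?expR_ge0.
rewrite integral_pos -ge0_integralZl_EFin ?divr_ge0 ?powR_ge0//; last 2 first.
- by move=> u _; rewrite mule_ge0// lee_fin gamma_kernel_ge0.
- by meas.
apply: eq_integral => u _; rewrite muleCA -!muleA; congr (_ * _).
rewrite -!EFinM; congr EFin; rewrite /gamma_kernel /pospow !posE.
have [u0|u0] := ltP 0%R u; last by rewrite !(mulr0, mul0r).
rewrite !mulr1 !mul1r normrN ger0_norm//.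
set k := Num.sqrt s; have ks : (k ^+ 2 = s)%R by rewrite sqr_sqrtr// ltW.
have uh : ((u `^ (- 2^-1)) ^+ 2 = u^-1)%R.
  rewrite -powR_mulrn ?powR_ge0// -powRrM (_ : - 2^-1 * 2%:R = - 1 :> R)%R; last by field.
  by rewrite powR_inv1 ?ltW.
have -> : (s / (2 * (k * u `^ (- 2^-1)) ^+ 2) = u / 2)%R.
  by rewrite exprMn uh ks; field; rewrite !gt_eqF.
rewrite powRM ?powR_ge0 ?(ltW k0)// -powRrM.
have -> : (k `^ (- p) = k `^ (- (p + 1)) * k)%R.
  rewrite -[X in (_ * X)%R](powRr1 (ltW k0)) -powRD ?(gt_eqF k0) ?implybT//.
  by congr (_ `^ _)%R; ring.
have -> : (u `^ (p / 2 - 1) = u `^ (- 2^-1 * - (p + 1)) * u `^ (- 2^-1 - 1))%R.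
  rewrite -powRD ?(gt_eqF u0) ?implybT//.
  by congr (_ `^ _)%R; field.
by field.
Qed.

(** With w = sqrt (1 - r^2), passing to t = s2 w contributes the factor w and passing to y = r / w
    contributes w^(-3); together they give the (1 - r^2)^(-1) of the integrand. *)
Lemma ge0_integral_regression (J : RR * RR * RR -> \bar R) :
  measurable_fun setT J -> (forall z, 0 <= J z) ->
  \int[mu]_(r in `](- 1)%R, 1%R[) \int[mu]_(s2 in `]0%R, +oo[) \int[mu]_(s1 in `]0%R, +oo[)
    (J (s1, s2 * Num.sqrt (1 - r ^+ 2), r / Num.sqrt (1 - r ^+ 2))%R *
     (1 - r ^+ 2)^-1%:E) =
  \int[mu]_(t in `]0%R, +oo[) \int[mu]_(s in `]0%R, +oo[) \int[mu]_y J (s, t, y).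
Proof.
move=> mJ J0; have mP : measurable (`]0%R, +oo[%classic : set R) by exact: measurable_itv.
have mK : measurable_fun setT
    (fun z : RR * RR => \int[mu]_(s in `]0%R, +oo[) J (s, z.1, z.2)).
  apply: (@measurable_fun_integral _ _ _ _ _ _ _ (fun z s => J (s, z.1, z.2))) => //.
  by meas.
have mK' y : measurable_fun setT
    (fun t : R => \int[mu]_(s in `]0%R, +oo[) J (s, t, y)).
  apply: (@measurable_fun_integral _ _ _ _ _ _ _ (fun t s => J (s, t, y))) => //.
  by meas.
transitivity (\int[mu]_y \int[mu]_(t in `]0%R, +oo[) \int[mu]_(s in `]0%R, +oo[) J (s, t, y)).
  rewrite [RHS]ge0_integral_div_sqrt; last 2 first.
  - apply: (@measurable_fun_integral _ _ _ _ _ _ _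
      (fun y t => \int[mu]_(s in `]0%R, +oo[) J (s, t, y))) => //.
      apply: (@measurable_fun_integral _ _ _ _ _ _ _ (fun z s => J (s, z.2, z.1))) => //.
      by meas.
    by move=> *; exact: integral_ge0.
  - by move=> y; apply: integral_ge0 => *; exact: integral_ge0.
  apply: eq_integral => r /set_mem; rewrite /= in_itv/= => /andP[r1 r2].
  have d0 : (0 < 1 - r ^+ 2)%R by nra.
  have w0 : (0 < Num.sqrt (1 - r ^+ 2))%R by rewrite sqrtr_gt0.
  have wd : (Num.sqrt (1 - r ^+ 2) ^+ 2 = 1 - r ^+ 2)%R by rewrite sqr_sqrtr ?ltW.
  set w := Num.sqrt _ in w0 wd *; rewrite -wd; move: w w0 {wd d0} => w w0.
  rewrite (ge0_integral_scale w0 (mK' (r / w)%R)); last by move=> *; exact: integral_ge0.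
  rewrite -ge0_integralZr//; last 3 first.
  - apply: measurable_funTS; apply: emeasurable_funM => //.
    by apply: (measurableT_comp (mK' (r / w)%R)); meas.
  - by move=> u _; apply: mule_ge0; [exact: integral_ge0|rewrite lee_fin ltW].
  - by rewrite lee_fin invr_ge0 mulr_ge0 ?sqr_ge0// ltW.
  apply: eq_integral => s2 _; rewrite ge0_integralZr//; last 2 first.
  - by apply: measurable_funTS; meas.
  - by rewrite lee_fin invr_ge0 sqr_ge0.
  rewrite -muleA; congr (_ * _); rewrite -EFinM; congr EFin.
  by field; rewrite gt_eqF.
transitivity (\int[mu]_(t in `]0%R, +oo[) \int[mu]_y \int[mu]_(s in `]0%R, +oo[) J (s, t, y)).
  apply: (@ge0_integral_swap _ _ _ _ _ mu mu setT `]0%R, +oo[%classic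
    (fun z : RR * RR => \int[mu]_(s in `]0%R, +oo[) J (s, z.2, z.1))) => //.
    apply: (@measurable_fun_integral _ _ _ _ _ _ _ (fun z s => J (s, z.2, z.1))) => //.
    by meas.
  by move=> *; exact: integral_ge0.
apply: eq_integral => t _.
apply: (@ge0_integral_swap _ _ _ _ _ mu mu setT `]0%R, +oo[%classic
  (fun z : RR * RR => J (z.2, t, z.1))) => //.
by meas.
Qed.

Lemma integral_phi_affine (k c : R) : (0 < c)%R ->
  \int[mu]_y (phi ((y - k) / c))%:E = c%:E.
Proof.
move=> c0; have mphi := @measurable_phi R.
rewrite (ge0_integral_affine k c0); last 2 first.
- by meas.
- by move=> y; rewrite lee_fin phi_ge0.
transitivity (\int[mu]_x (c%:E * (phi x)%:E)).
  by apply: eq_integral => x _; rewrite muleC addrK mulrC mulKf// gt_eqF.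
rewrite ge0_integralZl_EFin ?(ltW c0)//; last 2 first.
- by move=> x _; rewrite lee_fin phi_ge0.
- by meas.
rewrite -[RHS]mule1; congr (_ * _).
have := @integral_std_normal R (cst 1) (measurable_cst _) (fun=> lee01).
rewrite [LHS]integral_cst// [X in 1 * X]probability_setT mule1 => ->.
by apply: eq_integral => x _; rewrite mul1e.
Qed.

End posterior_substitutions.

(** * Likelihood and prior in regression coordinates *)

Section likelihood.
Context (R : realType).

Lemma phiE (x : R) : phi x = phi 0 * expR (- (x ^+ 2 / 2)).
Proof. by rewrite /phi expr0n /= mul0r oppr0 expR0 mulr1. Qed.

Lemma phiN (x : R) : phi (- x) = phi x.
Proof. by rewrite /phi sqrrN. Qed.

(** The sum of squares splits into its centered part and the mean. One Gaussian factor is kept for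
    the scaled mean, so n + 1 observations leave the power n of [phi 0]. *)
Lemma prod_phi (n : nat) (e : 'I_n.+1 -> R) :
  \prod_(k < n.+1) phi (e k) =
  phi 0 ^+ n *
  expR (- ((\sum_(k < n.+1) e k * e k -
            (\sum_(k < n.+1) e k) * (\sum_(k < n.+1) e k) / n.+1%:R) / 2)) *
  phi ((\sum_(k < n.+1) e k) / Num.sqrt n.+1%:R).
Proof.
have sn : Num.sqrt n.+1%:R ^+ 2 = n.+1%:R :> R by rewrite sqr_sqrtr.
under eq_bigr do rewrite phiE.
rewrite big_split/= prodr_const card_ord -expR_sum [in RHS](phiE (_ / _)).
rewrite exprSr [RHS]mulrACA; congr (_ * _).
rewrite -expRD; congr expR; rewrite sumrN -mulr_suml expr_div_n sn.
have -> : \sum_(k < n.+1) e k * e k = \sum_(k < n.+1) e k ^+ 2.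
  by apply: eq_bigr => k _; rewrite expr2.
by field.
Qed.

Variables (n : nat) (x : 'I_n.+1 -> R * R).

(** The residual sum of squares of the regression of x2 on x1 with slope [beta] and fitted
    intercept. *)
Definition residual_sum (beta : R) : R := s22 x - 2 * beta * s12 x + beta ^+ 2 * s11 x.

(** The last two factors are arranged for integration over mu2 and then mu1: the centre of mu2
    depends on mu1 only through a shift. *)
Lemma likelihoodE (mu1 mu2 sigma1 sigma2 rho tau beta : R) :
  0 < sigma1 -> 0 < sigma2 -> -1 < rho < 1 ->
  tau = sigma2 * Num.sqrt (1 - rho ^+ 2) -> beta = rho * sigma2 / sigma1 ->
  likelihood x (mu1, mu2, sigma1, sigma2, rho) =
  phi 0 ^+ n ^+ 2 * (sigma1 * tau) ^- n.+1 *
  (expR (- (s11 x / (2 * sigma1 ^+ 2))) *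
   expR (- (residual_sum beta / (2 * tau ^+ 2)))) *
  (phi ((mu1 - xbar1 x) / (sigma1 / Num.sqrt n.+1%:R)) *
   phi ((mu2 - (xbar2 x + beta * (mu1 - xbar1 x))) / (tau / Num.sqrt n.+1%:R))).
Proof.
move=> s1 s2 rho1 tauE betaE.
have [] := sums_standardize mu1 mu2 s1 s2 rho1 x (ltn0Sn n).
rewrite -tauE.
have tau0 : 0 < tau.
  by rewrite tauE mulr_gt0// sqrtr_gt0; case/andP: rho1 => *; nra.
have sn := lt0r_neq0 s1; have tn := lt0r_neq0 tau0.
have nn : n.+1%:R != 0 :> R by [].
set q : R := Num.sqrt n.+1%:R.
have qn : q != 0 by rewrite sqrtr_eq0 -ltNge.
have qq : q ^+ 2 = n.+1%:R by rewrite sqr_sqrtr.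
rewrite /likelihood /model_pdf /p_mu1 /p_mu2 /p_sigma1 /p_sigma2 /p_rho /=.
under [in X in _ -> _ -> _ -> X]eq_bigr do rewrite binormal_pdfE// -tauE.
set e := fun k => (standardize mu1 mu2 sigma1 sigma2 rho (x k)).1.
set f := fun k => (standardize mu1 mu2 sigma1 sigma2 rho (x k)).2.
pose c (u v : 'I_n.+1 -> R) :=
  \sum_(k < n.+1) u k * v k - (\sum_(k < n.+1) u k) * (\sum_(k < n.+1) v k) / n.+1%:R.
move=> s11E s12E s22E.
rewrite big_split big_split /= prodr_const card_ord.
rewrite (prod_phi e) (prod_phi f) -/q.
have <- : s11 x / sigma1 ^+ 2 = \sum_(k < n.+1) e k * e k -
    (\sum_(k < n.+1) e k) * (\sum_(k < n.+1) e k) / n.+1%:R.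
  by rewrite s11E mulrAC divff ?mul1r// expf_neq0.
have <- : residual_sum beta / tau ^+ 2 = \sum_(k < n.+1) f k * f k -
    (\sum_(k < n.+1) f k) * (\sum_(k < n.+1) f k) / n.+1%:R.
  rewrite /residual_sum s11E s12E s22E betaE -/(c e e) -/(c e f) -/(c f f).
  by move: (c e e) (c e f) (c f f) => cee cef cff; field; rewrite sn tn.
have -> : (\sum_(k < n.+1) e k) / q =
    - ((mu1 - xbar1 x) / (sigma1 / q)).
  have -> : \sum_(k < n.+1) e k = n.+1%:R * (xbar1 x - mu1) / sigma1.
    rewrite -mulr_suml sumrB sumr_const card_ord -[mu1 *+ _]mulr_natl /xbar1.
    by rewrite mulrBr mulVKf.
  by rewrite -qq; move: q qn {qq} => q qn; field; rewrite sn qn.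
have -> : (\sum_(k < n.+1) f k) / q =
    - ((mu2 - (xbar2 x + beta * (mu1 - xbar1 x))) / (tau / q)).
  have -> : \sum_(k < n.+1) f k =
      n.+1%:R * (xbar2 x - mu2 - beta * (xbar1 x - mu1)) / tau.
    rewrite /f /= -tauE -mulr_suml -betaE sumrB sumrB -mulr_sumr sumrB !sumr_const card_ord.
    rewrite -[mu1 *+ _]mulr_natl -[mu2 *+ _]mulr_natl /xbar1 /xbar2.
    by move: (n.+1%:R : R) nn => N nn; field; rewrite nn tn.
  by rewrite -qq; move: q qn {qq} => q qn; field; rewrite tn qn.
rewrite !phiN exprVn.
have -> : s11 x / sigma1 ^+ 2 / 2 = s11 x / (2 * sigma1 ^+ 2) by field; rewrite sn.
have -> : residual_sum beta / tau ^+ 2 / 2 = residual_sum beta / (2 * tau ^+ 2).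
  by field; rewrite tn.
by ring.
Qed.

(** Of the power b/2 - 2 of 1 - rho^2, the part b/2 - 1 is absorbed by [tau], which leaves the power
    -1 produced by the Jacobian of the regression coordinates. *)
Lemma priorE (a b mu1 mu2 sigma1 sigma2 rho tau : R) :
  0 < sigma1 -> 0 < sigma2 -> -1 < rho < 1 ->
  tau = sigma2 * Num.sqrt (1 - rho ^+ 2) ->
  prior a b (mu1, mu2, sigma1, sigma2, rho) =
  sigma1 `^ (a - 3) * tau `^ (b - 2) * (1 - rho ^+ 2)^-1.
Proof.
move=> s1 s2 rho1 ->.
have d0 : 0 < 1 - rho ^+ 2 by case/andP: rho1 => *; nra.
rewrite /prior /p_sigma1 /p_sigma2 /p_rho /= !invfM -!powRN.
rewrite powRM ?sqrtr_ge0 ?(ltW s2)// !opprB -!mulrA; congr (_ * (_ * _)).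
have <- := powR_inv1 (ltW d0); rewrite -powR12_sqrt ?(ltW d0)// -powRrM.
rewrite -powRD ?(gt_eqF d0) ?implybT//.
by congr (_ `^ _); field.
Qed.

End likelihood.

Section product_sigma_finite.
Local Open Scope ereal_scope.
Context d1 d2 (T1 : measurableType d1) (T2 : measurableType d2) (R : realType).
Variables (m1 : {sigma_finite_measure set T1 -> \bar R})
          (m2 : {sigma_finite_measure set T2 -> \bar R}).

Let sigma_finite_product : sigma_finite setT (m1 \x m2).
Proof.
have /sigma_finiteP[F [FT Fnd Foo]] := sigma_finiteT m1.
have /sigma_finiteP[G [GT Gnd Goo]] := sigma_finiteT m2.
exists (fun i => F i `*` G i); last first.
  move=> i; have [mF Fi] := Foo i; have [mG Gi] := Goo i.
  by split; [exact: measurableX|rewrite product_measure1E// lte_mul_pinfty// ge0_fin_numE].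
apply/esym/seteqP; split => // -[y z] _.
have [i _ Fy] : (\bigcup_i F i) y by rewrite -FT.
have [j _ Gz] : (\bigcup_i G i) z by rewrite -GT.
exists (maxn i j) => //; split => /=.
- by move/subsetPset: (Fnd i (maxn i j) (leq_maxl _ _)); apply.
- by move/subsetPset: (Gnd j (maxn i j) (leq_maxr _ _)); apply.
Qed.

(* The library proves that [m1 \x m2] is sigma-finite, but does not make it a
   canonical sigma-finite measure. *)
Definition product_sigma_finite_measure :
    {sigma_finite_measure set (T1 * T2)%type -> \bar R} :=
  HB.pack (m1 \x m2)
    (Measure_isSigmaFinite.Build _ _ _ (m1 \x m2) sigma_finite_product).

End product_sigma_finite.

(** * Integration over the means and passage to s, t and y *)

Section posterior_theta4.
Context (R : realType).
Local Notation RR := (measurableTypeR R).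
Notation mu := (@lebesgue_measure R).
Notation P := (`]0%R, +oo[%classic : set RR).
Variables (n : nat) (x : 'I_n.+1 -> R * R) (a b : R).
Local Notation N := (n.+1%:R : R).
Local Notation pm := product_sigma_finite_measure.
Local Notation q := (Num.sqrt N).

(* [s], [t] and [y] stand for sigma1, sigma2 sqrt(1 - rho^2) and
   rho / sqrt(1 - rho^2); [k] is the exponent left by the integration over
   (mu1, mu2). *)
Definition scale_kernel (k s t y : R) : R :=
  (s * t) `^ (- k) * (s `^ (a - 3) * t `^ (b - 2)) *
  (expR (- (s11 x / (2 * s ^+ 2))) *
   expR (- (residual_sum x (y * t / s) / (2 * t ^+ 2)))).

Lemma scale_kernel_ge0 k s t y : 0 <= scale_kernel k s t y.
Proof.
by apply: mulr_ge0; rewrite mulr_ge0 ?expR_ge0 ?powR_ge0// mulr_ge0 ?powR_ge0.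
Qed.

Lemma measurable_scale_kernel d (T : measurableType d) k (s t y : T -> R) :
  measurable_fun setT s -> measurable_fun setT t -> measurable_fun setT y ->
  measurable_fun setT (fun z => scale_kernel k (s z) (t z) (y z)).
Proof. by move=> ms mt my; rewrite /scale_kernel /residual_sum; meas. Qed.

Variable B : set R.
Hypothesis mB : measurable B.

Let mI : measurable_fun setT (\1_B : R -> R).
Proof. exact: measurable_indic. Qed.

Local Open Scope ereal_scope.

(** Integrating over the two means gives s t / N: this is the origin of the divisor [N] and of the
    exponent [n] instead of n + 1. *)
Definition theta4_kernel (z : RR * RR * RR) : \bar R :=
  (\1_B (z.1.2 / z.1.1)%R * (phi 0 ^+ n ^+ 2 / N * scale_kernel n%:R z.1.1 z.1.2 z.2))%:E.

Lemma theta4_kernel_ge0 z : 0 <= theta4_kernel z.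
Proof.
by rewrite lee_fin mulr_ge0// mulr_ge0 ?scale_kernel_ge0// divr_ge0 ?sqr_ge0.
Qed.

Lemma measurable_theta4_kernel : measurable_fun setT theta4_kernel.
Proof.
rewrite /theta4_kernel; have mk := measurable_scale_kernel.
meas; by apply: mk; meas.
Qed.

Lemma integral_mean_kernel (g s t beta x1 x2 : R) :
  (0 < s)%R -> (0 < t)%R -> (0 <= g)%R ->
  \int[mu \x mu]_m (g * (phi ((m.1 - x1) / s) *
     phi ((m.2 - (x2 + beta * (m.1 - x1))) / t)))%:E = (g * (s * t))%:E.
Proof.
move=> s0 t0 g0; have mphi := @measurable_phi R; have pge := @phi_ge0 R.
rewrite tonelli_prod; last 2 first.
- by meas.
- by move=> z; rewrite lee_fin !mulr_ge0.
transitivity (\int[mu]_y ((g * t)%:E * (phi ((y - x1) / s))%:E)).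
  apply: eq_integral => y _ /=.
  transitivity (\int[mu]_z ((g * phi ((y - x1) / s))%:E *
      (phi ((z - (x2 + beta * (y - x1))) / t))%:E)).
    by apply: eq_integral => z _; rewrite -EFinM mulrA.
  rewrite ge0_integralZl_EFin ?mulr_ge0//; last 2 first.
  - by move=> z _; rewrite lee_fin.
  - by meas.
  by rewrite integral_phi_affine// -!EFinM; congr EFin; ring.
rewrite ge0_integralZl_EFin ?mulr_ge0 ?(ltW t0)//; last 2 first.
- by move=> z _; rewrite lee_fin.
- by meas.
by rewrite integral_phi_affine// -!EFinM; congr EFin; ring.
Qed.

Lemma unnormalized_posterior_theta4_kernel :
  unnormalized_posterior a b x (@theta4 R @^-1` B) =
  \int[mu]_(t in P) \int[mu]_(s in P) \int[mu]_y theta4_kernel (s, t, y).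
Proof.
have mP : measurable P by exact: measurable_itv.
have mJ : measurable (`](- 1)%R, 1%R[%classic : set RR) by exact: measurable_itv.
have mphi := @measurable_phi R; have mk := measurable_scale_kernel.
rewrite -(ge0_integral_regression measurable_theta4_kernel theta4_kernel_ge0).
(* The full integrand, means included, extended to all arguments. The inverse of 1 - rho^2 is
   written as a real power, so that [F] stays nonnegative outside the parameter space, as Tonelli
   requires. *)
pose F (z : RR * RR * RR * RR * RR) : \bar R :=
  let t := (z.1.2 * Num.sqrt (1 - z.2 ^+ 2))%R in
  let y := (z.2 / Num.sqrt (1 - z.2 ^+ 2))%R in
  let s := z.1.1.2 in
  let beta := (y * t / s)%R in
  let m := z.1.1.1 in
  (\1_B (t / s)%R * (phi 0 ^+ n ^+ 2 * scale_kernel N s t y) * (1 - z.2 ^+ 2) `^ (- 1) *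
   (phi ((m.1 - xbar1 x) / (s / q)) *
    phi ((m.2 - (xbar2 x + beta * (m.1 - xbar1 x))) / (t / q))))%:E.
have mF : measurable_fun setT F by rewrite /F; meas; apply: mk; meas.
have F0 z : 0 <= F z.
  rewrite lee_fin; do 2!(apply: mulr_ge0; last by rewrite ?powR_ge0 ?mulr_ge0 ?phi_ge0).
  by rewrite mulr_ge0// mulr_ge0 ?scale_kernel_ge0// sqr_ge0.
transitivity (\int[@param_measure R]_(z in [set: RR * RR] `*` P `*` P `*` `](- 1)%R, 1%R[) F z).
  rewrite /unnormalized_posterior [LHS]integral_mkcond [RHS]integral_mkcond.
  apply: eq_integral => -[[[[m1 m2] s1] s2] r] _.
  set z := (m1, m2, s1, s2, r).
  have zE : param_space z <-> ([set: RR * RR] `*` P `*` P `*` `](- 1)%R, 1%R[) z.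
    by rewrite /param_space /= !in_itv/= !andbT; split => [[]|[[[]]]].
  rewrite !patchE in_setI.
  have [ps|nps] := pselect (param_space z); last first.
    by rewrite (memNset nps) andbF memNset// => /zE.
  rewrite (mem_set ps) andbT (mem_set (iffLR zE ps)).
  case: ps; rewrite /p_sigma1 /p_sigma2 /p_rho /= => s10 s20 r01.
  have d0 : (0 < 1 - r ^+ 2)%R by case/andP: r01 => *; nra.
  have w0 : (0 < Num.sqrt (1 - r ^+ 2))%R by rewrite sqrtr_gt0.
  have t0 : (0 < s2 * Num.sqrt (1 - r ^+ 2))%R by rewrite mulr_gt0.
  have betaE : (r / Num.sqrt (1 - r ^+ 2) * (s2 * Num.sqrt (1 - r ^+ 2)) / s1 = r * s2 / s1)%R.
    by move: (Num.sqrt _) w0 => w w0; field; rewrite !gt_eqF.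
  rewrite /F /= betaE indicE -[X in if X then _ else _]/(theta4 z \in B).
  rewrite -[(s2 * _ / s1)%R]/(theta4 z); case: ifP => _; last by rewrite !mul0r.
  congr EFin; rewrite mul1r /z (likelihoodE _ _ _ s10 s20 r01 erefl erefl).
  rewrite (priorE _ _ _ _ s10 s20 r01 erefl) powR_inv1 ?(ltW d0)//.
  rewrite /scale_kernel betaE powRN powR_mulrn; last by rewrite mulr_ge0 ?ltW.
  by ring.
have mPP : measurable ([set: RR * RR] `*` P) by exact: measurableX.
have mPPP : measurable ([set: RR * RR] `*` P `*` P) by exact: measurableX.
transitivity (\int[mu]_(r in `](- 1)%R, 1%R[) \int[mu]_(s2 in P) \int[mu]_(s1 in P)
    \int[mu \x mu]_m F (m, s1, s2, r)).
  etransitivity.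
    exact: (@ge0_integral_setX2 _ _ (RR * RR * RR * RR)%type RR R (pm (pm (pm mu mu) mu) mu) mu _ _ F mPPP mJ mF F0).
  apply: eq_integral => r _; etransitivity.
    apply: (@ge0_integral_setX2 _ _ (RR * RR * RR)%type RR R (pm (pm mu mu) mu) mu _ _ (fun z => F (z, r)) mPP mP).
      by apply: (measurableT_comp mF); meas.
    by move=> *; exact: F0.
  apply: eq_integral => s2 _.
  apply: (@ge0_integral_setX2 _ _ (RR * RR)%type RR R (pm mu mu) mu _ _ (fun z => F (z, s2, r)) _ mP) => //.
  by apply: (measurableT_comp mF); meas.
apply: eq_integral => r /set_mem; rewrite /= in_itv/= => /andP[r1 r2].
have d0 : (0 < 1 - r ^+ 2)%R by nra.
have w0 : (0 < Num.sqrt (1 - r ^+ 2))%R by rewrite sqrtr_gt0.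
apply: eq_integral => s2 /set_mem; rewrite /= in_itv/= andbT => s20.
apply: eq_integral => s1 /set_mem; rewrite /= in_itv/= andbT => s10.
have q0 : (0 < q)%R by rewrite sqrtr_gt0.
have t0 : (0 < s2 * Num.sqrt (1 - r ^+ 2))%R by rewrite mulr_gt0.
rewrite /F /= integral_mean_kernel ?divr_gt0//; last first.
  apply: mulr_ge0; last exact: powR_ge0.
  by rewrite mulr_ge0// mulr_ge0 ?sqr_ge0 ?scale_kernel_ge0.
rewrite /theta4_kernel -EFinM; congr EFin; rewrite powR_inv1 ?(ltW d0)//.
set t := (s2 * _)%R in t0 *; set y := (r / _)%R.
have -> : scale_kernel n%:R s1 t y = (scale_kernel N s1 t y * (s1 * t))%R.
  have st0 : (0 < s1 * t)%R by rewrite mulr_gt0.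
  rewrite /scale_kernel !(powRN (s1 * t)) !powR_mulrn ?(ltW st0)//.
  rewrite [((s1 * t) ^+ n.+1)%R]exprS; move: (s1 * t)%R st0 => st st0.
  move: (expR _) (expR _) (_ `^ _)%R (_ `^ _)%R (st ^+ n)%R (expf_neq0 n (lt0r_neq0 st0)).
  by move=> e1 e2 p1 p2 sn sn0; field; rewrite sn0 gt_eqF.
have qq : (q ^+ 2 = N)%R by rewrite sqr_sqrtr.
move: (scale_kernel _ _ _ _) => sk /=; set c := q in q0 qq *; rewrite -qq.
by move: c q0 {qq} => c c0; field; rewrite !gt_eqF.
Qed.

End posterior_theta4.

(** * Reduction to two chi-squared densities *)

Section posterior_law_theta4.
Context (R : realType).
Local Notation RR := (measurableTypeR R).
Notation mu := (@lebesgue_measure R).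
Notation P := (`]0%R, +oo[%classic : set RR).
Variables (n : nat) (x : 'I_n.+1 -> R * R) (a b : R).
Local Notation N := (n.+1%:R : R).
Local Notation S := (s22 x * (1 - corr x ^+ 2)).
Hypotheses (s110 : 0 < s11 x) (S0 : 0 < S).

Lemma residual_sumE beta :
  residual_sum x beta = S + s11 x * (beta - s12 x / s11 x) ^+ 2.
Proof. by rewrite /residual_sum s22_corr; field; rewrite gt_eqF. Qed.

Lemma theta4_starE u v : 0 < u -> 0 < v ->
  theta4_star x u v =
  Num.sqrt S * v `^ (- 2^-1) / (Num.sqrt (s11 x) * u `^ (- 2^-1)).
Proof.
move=> u0 v0; have hE z : 0 < z -> z `^ (- 2^-1) = (Num.sqrt z)^-1 :> R.
  by move=> z0; rewrite powRN powR12_sqrt// ltW.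
rewrite /theta4_star !hE//; move: (S) (s11 x) S0 s110 => w c w0 c0.
rewrite !sqrtrM ?ltW// !sqrtrV ?ltW//.
by field; rewrite !gt_eqF ?sqrtr_gt0.
Qed.

(** The unnormalized density of sqrt (c / W) for W chi-squared with [p] degrees of freedom. *)
Definition inv_chi_kernel (p c s : R) : R :=
  s `^ (- (p + 1)) * expR (- (c / (2 * s ^+ 2))).

Lemma inv_chi_kernel_ge0 p c s : 0 <= inv_chi_kernel p c s.
Proof. by rewrite mulr_ge0 ?powR_ge0 ?expR_ge0. Qed.

Lemma measurable_inv_chi_kernel p c : measurable_fun setT (inv_chi_kernel p c).
Proof.
have mid : measurable_fun setT (fun x : R => x) by exact: measurable_id.
by rewrite /inv_chi_kernel; meas.
Qed.

Local Open Scope ereal_scope.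

Definition theta4_constant : R :=
  phi 0 ^+ n ^+ 2 / N / phi 0 / Num.sqrt (s11 x).

Lemma theta4_constant_gt0 : (0 < theta4_constant)%R.
Proof. by rewrite !divr_gt0 ?sqrtr_gt0 ?phi_gt0// !exprn_gt0 ?phi_gt0. Qed.

(** Completing the square about the least squares slope makes the kernel Gaussian in y with standard
    deviation s / sqrt s11. The factor s gained here turns a - 3 into a - 2, so the degrees of
    freedom come out as N - a and N - b. *)
Lemma integral_theta4_kernel (B : set R) (s t : R) : (0 < s)%R -> (0 < t)%R ->
  \int[mu]_y theta4_kernel x a b B (s, t, y) =
  (theta4_constant * \1_B (t / s)%R * inv_chi_kernel (N - b) S t)%:E *
  (inv_chi_kernel (N - a) (s11 x) s)%:E.
Proof.
move=> s0 t0; have mphi := @measurable_phi R.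
have p0 := @phi_gt0 R 0; have sq0 : (0 < Num.sqrt (s11 x))%R by rewrite sqrtr_gt0.
have sq2 : (Num.sqrt (s11 x) ^+ 2 = s11 x)%R by rewrite sqr_sqrtr ?ltW.
pose c := (\1_B (t / s)%R * (phi 0 ^+ n ^+ 2 / N) *
  ((s * t) `^ (- n%:R) * (s `^ (a - 3) * t `^ (b - 2))) *
  (expR (- (s11 x / (2 * s ^+ 2))) * expR (- (S / (2 * t ^+ 2)))) / phi 0)%R.
have c0 : (0 <= c)%R.
  apply: mulr_ge0; last by rewrite invr_ge0 ltW.
  apply: mulr_ge0; last by rewrite mulr_ge0 ?expR_ge0.
  apply: mulr_ge0; last by rewrite mulr_ge0 ?powR_ge0// mulr_ge0 ?powR_ge0.
  by rewrite mulr_ge0// divr_ge0 ?sqr_ge0.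
transitivity (\int[mu]_y (c%:E *
    (phi ((y - s12 x / s11 x * (s / t)) / (s / Num.sqrt (s11 x))))%:E)).
  apply: eq_integral => y _; rewrite /theta4_kernel -EFinM; congr EFin => /=.
  rewrite /scale_kernel residual_sumE [phi (_ / _)]phiE /c.
  set e := expR (- (((y - _) / _) ^+ 2 / 2)).
  have -> : expR (- ((S + s11 x * (y * t / s - s12 x / s11 x) ^+ 2) / (2 * t ^+ 2))) =
      (expR (- (S / (2 * t ^+ 2))) * e)%R.
    rewrite /e -expRD; congr expR; move: (S) => T.
    move: (s12 x / s11 x)%R => bh; set w := Num.sqrt _ in sq0 sq2 *; rewrite -sq2.
    by move: w sq0 {sq2} => w w0; field; rewrite !gt_eqF.
  by rewrite [RHS]mulrA divfK ?gt_eqF//; ring.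
rewrite ge0_integralZl_EFin//; last 2 first.
- by move=> y _; rewrite lee_fin phi_ge0.
- by meas.
rewrite integral_phi_affine ?divr_gt0// -!EFinM; congr EFin.
rewrite /c /theta4_constant /inv_chi_kernel powRM ?(ltW s0) ?(ltW t0)//.
have -> : (s `^ (- (N - a + 1)) = s `^ (- n%:R) * s `^ (a - 3) * s)%R.
  rewrite -[X in (_ * X)%R](powRr1 (ltW s0)) -!powRD ?(gt_eqF s0) ?implybT//.
  by congr (_ `^ _)%R; rewrite -natr1; ring.
have -> : (t `^ (- (N - b + 1)) = t `^ (- n%:R) * t `^ (b - 2))%R.
  rewrite -powRD ?(gt_eqF t0) ?implybT//.
  by congr (_ `^ _)%R; rewrite -natr1; ring.
by field; rewrite !gt_eqF.
Qed.

(** The inverse chi substitution is made in s with t frozen, then in t. The constant is the same for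
    every [B], so normalization removes it. *)
Lemma unnormalized_posterior_chi : exists2 C : R, (0 < C)%R &
  forall B : set R, measurable B ->
  unnormalized_posterior a b x (@theta4 R @^-1` B) =
  C%:E * \int[mu]_v (\int[mu]_u
    ((\1_B (theta4_star x u v))%:E * (gamma_kernel ((N - a) / 2) u)%:E) *
    (gamma_kernel ((N - b) / 2) v)%:E).
Proof.
have c0 := theta4_constant_gt0.
pose ka := (Num.sqrt (s11 x) `^ (- (N - a)) / 2)%R.
pose kb := (Num.sqrt S `^ (- (N - b)) / 2)%R.
have ka0 : (0 < ka)%R by rewrite divr_gt0 ?powR_gt0 ?sqrtr_gt0.
have kb0 : (0 < kb)%R by rewrite divr_gt0 ?powR_gt0 ?sqrtr_gt0.
exists (theta4_constant * ka * kb)%R => [|B mB]; first by do 2!apply: mulr_gt0 => //.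
have mI : measurable_fun setT (\1_B : R -> R) by exact: measurable_indic.
have mg := measurable_gamma_kernel ((N - a) / 2); have mg' := measurable_gamma_kernel ((N - b) / 2).
have mk := measurable_inv_chi_kernel (N - b) S.
rewrite unnormalized_posterior_theta4_kernel//.
pose g s t : R := (\1_B (t / (Num.sqrt (s11 x) * s `^ (- 2^-1))))%R.
pose h t := \int[mu]_u ((g u t)%:E * (gamma_kernel ((N - a) / 2) u)%:E).
have mh : measurable_fun setT h.
  rewrite /h /g; meas_int => z u; apply: mule_ge0; rewrite lee_fin//; exact: gamma_kernel_ge0.
have h0 t : 0 <= h t.
  by apply: integral_ge0 => u _; apply: mule_ge0; rewrite lee_fin//; exact: gamma_kernel_ge0.
transitivity (\int[mu]_(t in P) ((theta4_constant * ka)%:E *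
    (h t * (inv_chi_kernel (N - b) S t)%:E))).
  apply: eq_integral => t /set_mem; rewrite /= in_itv/= andbT => t0.
  transitivity (\int[mu]_(s in P)
      ((theta4_constant * \1_B (t / s)%R * inv_chi_kernel (N - b) S t)%:E *
       (inv_chi_kernel (N - a) (s11 x) s)%:E)).
    apply: eq_integral => s /set_mem; rewrite /= in_itv/= andbT => s0.
    exact: integral_theta4_kernel.
  rewrite ge0_integral_inv_chi//; last 2 first.
  - by have minv := @measurable_inv R; meas.
  - move=> y; rewrite lee_fin; apply: mulr_ge0; last exact: inv_chi_kernel_ge0.
    by rewrite mulr_ge0// ltW.
  transitivity (ka%:E * \int[mu]_u ((theta4_constant * inv_chi_kernel (N - b) S t)%:E *
      ((g u t)%:E * (gamma_kernel ((N - a) / 2) u)%:E))).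
    congr (_ * _); apply: eq_integral => u _; rewrite -!EFinM /g; congr EFin; ring.
  have ck0 : (0 <= theta4_constant * inv_chi_kernel (N - b) S t)%R.
    by apply: mulr_ge0; [exact: ltW|exact: inv_chi_kernel_ge0].
  rewrite ge0_integralZl_EFin//; last 2 first.
  - by move=> u _; apply: mule_ge0; rewrite lee_fin//; exact: gamma_kernel_ge0.
  - by rewrite /g; meas.
  rewrite -/(h t) muleA -EFinM [X in _ = _ * X]muleC muleA -EFinM.
  by congr (_%:E * _); ring.
move: ka ka0 (theta4_constant) c0 => ka ka0 c c0.
rewrite ge0_integralZl_EFin; last 4 first.
- by [].
- by move=> t _; rewrite mule_ge0// lee_fin inv_chi_kernel_ge0.
- by apply: measurable_funTS; meas.
- by apply: mulr_ge0; exact: ltW.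
transitivity ((c * ka)%:E * (kb%:E * \int[mu]_v
    (h (Num.sqrt S * v `^ (- 2^-1))%R * (gamma_kernel ((N - b) / 2) v)%:E))).
  by congr (_ * _); exact: (ge0_integral_inv_chi (N - b) S0 mh h0).
rewrite (EFinM (c * ka)) -[RHS]muleA.
apply: (congr1 (fun I => (c * ka)%:E * (kb%:E * I))).
apply: eq_integral => v _.
(* The closed form of [theta4_star] requires positive arguments; elsewhere the kernels vanish. *)
have [v0|v0] := ltP 0%R v; last by rewrite /gamma_kernel /pospow posE ltNge v0 !mul0r !mule0.
congr (_ * _); apply: eq_integral => u _.
have [u0|u0] := ltP 0%R u; last by rewrite /gamma_kernel /pospow posE ltNge u0 !mul0r !mule0.
by rewrite theta4_starE.
Qed.

End posterior_law_theta4.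

Lemma posterior_theta4 (R : realType) (n : nat) (a b : R) d (T : measurableType d)
    (Q : probability T R) (Ua Vb : {RV Q >-> R}) :
  is_chi2 Ua (n.+1%:R - a) -> is_chi2 Vb (n.+1%:R - b) ->
  (forall A B, measurable A -> measurable B ->
    Q (Ua @^-1` A `&` Vb @^-1` B) = (Q (Ua @^-1` A) * Q (Vb @^-1` B))%E) ->
  forall x : 'I_n.+1 -> R * R, nondegenerate x ->
  forall B : set R, measurable B ->
  posterior a b x (@theta4 R @^-1` B) = Q [set w | B (theta4_star x (Ua w) (Vb w))].
Proof.
move=> lawU lawV indep x [s110 s220 corr1] B mB.
have S0 : 0 < s22 x * (1 - corr x ^+ 2).
  by rewrite mulr_gt0// subr_gt0 -real_normK ?num_real// expr_lt1.
have [C C0 postE] := unnormalized_posterior_chi a b s110 S0.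
have [K K0 dens] := is_chi2_density lawU.
have [K' K'0 dens'] := is_chi2_density lawV.
have mU : measurable_fun setT (Ua : T -> measurableTypeR R).
  by exact: (@measurable_funPT _ _ _ _ Ua).
have mV : measurable_fun setT (Vb : T -> measurableTypeR R).
  by exact: (@measurable_funPT _ _ _ _ Vb).
have mg := measurable_gamma_kernel ((n.+1%:R - a) / 2).
have mg' := measurable_gamma_kernel ((n.+1%:R - b) / 2).
pose I A := (\int[@lebesgue_measure R]_v (\int[@lebesgue_measure R]_u
    ((\1_A (theta4_star x u v))%:E * (gamma_kernel ((n.+1%:R - a) / 2) u)%:E) *
    (gamma_kernel ((n.+1%:R - b) / 2) v)%:E))%E.
have QE A : measurable A ->
    Q [set w | A (theta4_star x (Ua w) (Vb w))] = ((K' * K)%:E * I A)%E.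
  move=> mA; have mI : measurable_fun setT (\1_A : R -> R) by exact: measurable_indic.
  pose f (z : measurableTypeR R * measurableTypeR R) : \bar R :=
    (\1_A (theta4_star x z.2 z.1))%:E.
  have mf : measurable_fun setT f by rewrite /f /theta4_star; meas.
  have f0 z : (0 <= f z)%E by rewrite lee_fin.
  have mW : measurable_fun setT (fun w => theta4_star x (Ua w) (Vb w)).
    by rewrite /theta4_star; meas.
  have mE : measurable [set w | A (theta4_star x (Ua w) (Vb w))].
    by rewrite -[X in measurable X]setTI; exact: mW.
  transitivity (\int[Q]_w f (Vb w, Ua w))%E.
    transitivity (\int[Q]_w (\1_[set w | A (theta4_star x (Ua w) (Vb w))] w)%:E)%E; last by [].
    by rewrite integral_indic// setIT.
  rewrite (indep_pair_integral mV mU _ mf f0); last first.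
    by move=> A' B' mA' mB'; rewrite setIC muleC; exact: indep.
  pose h v := (\int[@lebesgue_measure R]_u
    (f (v, u) * (gamma_kernel ((n.+1%:R - a) / 2) u)%:E))%E.
  have g0 p (u : R) : (0 <= (gamma_kernel p u)%:E)%E by rewrite lee_fin gamma_kernel_ge0.
  have h0 v : (0 <= h v)%E by apply: integral_ge0 => u _; rewrite mule_ge0.
  have mh : measurable_fun setT h.
    by rewrite /h; meas_int => v u; rewrite mule_ge0.
  transitivity (\int[Q]_w (K%:E * h (Vb w)))%E.
    apply: eq_integral => w _; rewrite (dens (fun u => f (Vb w, u)))//; last by meas.
    rewrite -ge0_integralZl_EFin; last 4 first.
    - by [].
    - by move=> u _; rewrite mule_ge0.
    - by meas.
    - exact: ltW.
    by apply: eq_integral => u _; rewrite EFinM muleCA.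
  rewrite (dens' (fun v => K%:E * h v)%E); last 2 first.
  - by meas.
  - by move=> v; rewrite mule_ge0// lee_fin ltW.
  have -> : I A = (\int[@lebesgue_measure R]_v (h v * (gamma_kernel ((n.+1%:R - b) / 2) v)%:E))%E by [].
  rewrite -ge0_integralZl_EFin; last 4 first.
  - by [].
  - by move=> v _; rewrite mule_ge0.
  - by meas.
  - by apply: mulr_ge0; exact: ltW.
  apply: eq_integral => v _; rewrite [X in (_ * X)%E]EFinM [X in (_ = X * _)%E]EFinM.
  by rewrite muleACA [(K%:E * _)%E]muleC.
have KK0 : 0 < K' * K by exact: mulr_gt0.
have IE A : measurable A ->
    I A = ((K' * K)^-1%:E * Q [set w | A (theta4_star x (Ua w) (Vb w))])%E.
  by move=> mA; rewrite QE// muleA -EFinM mulVf ?gt_eqF// mul1e.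
pose c := C * (K' * K)^-1.
have c0 : 0 < c by rewrite divr_gt0.
have UE A : measurable A -> unnormalized_posterior a b x (@theta4 R @^-1` A) =
    (c%:E * Q [set w | A (theta4_star x (Ua w) (Vb w))])%E.
  by move=> mA; rewrite postE// -/(I A) IE// muleA -EFinM.
(* With the whole line in place of [B] the total mass is [c], which is positive and finite: the
   posterior is proper and [c] cancels. *)
rewrite /posterior -(preimage_setT (@theta4 R)) !UE//.
have -> : [set w | [set: R] (theta4_star x (Ua w) (Vb w))] = [set: T] by apply/seteqP.
rewrite [X in (_ / (_ * X))%E]probability_setT mule1 inver gt_eqF//.
by rewrite muleC muleA -EFinM mulVf ?gt_eqF// mul1e.
Qed.

Theorem theorem7 (R : realType) (n : nat) (a b : R)
    (hn : (3 <= n)%N) (ha : a < n%:R) (hb : b < n%:R)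
    (d' : measure_display) (T' : measurableType d') (Q : probability T' R)
    (U V Ua Vb : {RV Q >-> R})
    (hU : is_chi2 U (n%:R - 1)) (hV : is_chi2 V (n%:R - 2))
    (hUa : is_chi2 Ua (n%:R - a)) (hVb : is_chi2 Vb (n%:R - b))
    (hind : mutually_independent (fun i : 'I_4 => tnth [tuple U; V; Ua; Vb] i)) :
  [/\ (forall x : 'I_n -> R * R, nondegenerate x ->
        forall B : set R, measurable B ->
          posterior a b x (@theta4 R @^-1` B) =
          Q [set w | B (theta4_star x (Ua w) (Vb w))]),
      (forall (alpha mu1 mu2 sigma1 sigma2 rho : R),
        0 < alpha < 1 -> 0 < sigma1 -> 0 < sigma2 -> -1 < rho < 1 ->
        forall (d : measure_display) (T : measurableType d)
          (P : probability T R) (X : 'I_n -> {RV P >-> (R * R)%type}),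
          is_normal_sample X (mu1, mu2, sigma1, sigma2, rho) ->
          P [set w | theta4 (mu1, mu2, sigma1, sigma2, rho) <
               quantile Q (fun w' => theta4_star (fun k => X k w) (Ua w') (Vb w'))
                 (1 - alpha)] =
          Q [set w' | U w' / V w' <
               quantile Q (fun w' => Ua w' / Vb w') (1 - alpha)])
    & ((forall alpha : R, 0 < alpha < 1 ->
          Q [set w' | U w' / V w' <
               quantile Q (fun w' => Ua w' / Vb w') (1 - alpha)] =
          (1 - alpha)%:E)
       <-> (a, b) = (1, 2))].
Proof.
have iUV A B : measurable A -> measurable B ->
    Q (U @^-1` A `&` V @^-1` B) = (Q (U @^-1` A) * Q (V @^-1` B))%E.
  exact: (@mutually_independent_pair _ _ _ _ _ _ _ _ (@Ordinal 4 0 isT) (@Ordinal 4 1 isT) hind).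
have iab A B : measurable A -> measurable B ->
    Q (Ua @^-1` A `&` Vb @^-1` B) = (Q (Ua @^-1` A) * Q (Vb @^-1` B))%E.
  exact: (@mutually_independent_pair _ _ _ _ _ _ _ _ (@Ordinal 4 2 isT) (@Ordinal 4 3 isT) hind).
split.
- by case: n hn ha hb hU hV hUa hVb => // n _ _ _ _ _ hUa hVb; exact: posterior_theta4.
- move=> alpha mu1 mu2 sigma1 sigma2 rho al01 s1 s2 r1 d T P X lX.
  apply: (coverage_theta4_star Ua Vb hn hU hV iUV _ s1 s2 r1 lX).
  by case/andP: al01 => *; apply/andP; split; lra.
- exact: (exact_coverage_iff hn ha hb hU hV hUa hVb iUV iab).
Qed.
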